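(* Let $\Omega\subset\mathbb R^3$ be a bounded Lipschitz domain and $0<T<\infty$. Let $\varepsilon,\mu,\sigma\in L^\infty(\Omega;\mathbb R^{3\times3})$ be symmetric tensor fields such that, for some constants $\varepsilon_0,\mu_0>0$, $\xi^\top\varepsilon(x)\xi\ge\varepsilon_0|\xi|^2$ and $\xi^\top\mu(x)\xi\ge\mu_0|\xi|^2$ for all $\xi\in\mathbb R^3$ and a.e. $x\in\Omega$, and $\sigma(x)$ is positive semi-definite for a.e. $x\in\Omega$. Let $f\in L^2(0,T;L^2(\Omega)^3)$ and $E_0,B_0\in L^2(\Omega)^3$ with $\operatorname{div}B_0=0$ in $L^2(\Omega)$. Let $(E_i,B_i)$, $i=1,2$, be two weak solutions (in the sense defined in the context) of the Maxwell system with the same data $f,E_0,B_0$. Then $E_1\equiv E_2$ and $B_1\equiv B_2$ on $(0,T)$.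
   Context: $(\cdot,\cdot)$ is the $L^2$ scalar product on $\Omega$. $H(\operatorname{curl};\Omega)=\{v\in L^2(\Omega)^3:\operatorname{curl}v\in L^2(\Omega)^3\}$; $H_0(\operatorname{curl};\Omega)$ is the subspace with vanishing tangential trace $v\times\nu=0$ on $\partial\Omega$; $H(\operatorname{div}^0;\Omega)=\{v\in L^2(\Omega)^3:\operatorname{div}v=0\}$. For a Banach space $X$, $X^*$ is its dual and $\langle\cdot,\cdot\rangle_X$ the duality pairing between $X^*$ and $X$; $L^2(\Omega)^3$ is embedded in $H_0(\operatorname{curl};\Omega)^*$ and in $H(\operatorname{curl};\Omega)^*$ via $(\cdot,\cdot)$. Weak solution of the Maxwell system with data $f,E_0,B_0$: a pair $(E,B)$ with $E\in H^1(0,T;H_0(\operatorname{curl};\Omega)^* )\cap L^\infty(0,T;L^2(\Omega)^3)$ and $B\in H^1(0,T;H(\operatorname{curl};\Omega)^* )\cap L^\infty(0,T;L^2(\Omega)^3)$ such that for a.e. $t\in(0,T)$ $$\langle\varepsilon\partial_tE,\psi\rangle_{H_0(\operatorname{curl};\Omega)}+(\sigma E,\psi)-(\mu^{-1}B,\operatorname{curl}\psi)=(f,\psi)\quad\forall\psi\in H_0(\operatorname{curl};\Omega),$$ $$\langle\partial_tB,\phi\rangle_{H(\operatorname{curl};\Omega)}+(E,\operatorname{curl}\phi)=0\quad\forall\phi\in H(\operatorname{curl};\Omega),$$ with $E(0)=E_0$, $B(0)=B_0$ (for the time-continuous representatives), and, since $\operatorname{div}B_0=0$, additionally $B\in L^\infty(0,T;H(\operatorname{div}^0;\Omega))$.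 Here $\varepsilon\partial_tE$ is understood as the weak time derivative of $\varepsilon E$ in $L^2(0,T;H_0(\operatorname{curl};\Omega)^* )$. *)

(* Defs.v *)
From HB Require Import structures.
From mathcomp Require Import all_boot all_order all_algebra.
From mathcomp Require Import all_classical all_reals all_analysis.

Set Implicit Arguments.
Unset Strict Implicit.
Unset Printing Implicit Defensive.

Import Order.TTheory GRing.Theory Num.Theory.
Import numFieldNormedType.Exports.

Local Open Scope classical_set_scope.
Local Open Scope ring_scope.

(* R^3 as a space of points is [R * R * R], which carries the product Borel
   sigma-algebra; vectors (the values of fields) are columns ['cV[R]_3]. The
   indices of ['I_3] are added modulo 3. *)

Notation pt3 R := (R * R * R)%type.
Notation vf3 R := (pt3 R -> 'cV[R]_3).
Notation tf3 R := (pt3 R -> 'M[R]_3).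

Notation leb1 R := (@lebesgue_measure R).
Definition leb3 (R : realType) :
    {measure set (measurableTypeR R * measurableTypeR R * measurableTypeR R)
     -> \bar R} :=
  ((leb1 R \x leb1 R) \x leb1 R)%E.

Section Vectors.
Context {R : realType}.

Definition dot (u v : 'cV[R]_3) : R := \sum_i u i 0 * v i 0.

Definition vec (x : pt3 R) : 'cV[R]_3 :=
  \col_i [:: x.1.1; x.1.2; x.2]`_i.

Definition unitp (i : 'I_3) : pt3 R :=
  ((i == 0)%:R, (i == 1)%:R, (i == 2%:R)%:R).

Definition tapp (A : tf3 R) (u : vf3 R) : vf3 R := fun x => A x *m u x.

Definition partial (i : 'I_3) (f : pt3 R -> R) : pt3 R -> R :=
  'D_(unitp i) f.

Definition grad (f : pt3 R -> R) : vf3 R := fun x => \col_i partial i f x.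

Definition curl (u : vf3 R) : vf3 R := fun x =>
  \col_i (partial (i + 1) (fun y => u y (i + 2%:R) 0) x
          - partial (i + 2%:R) (fun y => u y (i + 1) 0) x).

End Vectors.

Section Domains.
Context {R : realType}.

(* In suitable orthonormal coordinates, near each boundary point the set is the
   strict epigraph of a Lipschitz function of two variables. *)
Definition lipschitz_boundary (Omega : set (pt3 R)) : Prop :=
  forall p, closure Omega p -> ~ interior Omega p ->
    exists (Q : 'M[R]_3) (g : R * R -> R),
      [/\ Q *m Q^T = 1%:M,
          lipschitz g &
          \forall x \near p, Omega x <->
            let y := Q *m vec x in g (y 0 0, y 1 0) < y 2%:R 0].

Definition bounded_lipschitz_domain (Omega : set (pt3 R)) : Prop :=
  [/\ Omega !=set0, open Omega, connected Omega, bounded_set Omega & lipschitz_boundary Omega].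

End Domains.

Section TestFunctions.
Context {R : realType} {V : normedModType R}.

(* In finite dimension: C^oo, i.e. all iterated directional derivatives exist
   and are continuous. *)
Definition smooth (f : V -> R) : Prop :=
  forall s : seq V, let g := foldr (fun v h => 'D_v h) f s in
    continuous g /\ forall x v, derivable g x v.

Definition test_function (U : set V) (f : V -> R) : Prop :=
  let supp := closure [set x | f x != 0] in
  [/\ smooth f, compact supp & supp `<=` U].

End TestFunctions.

(* A (semi)normed space realized as a linear subspace of [W]. Elements at
   distance zero are to be identified: no quotient is taken. *)
Record nspace (R : realType) (W : lmodType R) := NSpace {
  nset :> W -> Prop;
  nnorm : W -> R
}.

Section Spaces.
Context {R : realType}.
Variable Omega : set (pt3 R).

Definition test_field (u : vf3 R) : Prop :=
  forall i, test_function Omega (fun x => u x i 0).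

(* The scalar product of L^2(Omega)^3. *)
Definition ip (u v : vf3 R) : R :=
  \int[leb3 R]_(x in Omega) dot (u x) (v x).

Definition L2scalar (f : pt3 R -> R) : Prop :=
  measurable_fun Omega f /\ (leb3 R).-integrable Omega (fun x => (f x ^+ 2)%:E).

Definition L2 : nspace (vf3 R) := @NSpace R (vf3 R)
  [set u : vf3 R | forall i, L2scalar (fun x => u x i 0)]
  (fun u => Num.sqrt (ip u u)).

Definition Linf_tensor (A : tf3 R) : Prop :=
  (forall i j, measurable_fun Omega (fun x => A x i j)) /\
  exists M : R, {ae leb3 R, forall x, Omega x -> forall i j, `|A x i j| <= M}.

Definition weak_partial (i : 'I_3) (f g : pt3 R -> R) : Prop :=
  forall theta, test_function Omega theta ->
    \int[leb3 R]_(x in Omega) (f x * partial i theta x)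
    = - \int[leb3 R]_(x in Omega) (g x * theta x).

Definition H1 : set (vf3 R) := [set u : vf3 R | L2 u /\
  forall i j, exists2 g, L2scalar g & weak_partial j (fun x => u x i 0) g].

Definition weak_div (u : vf3 R) (g : pt3 R -> R) : Prop :=
  forall theta, test_function Omega theta ->
    ip u (grad theta) = - \int[leb3 R]_(x in Omega) (g x * theta x).

Definition Hdiv0 : nspace (vf3 R) := @NSpace R (vf3 R)
  [set u : vf3 R | L2 u /\ weak_div u (cst 0)] (nnorm L2).

Definition weak_curl (u w : vf3 R) : Prop :=
  forall theta, test_field theta -> ip u (curl theta) = ip w theta.

(* A representative of the distributional curl, for [u] in H(curl). *)
Definition curlw (u : vf3 R) : vf3 R :=
  get [set w | L2 w /\ weak_curl u w].

Definition Hcurl : nspace (vf3 R) := @NSpace R (vf3 R)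
  [set u : vf3 R | L2 u /\ exists2 w, L2 w & weak_curl u w]
  (fun u => Num.sqrt (ip u u + ip (curlw u) (curlw u))).

(* The tangential trace u x nu of u in H(curl), an element of
   H^(-1/2)(bd Omega)^3, as the functional on (traces of) H^1(Omega)^3 given by
   Green's formula:
   int_(bd Omega) (u x nu) . phi = int_O u . curl phi - int_O curl u . phi. *)
Definition tangential_trace (u phi : vf3 R) : R :=
  ip u (curlw phi) - ip (curlw u) phi.

Definition H0curl : nspace (vf3 R) := @NSpace R (vf3 R)
  [set u : vf3 R | Hcurl u /\ forall phi, H1 phi -> tangential_trace u phi = 0]
  (nnorm Hcurl).

End Spaces.

(* The dual of [X]; functionals are functions on the whole of [W], of which
   only the values on [X] matter. *)
Definition dual (R : realType) (W : lmodType R) (X : nspace W) :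
    nspace (W -> R) := @NSpace R (W -> R)
  [set l : W -> R |
    (forall a u v, X u -> X v -> l (a *: u + v) = a * l u + l v) /\
    exists C : R, forall u, X u -> `|l u| <= C * nnorm X u]
  (fun l => sup [set `|l u| | u in [set u | X u /\ nnorm X u <= 1]]).

(* The embedding of L^2(Omega)^3 into the duals of H(curl) and H_0(curl). *)
Definition emb (R : realType) (Omega : set (pt3 R)) (u : vf3 R) :
  vf3 R -> R := fun psi => ip Omega u psi.

Section Bochner.
Context {R : realType} {W : lmodType R}.
Variables (X : nspace W) (T : R).

Local Notation I := (`]0, T[%classic : set R).

Record simple_fun := SimpleFun {
  sf_size : nat;
  sf_dom : 'I_sf_size -> set R;
  sf_val : 'I_sf_size -> W
}.
Arguments sf_dom : clear implicits.
Arguments sf_val : clear implicits.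

Definition sf_wf (s : simple_fun) : Prop :=
  forall i, measurable (sf_dom s i) /\ X (sf_val s i).

Definition sf_eval (s : simple_fun) (t : R) : W :=
  \sum_(i < sf_size s) \1_(sf_dom s i) t *: sf_val s i.

Definition sf_integral (s : simple_fun) : W :=
  \sum_(i < sf_size s) fine (leb1 R (sf_dom s i `&` I)) *: sf_val s i.

Definition sf_approx (s : nat -> simple_fun) (u : R -> W) : Prop :=
  (forall n, sf_wf (s n)) /\
  {ae leb1 R, forall t, I t ->
    X (u t) /\ nnorm X (sf_eval (s n) t - u t) @[n --> \oo] --> 0}.

Definition strongly_measurable (u : R -> W) : Prop :=
  exists s, sf_approx s u.

Definition bochner_integral (u : R -> W) (w : W) : Prop :=
  exists s, [/\ sf_approx s u,
    (\int[leb1 R]_(t in I) (nnorm X (sf_eval (s n) t - u t))%:E)%E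
      @[n --> \oo] --> 0%E,
    X w &
    nnorm X (sf_integral (s n) - w) @[n --> \oo] --> 0].

(* For strongly measurable [u], the function t |-> nnorm X (u t) agrees a.e. on
   (0, T) with a Borel function, but need not be Borel itself. This is harmless
   for the integral of a nonnegative function, which is a supremum over the
   simple functions below it; [integrable] would be too strong here. *)
Definition L2t (u : R -> W) : Prop :=
  strongly_measurable u /\
  (\int[leb1 R]_(t in I) (nnorm X (u t) ^+ 2)%:E < +oo)%E.

Definition Linft (u : R -> W) : Prop :=
  strongly_measurable u /\
  exists M : R, {ae leb1 R, forall t, I t -> nnorm X (u t) <= M}.

(* int_0^T theta' u = w = - int_0^T theta u' in X. *)
Definition weak_time_deriv (u u' : R -> W) : Prop :=
  forall theta : R -> R, test_function I theta ->
    exists w, bochner_integral (fun t => derive1 theta t *: u t) w /\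
              bochner_integral (fun t => theta t *: u' t) (- w).

Definition H1t (u : R -> W) : Prop :=
  L2t u /\ exists2 u', L2t u' & weak_time_deriv u u'.

(* u(0) = w0 for the representative of u in C([0, T]; X). *)
Definition initial_value (u : R -> W) (w0 : W) : Prop :=
  exists g : R -> W,
    [/\ forall t, `[0, T]%classic t -> X (g t),
        forall t, `[0, T]%classic t ->
          nnorm X (g s - g t) @[s --> within `[0, T]%classic (nbhs t)] --> 0,
        {ae leb1 R, forall t, I t -> nnorm X (g t - u t) = 0},
        X w0 &
        nnorm X (g 0 - w0) = 0].

End Bochner.

Section Maxwell.
Context {R : realType}.
Variables (Omega : set (pt3 R)) (T : R) (eps mu sigma : tf3 R).
Variables (f : R -> vf3 R) (E0 B0 : vf3 R).

(* [dD] is the weak time derivative of eps E in L^2(0, T; H_0(curl)^* ). *)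
Record maxwell_weak_solution (E B : R -> vf3 R) : Prop := {
  mws_E_H1 : H1t (dual (H0curl Omega)) T (fun t => emb Omega (E t));
  mws_E_Linf : Linft (L2 Omega) T E;
  mws_B_H1 : H1t (dual (Hcurl Omega)) T (fun t => emb Omega (B t));
  mws_B_Linf : Linft (L2 Omega) T B;
  mws_ampere : exists dD : R -> vf3 R -> R,
    [/\ L2t (dual (H0curl Omega)) T dD,
        weak_time_deriv (dual (H0curl Omega)) T
          (fun t => emb Omega (tapp eps (E t))) dD &
        {ae leb1 R, forall t, `]0, T[%classic t ->
          forall psi, H0curl Omega psi ->
            dD t psi + ip Omega (tapp sigma (E t)) psi
            - ip Omega (tapp (fun x => invmx (mu x)) (B t)) (curlw Omega psi)
            = ip Omega (f t) psi}];
  mws_faraday : exists dB : R -> vf3 R -> R,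
    [/\ L2t (dual (Hcurl Omega)) T dB,
        weak_time_deriv (dual (Hcurl Omega)) T (fun t => emb Omega (B t)) dB &
        {ae leb1 R, forall t, `]0, T[%classic t ->
          forall phi, Hcurl Omega phi ->
            dB t phi + ip Omega (E t) (curlw Omega phi) = 0}];
  mws_E_init :
    initial_value (dual (H0curl Omega)) T (fun t => emb Omega (E t)) (emb Omega E0);
  mws_B_init :
    initial_value (dual (Hcurl Omega)) T (fun t => emb Omega (B t)) (emb Omega B0);
  mws_B_div : Linft (Hdiv0 Omega) T B
}.

End Maxwell.

(* Main.v *)
Require Import Defs.
From HB Require Import structures.
From mathcomp Require Import all_boot all_order all_algebra.
From mathcomp Require Import all_classical all_reals all_analysis.
From mathcomp Require Import measurable_realfun.
From mathcomp Require Import ring lra.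

Set Implicit Arguments.
Unset Strict Implicit.
Unset Printing Implicit Defensive.

Import Order.TTheory GRing.Theory Num.Theory.
Import numFieldNormedType.Exports.

Local Open Scope classical_set_scope.
Local Open Scope ring_scope.

(** The system is linear, so the difference [(E, B)] of two solutions solves the
    homogeneous system with zero initial data. If [E] and [B] were admissible
    test functions, uniqueness would follow at once from the energy identity
    [d/dt ((eps E, E) + (mu^-1 B, B)) = - 2 (sigma E, E) <= 0]. They are not:
    they are merely bounded in time with values in [L^2], and their curls are
    distributions. The remedy is to integrate the system twice in time. For the
    first and second primitives [PE], [PPE], [PB], [PPB], which are fields in
    [L^2], it reads
    - [(PB(t), phi) = - (PPE(t), curl phi)] for all [phi] in [H(curl)],
    - [(PE(t), eps psi) = (PPB(t), mu^-1 curl psi) - (PPE(t), sigma psi)] for all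
      [psi] in [H_0(curl)].
    Because [phi] need not vanish on the boundary, the first line says that
    [PPE(t)] lies in [H_0(curl)] and has curl [- PB(t)] ([H0curl_by_parts]). So
    [psi = PPE(t)] is allowed in the second line, and
    [(eps PE, PPE) + (mu^-1 PB, PPB) = - (sigma PPE, PPE) <= 0].
    The left-hand side is half the derivative of the energy
    [y = (eps PPE, PPE) + (mu^-1 PPB, PPB)]. Rather than differentiate [y], one
    uses that [PPE(t) - PPE(s) - (t - s) PE(s)] is of second order in [t - s]:
    thus [y(t) - y(s) <= C (t - s)^2], and as [y(0) = 0] a subdivision of [0, t]
    gives [y <= 0] ([square_increments_le]). Coercivity of [eps] yields [PPE = 0],
    whence [PE = 0], and also [PB = - curl PPE = 0] ([energy_primitives0]). By
    Lebesgue differentiation a bounded field with vanishing primitives is zero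
    almost everywhere ([strong_limit_ae_eq0]).

    The integrated system is obtained from the weak formulation by fixing [psi].
    Bochner integrals in the dual then become scalar integrals ([bochner_apply]),
    and the weak derivative in time is tested with smooth cutoffs that converge
    to [r |-> max (t - r) 0] ([time_primitive]); the initial condition disposes of
    the boundary layer at [0]. The forcing term cancels in the difference
    ([weak_primitive]).

    Three facts about [L^2] support this. It is complete, which provides the
    primitives as fields ([L2_complete], [strong_integral]). Test fields are
    dense in it ([test_field_dense]), which makes weak curls unique and allows
    the initial condition to be tested with [eps psi], a field that need not lie in
    [H_0(curl)]. And test functions satisfy integration by parts
    ([integral_partial_eq0]), which makes them elements of [H_0(curl)]. *)

(** * Smooth functions built from a flat exponential *)

Section FlatExponential.
Context {R : realType}.
Implicit Types (k : nat) (x : R).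

(** The functions [x^-k exp (- 1/x)] for [x > 0], extended by zero. Admitting all
    [k] at once makes the family closed under differentiation. *)
Definition flat_exp k x : R := if 0 < x then x^-1 ^+ k * expR (- x^-1) else 0.

Lemma flat_exp_le0 k x : x <= 0 -> flat_exp k x = 0.
Proof. by rewrite /flat_exp ltNge => ->. Qed.

Lemma flat_exp_ge0 k x : 0 <= flat_exp k x.
Proof.
rewrite /flat_exp; case: ifP => // x0.
by rewrite mulr_ge0 ?expR_ge0// exprn_ge0// invr_ge0 ltW.
Qed.

(** The exponential beats every power: [(1/x)^(k+1) <= (k+1)! exp (1/x)]. *)
Lemma flat_exp_le k x : flat_exp k x <= k.+1`!%:R * `|x|.
Proof.
rewrite /flat_exp; case: ifPn => [x0|]; last by rewrite mulr_ge0.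
have u0 : 0 < x^-1 by rewrite invr_gt0.
have H : x^-1 ^+ k.+1 <= k.+1`!%:R * expR x^-1.
  have := expR_ge1Dxn k (ltW u0).
  set a := x^-1 ^+ k.+1; set b := _%:R; set e := expR _ => h.
  have b0 : 0 < b by rewrite ltr0n fact_gt0.
  by rewrite -ler_pdivrMl// mulrC; apply: le_trans h; rewrite lerDr.
rewrite gtr0_norm// expRN ler_pdivrMr ?expR_gt0//.
rewrite mulrAC -ler_pdivrMr//.
by rewrite -exprSr.
Qed.

Lemma is_derive_flat_exp k x :
  is_derive x 1 (flat_exp k) (flat_exp k.+2 x - k%:R * flat_exp k.+1 x).
Proof.
have [x0|x0|->] := ltgtP x 0.
- rewrite !flat_exp_le0 ?ltW// mulr0 subr0.
  apply: (@near_eq_is_derive _ _ _ (cst 0)).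
  near=> y; rewrite flat_exp_le0//; apply/ltW; near: y.
  exact: lt_nbhsl.
- have xN0 : x != 0 by rewrite gt_eqF.
  apply: (@near_eq_is_derive _ _ _ (fun y : R => y^-1 ^+ k * expR (- y^-1))).
    near=> y; rewrite /flat_exp ifT//; near: y.
    exact: lt_nbhsr.
  rewrite /flat_exp x0.
  have d1 : is_derive x 1 (fun y : R => y^-1) (- x ^- 2).
    have := @is_deriveV R id x 1 1 xN0 (is_derive_id x 1).
    by rewrite /GRing.scale/= mulr1.
  have d2 : is_derive x 1 (fun y : R => (expR \o (fun y => - y^-1)) y)
      (x ^- 2 * expR (- x^-1)).
    apply: is_derive_eq.
    by rewrite /= /GRing.scale/= opprK mulr1 mulrC.
  have d3 : is_derive x 1 (fun y : R => y^-1 ^+ k) (- k%:R * x^-1 ^+ k.+1).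
    have -> : (fun y : R => y^-1 ^+ k) = (fun y : R => y^-1) ^+ k.
      apply/funext => y; elim: k => [|k IH]; first by rewrite !expr0.
      by rewrite !exprS IH.
    apply: is_derive_eq.
    rewrite /GRing.scale/=.
    case: k => [|k]; first by rewrite !mul0r oppr0 mul0r.
    by rewrite /= -exprVn !exprS; ring.
  apply: is_derive_eq.
  rewrite /GRing.scale/= -exprVn !exprS; ring.
- (* at 0 the difference quotient is [flat_exp k.+1], which tends to 0 *)
  rewrite !flat_exp_le0// mulr0 subr0.
  suff H : (fun h : R => h^-1 *: ((flat_exp k \o shift 0) (h *: 1) - flat_exp k 0))
      @ 0^' --> (0 : R).
    apply: DeriveDef; first exact: (cvgP _ H).
    exact: cvg_lim H.
  apply/cvgrPdist_le => e e0; near=> h.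
  rewrite sub0r normrN /= /GRing.scale/= mulr1 addr0 (flat_exp_le0 _ (lexx 0)) subr0.
  have -> : h^-1 * flat_exp k h = flat_exp k.+1 h.
    by rewrite /flat_exp; case: ifP; rewrite ?mulr0// exprS mulrA.
  rewrite ger0_norm ?flat_exp_ge0//.
  apply: le_trans (flat_exp_le _ _) _.
  rewrite -ler_pdivlMl ?ltr0n ?fact_gt0//.
  near: h; apply: dnbhs0_le.
  by rewrite mulr_gt0// invr_gt0 ltr0n fact_gt0.
Unshelve. all: by end_near. Qed.

End FlatExponential.

Section SmoothClass.
Context {R : realType} {V : normedModType R}.
Implicit Types f g : V -> R.

(** A class of functions closed under directional derivatives, so that all of
    them are smooth: beyond sums, products and inverses, composition is only
    allowed with the functions [flat_exp k], whose derivatives are again of that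
    form. *)
Inductive elementary : (V -> R) -> Prop :=
| elementary_cst c : elementary (cst c)
| elementary_affine f c : (forall x, differentiable f x) ->
    (forall x v, 'D_v f x = c v) -> elementary f
| elementaryD f g : elementary f -> elementary g ->
    elementary (fun x => f x + g x)
| elementaryM f g : elementary f -> elementary g ->
    elementary (fun x => f x * g x)
| elementary_flat k f : elementary f -> elementary (fun x => flat_exp k (f x))
| elementaryV f : (forall x, f x != 0) -> elementary f ->
    elementary (fun x => (f x)^-1).

Lemma differentiable_flat_exp k x : differentiable (@flat_exp R k) x.
Proof.
by apply/derivable1_diffP; case: (is_derive_flat_exp k x).
Qed.

Lemma elementary_differentiable f x : elementary f -> differentiable f x.
Proof.
elim=> {f}.
- by move=> c; exact: differentiable_cst.
- by [].
- by move=> f g _ df _ dg; exact: differentiableD.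
- by move=> f g _ df _ dg; exact: differentiableM.
- move=> k f _ df; apply: differentiable_comp => //.
  exact: differentiable_flat_exp.
- by move=> f f0 _ df; exact: differentiableV.
Qed.

(** The derivative rules produce nothing outside the class; in particular
    [(1/f)' = - f' / f^2], and [flat_exp k] yields [flat_exp k.+2] and
    [flat_exp k.+1]. *)
Lemma elementary_derive f v : elementary f -> elementary ('D_v f).
Proof.
elim=> {f}.
- move=> c; have -> : 'D_v (cst c) = cst (0 : R).
    by apply/funext => x; rewrite derive_cst.
  exact: elementary_cst.
- move=> f c _ fc; have -> : 'D_v f = cst (c v) by apply/funext => x; rewrite fc.
  exact: elementary_cst.
- move=> f g ef Df eg Dg.
  have -> : 'D_v (fun x => f x + g x) = (fun x => 'D_v f x + 'D_v g x).
    apply/funext => x; rewrite -[LHS]/('D_v (f + g) x) deriveD//;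
    by apply: diff_derivable; exact: elementary_differentiable.
  exact: elementaryD.
- move=> f g ef Df eg Dg.
  have -> : 'D_v (fun x => f x * g x) = (fun x => f x * 'D_v g x + g x * 'D_v f x).
    apply/funext => x; rewrite -[LHS]/('D_v (f * g) x) deriveM//;
    by apply: diff_derivable; exact: elementary_differentiable.
  by apply: elementaryD; apply: elementaryM.
- move=> k f ef Df.
  have -> : 'D_v (fun x => flat_exp k (f x)) =
      (fun x => (flat_exp k.+2 (f x) + (cst (- k%:R) x * flat_exp k.+1 (f x)))
                 * 'D_v f x).
    apply/funext => x.
    have df := elementary_differentiable x ef.
    have dh := differentiable_flat_exp k (f x).
    rewrite deriveE; last exact: differentiable_comp.
    rewrite [X in 'd X x](_ : _ = flat_exp k \o f)//.
    rewrite diff_comp//= diff1E// /= /GRing.scale/= -deriveE// mulrC derive1E.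
    have [_ ->] := is_derive_flat_exp k (f x).
    by rewrite mulNr.
  apply: elementaryM => //; apply: elementaryD; first exact: elementary_flat.
  by apply: elementaryM; [exact: elementary_cst|exact: elementary_flat].
- move=> f f0 ef Df.
  have -> : 'D_v (fun x => (f x)^-1) =
      (fun x => (cst (-1) x * ((f x)^-1 * (f x)^-1)) * 'D_v f x).
    apply/funext => x.
    rewrite deriveV//; last by apply: diff_derivable; exact: elementary_differentiable.
    by rewrite /GRing.scale/= mulN1r -exprVn expr2.
  by apply: elementaryM => //; apply: elementaryM; [exact: elementary_cst|];
    apply: elementaryM; exact: elementaryV.
Qed.

Lemma elementary_smooth f : elementary f -> smooth f.
Proof.
move=> ef s /=.
have es : elementary (foldr (fun v h => 'D_v h) f s).
  by elim: s => //= v s; exact: elementary_derive.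
split=> [x|x v].
  by apply: differentiable_continuous; exact: elementary_differentiable.
by apply: diff_derivable; exact: elementary_differentiable.
Qed.

End SmoothClass.

Section SmoothStep.
Context {R : realType}.

(** The usual smooth transition from [0] on the left of [0] to [1] on the right
    of [1]; one of the two terms of the denominator is always positive. *)
Definition step (x : R) : R :=
  flat_exp 0 x * (flat_exp 0 x + flat_exp 0 (1 - x))^-1.

Lemma flat_exp_gt0 k (x : R) : 0 < x -> 0 < flat_exp k x.
Proof.
by move=> x0; rewrite /flat_exp x0 mulr_gt0 ?expR_gt0// exprn_gt0// invr_gt0.
Qed.

Lemma step_denom_gt0 (x : R) : 0 < flat_exp 0 x + flat_exp 0 (1 - x).
Proof.
have [x0|x0] := leP x 0.
  by rewrite ltr_wpDl ?flat_exp_ge0// flat_exp_gt0; lra.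
by rewrite ltr_wpDr ?flat_exp_ge0// flat_exp_gt0; lra.
Qed.

Lemma step_le0 (x : R) : x <= 0 -> step x = 0.
Proof. by move=> x0; rewrite /step flat_exp_le0// mul0r. Qed.

Lemma step_ge1 (x : R) : 1 <= x -> step x = 1.
Proof.
move=> x1; rewrite /step (@flat_exp_le0 _ 0 (1 - x)) ?addr0; last lra.
by rewrite divff// gt_eqF// flat_exp_gt0; lra.
Qed.

Lemma step_ge0 (x : R) : 0 <= step x.
Proof.
by rewrite /step mulr_ge0 ?flat_exp_ge0// invr_ge0 ltW// step_denom_gt0.
Qed.

Lemma step_le1 (x : R) : step x <= 1.
Proof.
rewrite /step ler_pdivrMr ?step_denom_gt0// mul1r lerDl; exact: flat_exp_ge0.
Qed.

Lemma elementary_step (V : normedModType R) (f : V -> R) :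
  elementary f -> elementary (fun x => step (f x)).
Proof.
move=> ef; have ef1 : elementary (fun x => 1 - f x).
  apply: (@elementaryD _ _ (cst 1) (fun x => - f x)).
    exact: elementary_cst.
  have -> : (fun x => - f x) = (fun x => cst (-1) x * f x).
    by apply/funext => x; rewrite mulN1r.
  by apply: elementaryM => //; exact: elementary_cst.
apply: elementaryM; first exact: elementary_flat.
apply: elementaryV; first by move=> x; rewrite gt_eqF// step_denom_gt0.
by apply: elementaryD; exact: elementary_flat.
Qed.

Lemma elementary_id : elementary (@id R).
Proof. by apply: (@elementary_affine _ _ _ id) => // x v; rewrite derive_id. Qed.

Lemma elementary_step_id : elementary step.
Proof. exact: elementary_step elementary_id. Qed.

Lemma derivable_step (x : R) : derivable step x 1.
Proof.
apply: diff_derivable; apply: elementary_differentiable.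
exact: elementary_step_id.
Qed.

Lemma continuous_step : continuous step.
Proof.
move=> x; apply: differentiable_continuous; apply: elementary_differentiable.
exact: elementary_step_id.
Qed.

Lemma continuous_derive1_step : continuous (derive1 step).
Proof.
move=> x; have -> : derive1 step = 'D_1 step by apply/funext => y; rewrite derive1E.
apply: differentiable_continuous; apply: elementary_differentiable.
exact/elementary_derive/elementary_step_id.
Qed.

Lemma derive1_step_out (x : R) : x < 0 \/ 1 < x -> derive1 step x = 0.
Proof.
move=> [x0|x1]; rewrite derive1E.
  rewrite (@near_eq_derive _ _ _ _ (cst 0)) ?derive_cst ?oner_neq0//.
  by near=> y; rewrite step_le0//; apply/ltW; near: y; exact: lt_nbhsl.
rewrite (@near_eq_derive _ _ _ _ (cst (1 : R))) ?derive_cst ?oner_neq0//.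
by near=> y; rewrite step_ge1//; apply/ltW; near: y; exact: lt_nbhsr.
Unshelve. all: by end_near. Qed.

(** Off [0, 1] the step is locally constant, and on [0, 1] a continuous function
    attains its maximum. *)
Lemma derive1_step_bounded : exists2 C : R, 0 < C & forall x, `|derive1 step x| <= C.
Proof.
have cf : {within `[0, 1]%classic, continuous (fun x => `|derive1 step x|)}.
  apply: continuous_subspaceT => x.
  by apply: continuous_comp; [exact: continuous_derive1_step|exact: norm_continuous].
have [c _ hc] := @EVT_max R _ 0 1 ler01 cf.
exists (`|derive1 step c| + 1); first by rewrite ltr_wpDl.
move=> x; have [x0|x0] := ltP x 0.
  by rewrite derive1_step_out ?normr0 ?addr_ge0//; left.
have [x1|x1] := ltP 1 x.
  by rewrite derive1_step_out ?normr0 ?addr_ge0//; right.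
by rewrite (le_trans (hc x _))// ?in_itv/= ?x0// lerDl.
Qed.

End SmoothStep.

(** * Square integrable functions *)

Section SquareIntegrable.
Context d (T : measurableType d) (R : realType) (mu : {measure set T -> \bar R}).
Variables (D : set T) (mD : measurable D).
Implicit Types f g h : T -> R.

Definition sq_integrable f :=
  measurable_fun D f /\ mu.-integrable D (fun x => (f x ^+ 2)%:E).

Local Notation sq f g := (\int[mu]_(x in D) (f x - g x) ^+ 2).

Lemma integrable_EFinD f g : mu.-integrable D (fun x => (f x)%:E) ->
  mu.-integrable D (fun x => (g x)%:E) -> mu.-integrable D (fun x => (f x + g x)%:E).
Proof. by move=> hf hg; exact: (integrableD mD hf hg). Qed.

Lemma integrable_EFinB f g : mu.-integrable D (fun x => (f x)%:E) ->
  mu.-integrable D (fun x => (g x)%:E) -> mu.-integrable D (fun x => (f x - g x)%:E).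
Proof. by move=> hf hg; exact: (integrableB mD hf hg). Qed.

Lemma integrable_EFinZ (k : R) f : mu.-integrable D (fun x => (f x)%:E) ->
  mu.-integrable D (fun x => (k * f x)%:E).
Proof. by move=> hf; exact: (integrableZl mD k hf). Qed.

Lemma integrable_EFin_le f g : measurable_fun D f ->
  (forall x, D x -> `|f x| <= g x) -> mu.-integrable D (fun x => (g x)%:E) ->
  mu.-integrable D (fun x => (f x)%:E).
Proof.
move=> mf fg; apply: le_integrable => //; first exact/measurable_EFinP.
by move=> x Dx; rewrite !abse_EFin lee_fin (le_trans (fg _ Dx))// ler_norm.
Qed.

Lemma sq_integrableM f g : sq_integrable f -> sq_integrable g ->
  mu.-integrable D (fun x => (f x * g x)%:E).
Proof.
move=> [mf f2] [mg g2]; apply: integrable_EFin_le (integrable_EFinD f2 g2).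
  exact: measurable_funM.
move=> x _; rewrite normrM -[f x ^+ 2]real_normK ?num_real//.
rewrite -[g x ^+ 2]real_normK ?num_real//.
by have := sqr_ge0 (`|f x| - `|g x|); nra.
Qed.

Lemma sq_integrableD f g : sq_integrable f -> sq_integrable g ->
  sq_integrable (fun x => f x + g x).
Proof.
move=> Lf Lg; split; first by apply: measurable_funD; [case: Lf|case: Lg].
have fg := sq_integrableM Lf Lg.
have -> : (fun x => ((f x + g x) ^+ 2)%:E) =
    (fun x => ((f x ^+ 2 + (2 * (f x * g x))) + g x ^+ 2)%:E).
  by apply/funext => x; congr EFin; ring.
apply: integrable_EFinD; last by case: Lg.
by apply: integrable_EFinD; [case: Lf|exact: integrable_EFinZ].
Qed.

Lemma sq_integrableZ k f : sq_integrable f -> sq_integrable (fun x => k * f x).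
Proof.
move=> [mf f2]; split; first exact: measurable_funM.
under eq_fun do rewrite exprMn.
exact: integrable_EFinZ.
Qed.

Lemma sq_integrableN f : sq_integrable f -> sq_integrable (fun x => - f x).
Proof.
move=> Lf; have := sq_integrableZ (-1) Lf.
by under eq_fun do rewrite mulN1r.
Qed.

Lemma sq_integrableB f g : sq_integrable f -> sq_integrable g ->
  sq_integrable (fun x => f x - g x).
Proof. by move=> Lf Lg; apply: sq_integrableD => //; exact: sq_integrableN. Qed.

Lemma sq_integrable0 : sq_integrable (fun=> 0).
Proof.
split; first exact: measurable_cst.
under eq_fun do rewrite expr0n/=.
exact: integrable0.
Qed.

Lemma sq_integrable_sum (I : Type) (s : seq I) (F : I -> T -> R) :
  (forall i, sq_integrable (F i)) -> sq_integrable (fun x => \sum_(i <- s) F i x).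
Proof.
move=> LF; elim: s => [|a s IH].
  under eq_fun do rewrite big_nil.
  exact: sq_integrable0.
under eq_fun do rewrite big_cons.
exact: sq_integrableD.
Qed.

Lemma sq_integrable_le f g : measurable_fun D f -> sq_integrable g ->
  (forall x, D x -> `|f x| <= `|g x|) -> sq_integrable f.
Proof.
move=> mf [mg g2] fg; split=> //; apply: integrable_EFin_le g2.
  exact: measurable_funX.
move=> x Dx; rewrite normrX -[g x ^+ 2]real_normK ?num_real//.
by rewrite lerXn2r ?nnegrE//; exact: fg.
Qed.

Lemma eq_ae_Rintegral f g : measurable_fun D f -> measurable_fun D g ->
  {ae mu, forall x, D x -> f x = g x} ->
  \int[mu]_(x in D) f x = \int[mu]_(x in D) g x.
Proof.
move=> mf mg fg; congr fine; apply: ae_eq_integral => //.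
- exact/measurable_EFinP.
- exact/measurable_EFinP.
- by apply: filterS fg => x fg Dx; rewrite fg.
Qed.

Lemma Rintegral_sq_eq0 f : sq_integrable f -> \int[mu]_(x in D) (f x ^+ 2) = 0 ->
  {ae mu, forall x, D x -> f x = 0}.
Proof.
move=> [mf f2] f0.
have : (\int[mu]_(x in D) `|(f x ^+ 2)%:E|)%E = 0%E.
  under eq_integral do rewrite gee0_abs ?lee_fin ?sqr_ge0//.
  rewrite -[LHS]fineK; first by congr EFin.
  exact: integrable_fin_num.
move/(ae_eq_integral_abs mu mD (measurable_int _ f2)); apply: filterS => x + Dx.
by move=> /(_ Dx)/= [] /eqP; rewrite sqrf_eq0 => /eqP.
Qed.

(** From [(a + b)^2 <= 2 a^2 + 2 b^2]. The factor 2 does no harm in limit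
    arguments and spares square roots. *)
Lemma sq_triangle f g h : sq_integrable f -> sq_integrable g -> sq_integrable h ->
  sq f h <= 2 * sq f g + 2 * sq g h.
Proof.
move=> Lf Lg Lh.
have [_ ifg] := sq_integrableB Lf Lg; have [_ igh] := sq_integrableB Lg Lh.
have [_ ifh] := sq_integrableB Lf Lh.
rewrite -!RintegralZl// -RintegralD//; [|exact: integrable_EFinZ..].
apply: le_Rintegral => //.
  by apply: integrable_EFinD; exact: integrable_EFinZ.
by move=> x _; have := sqr_ge0 (f x - g x - (g x - h x)); nra.
Qed.

(** The Riesz-Fischer argument, along a sequence whose increments decay
    geometrically: [G = sum_k 4^k (f_(k+1) - f_k)^2] is integrable, and pointwise
    the increments are at most [2^-k sqrt G], hence summable. *)
Lemma sq_integrable_fast_limit (f : nat -> T -> R) :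
  (forall n, sq_integrable (f n)) ->
  (forall n, sq (f n.+1) (f n) <= 16^-1 ^+ n) ->
  exists2 g, sq_integrable g & exists C : R, forall n, sq (f n) g <= C * 4^-1 ^+ n.
Proof.
move=> Lf fn.
pose del n x := f n.+1 x - f n x.
have Ldel n : sq_integrable (del n) by exact: sq_integrableB.
pose G x : \bar R := (\sum_(k <oo) (4 ^+ k * del k x ^+ 2)%:E)%E.
have term_ge0 k x : (0%R <= (4 ^+ k * del k x ^+ 2)%:E)%E.
  by rewrite lee_fin mulr_ge0 ?sqr_ge0 ?exprn_ge0.
have mterm k : measurable_fun D (fun x => (4 ^+ k * del k x ^+ 2)%:E).
  apply/measurable_EFinP/measurable_funM => //.
  by apply: measurable_funX; case: (Ldel k).
have mG : measurable_fun D G by apply: ge0_emeasurable_sum.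
have G_ge0 x : (0%R <= G x)%E by apply: nneseries_ge0.
have intG : (\int[mu]_(x in D) G x <= 2%:E)%E.
  rewrite /G integral_nneseries//.
  apply: (@le_trans _ _ (\sum_(k <oo) (2 / (2 ^ k.+1)%:R)%:E)%E); last first.
    exact: epsilon_trick0.
  apply: lee_nneseries => k _; first by move=> _; exact: integral_ge0.
  have -> : (\int[mu]_(x in D) (4 ^+ k * del k x ^+ 2)%:E =
      (\int[mu]_(x in D) (4 ^+ k * del k x ^+ 2))%:E)%E.
    rewrite fineK//; apply: integrable_fin_num => //.
    by apply: integrable_EFinZ; case: (Ldel k).
  rewrite lee_fin RintegralZl//; last by case: (Ldel k).
  apply: le_trans (ler_wpM2l _ (fn k)) _; first exact: exprn_ge0.
  have -> : 2 / (2 ^ k.+1)%:R = 2^-1 ^+ k :> R.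
    by rewrite natrX exprS invfM mulrA divff// mul1r exprVn.
  rewrite -exprMn; apply: lerXn2r; rewrite ?nnegrE; lra.
have iG : mu.-integrable D G.
  apply/integrableP; split=> //.
  under eq_integral do rewrite gee0_abs//.
  by apply: le_lt_trans intG _; rewrite ltry.
have /(integrable_ae mD)[N [mN N0 DN]] := iG.
have GfinN x : D x -> ~ N x -> G x \is a fin_num.
  by move=> Dx Nx; apply: contrapT => Gx; apply: Nx; apply: DN => /= /(_ Dx).
have del_le x k : D x -> ~ N x -> `|del k x| <= Num.sqrt (fine (G x)) * 2^-1 ^+ k.
  move=> Dx Nx.
  have h : 4 ^+ k * del k x ^+ 2 <= fine (G x).
    rewrite -lee_fin fineK ?GfinN//.
    have := @nneseries_lim_ge R (fun k => (4 ^+ k * del k x ^+ 2)%:E) xpredT 0 k.+1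
      (fun n _ _ => term_ge0 n x).
    apply: le_trans; rewrite big_nat_recr//= leeDr//.
    exact: sume_ge0.
  rewrite -(@ler_pXn2r _ 2)// ?nnegrE ?mulr_ge0 ?sqrtr_ge0 ?exprn_ge0//.
  rewrite exprMn sqr_sqrtr ?fine_ge0// -exprM mulnC exprM real_normK ?num_real//.
  have -> : (2^-1 ^+ 2) ^+ k = (4 ^+ k)^-1 :> R by rewrite -exprVn; congr (_ ^+ k); lra.
  by rewrite ler_pdivlMr ?exprn_gt0// mulrC.
have fE x n : f n x = f 0%N x + series (del ^~ x) n.
  elim: n => [|n IH]; first by rewrite /series/= big_geq ?addr0.
  by rewrite seriesSr addrA -IH /del addrC subrK.
have cvg_del x : D x -> ~ N x -> cvgn (series (del ^~ x)).
  move=> Dx Nx; apply: normed_cvg.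
  apply: (@series_le_cvg _ _ (fun k => Num.sqrt (fine (G x)) * 2^-1 ^+ k)).
  - by move=> n /=; rewrite normr_ge0.
  - by move=> n; rewrite mulr_ge0 ?sqrtr_ge0 ?exprn_ge0.
  - by move=> n; exact: del_le.
  - by apply: is_cvg_geometric_series; rewrite ger0_norm; lra.
(* putting the sequence to 0 on the exceptional set [N] makes it converge
   everywhere on [D], hence to a measurable limit *)
pose fN n x := f n x * \1_(~` N) x.
pose g x := limn (fun n => fN n x).
have fN_out x n : ~ N x -> fN n x = f n x.
  by move=> Nx; rewrite /fN indicE mem_set ?mulr1.
have fN_in x n : N x -> fN n x = 0.
  by move=> Nx; rewrite /fN indicE memNset ?mulr0//=; exact.
have cvg_g x : D x -> fN n x @[n --> \oo] --> g x.
  move=> Dx; rewrite /g; have [Nx|Nx] := pselect (N x).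
    under eq_fun do rewrite fN_in//.
    exact: is_cvg_cst.
  under eq_fun do rewrite fN_out// fE.
  apply: is_cvgD; first exact: is_cvg_cst.
  exact: cvg_del.
have mfN n : measurable_fun D (fN n).
  apply: measurable_funM; first by case: (Lf n).
  by apply: measurable_indic; exact: measurableC.
have mg : measurable_fun D g by apply: measurable_fun_cvg cvg_g.
(* the factor [1 - 2^-m] makes the induction on [m] go through *)
have tail x n m : D x -> ~ N x ->
    `|f (n + m)%N x - f n x| <= 2 * Num.sqrt (fine (G x)) * 2^-1 ^+ n.
  move=> Dx Nx; set h := Num.sqrt _.
  have h0 : 0 <= h by rewrite sqrtr_ge0.
  suff : `|f (n + m)%N x - f n x| <= 2 * h * 2^-1 ^+ n * (1 - 2^-1 ^+ m).
    move=> H; apply: le_trans H _; apply: ler_piMr.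
      by rewrite !mulr_ge0// exprn_ge0.
    by rewrite gerBl exprn_ge0.
  elim: m => [|m IH]; first by rewrite addn0 subrr normr0 expr0 subrr mulr0.
  rewrite addnS -[f _ x](subrK (f (n + m)%N x)) -addrA.
  apply: le_trans (ler_normD _ _) _.
  apply: le_trans (lerD (del_le _ _ Dx Nx) IH) _.
  rewrite exprD exprS; set a := 2^-1 ^+ n; set b := 2^-1 ^+ m.
  rewrite -/h; have : h * a * b = 2 * (h * a * (2^-1 * b)) by field.
  lra.
have gtail x n : D x -> ~ N x -> (f n x - g x) ^+ 2 <= 4 * 4^-1 ^+ n * fine (G x).
  move=> Dx Nx.
  have : `|g x - f n x| <= 2 * Num.sqrt (fine (G x)) * 2^-1 ^+ n.
    have c : fN m x - f n x @[m --> \oo] --> g x - f n x.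
      by apply: cvgB; [exact: cvg_g|exact: cvg_cst].
    apply: (closed_cvg (fun z : R => `|z| <= _)) c.
      exact: (@closed_comp _ _ (fun z : R => `|z|) _ (fun z _ => @norm_continuous _ _ z)
        (@closed_le _ _)).
    exists n => // m /= nm; rewrite fN_out// -(subnKC nm); exact: tail.
  rewrite -(@ler_pXn2r _ 2)// ?nnegrE ?mulr_ge0 ?sqrtr_ge0 ?exprn_ge0//.
  rewrite real_normK ?num_real// !exprMn sqr_sqrtr ?fine_ge0//.
  have -> : (2^-1 ^+ n) ^+ 2 = 4^-1 ^+ n :> R.
    by rewrite -exprM mulnC exprM; congr (_ ^+ n); lra.
  lra.
have ifG : mu.-integrable (D `\` N) (fun x => (fine (G x))%:E).
  apply: (@eq_integrable _ _ _ mu (D `\` N) _ G).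
  - exact: measurableD.
  - by move=> x; rewrite inE => -[Dx Nx]; rewrite fineK ?GfinN.
  - by apply: integrableS iG => //; exact: measurableD.
have ifgN n : mu.-integrable (D `\` N) (fun x => ((f n x - g x) ^+ 2)%:E).
  apply: (@le_integrable _ _ _ mu (D `\` N) _ _
     (fun x => (4 * 4^-1 ^+ n * fine (G x))%:E)).
  - exact: measurableD.
  - apply/measurable_EFinP/measurable_funX/(measurable_funS mD) => //.
    by apply: measurable_funB => //; case: (Lf n).
  - move=> x [Dx Nx]; rewrite !abse_EFin lee_fin.
    rewrite ger0_norm ?sqr_ge0//; apply: le_trans (gtail _ _ Dx Nx) _.
    exact: ler_norm.
  - by apply: (integrableZl _ _ ifG); exact: measurableD.
have ifg n : mu.-integrable D (fun x => ((f n x - g x) ^+ 2)%:E).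
  have mfg : measurable_fun D (fun x => ((f n x - g x) ^+ 2)%:E).
    apply/measurable_EFinP/measurable_funX.
    by apply: measurable_funB => //; case: (Lf n).
  by apply/(negligible_integrable mN mD mfg N0); exact: ifgN.
have Lg : sq_integrable g.
  have Lfg : sq_integrable (fun x => f 0%N x - g x).
    by split => //; apply: measurable_funB => //; case: (Lf 0%N).
  have -> : g = (fun x => f 0%N x - (f 0%N x - g x)) by apply/funext => x; ring.
  exact: sq_integrableB.
exists g => //; exists (4 * \int[mu]_(x in D `\` N) fine (G x)) => n.
have -> : sq (f n) g = \int[mu]_(x in D `\` N) (f n x - g x) ^+ 2.
  by congr fine; exact: (negligible_integral mN mD (ifg n) N0).
have mDN : measurable (D `\` N) by exact: measurableD.
rewrite mulrAC -RintegralZl//; apply: le_Rintegral => //.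
- exact: ifgN.
- exact: (integrableZl mDN _ ifG).
by move=> x [Dx Nx]; exact: gtail.
Qed.

(** A Cauchy sequence has a subsequence with geometrically decaying increments,
    and it converges as soon as this subsequence does. *)
Lemma sq_integrable_complete (f : nat -> T -> R) :
  (forall n, sq_integrable (f n)) ->
  (forall e : R, 0 < e -> exists N, forall m n, (N <= m)%N -> (N <= n)%N ->
     sq (f m) (f n) <= e) ->
  exists2 g, sq_integrable g &
    forall e : R, 0 < e -> exists N, forall n, (N <= n)%N -> sq (f n) g <= e.
Proof.
move=> Lf cf.
have e16 k : 0 < 16^-1 ^+ k :> R by rewrite exprn_gt0.
have [N0 N0P] := choice (fun k => cf _ (e16 k)).
(* partial sums turn the ranks [N0 k] into a nondecreasing sequence *)
pose phi k := (\sum_(i < k.+1) N0 i)%N.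
have phiN k : (N0 k <= phi k)%N by rewrite /phi big_ord_recr/= leq_addl.
have phiS k : (phi k <= phi k.+1)%N by rewrite {2}/phi big_ord_recr/= leq_addr.
have [|g Lg [C gC]] := @sq_integrable_fast_limit (fun k => f (phi k)) (fun k => Lf _).
  by move=> n; apply: N0P => //; exact: leq_trans (phiS n).
exists g => // e e0.
have c4 : (4^-1 : R) ^+ n @[n --> \oo] --> (0 : R).
  by apply: cvg_expr; rewrite ger0_norm; lra.
have [K _ HK] : \forall n \near \oo, C * 4^-1 ^+ n < e / 4 /\ (4^-1 ^+ n < e / 4 :> R).
  near=> n; split; near: n.
    have : C * (4^-1 : R) ^+ n @[n --> \oo] --> C * 0 by apply: cvgM => //; exact: cvg_cst.
    by rewrite mulr0 => /cvgr_lt; apply; lra.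
  by move/cvgr_lt : c4; apply; lra.
have [HC H4] := HK K (leqnn K).
exists (N0 K) => n Nn.
apply: le_trans (sq_triangle (Lf n) (Lf (phi K)) Lg) _.
have H1 := gC K; have H2 := N0P K _ _ Nn (phiN K).
have H3 : 16^-1 ^+ K <= 4^-1 ^+ K :> R by apply: lerXn2r; rewrite ?nnegrE; lra.
lra.
Unshelve. all: by end_near. Qed.

End SquareIntegrable.

(** * Square integrable fields *)

Notation borel3 R := (measurableTypeR R * measurableTypeR R * measurableTypeR R)%type.

#[global] Instance leb3_ae_filter (R : realType) :
  Filter (nbhs (almost_everywhere (leb3 R))) := ae_filter_ringOfSetsType (leb3 R).

Section InnerProduct.
Context {R : realType} (Omega : set (pt3 R)).
Hypothesis mO : measurable (Omega : set (borel3 R)).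
Implicit Types u v w : vf3 R.

Local Notation mu := (leb3 R).
Local Notation sqi := (sq_integrable (leb3 R) (Omega : set (borel3 R))).
Local Notation "<| u , v |>" := (ip Omega u v) (at level 0, format "<| u ,  v |>").
Local Notation nrm := (nnorm (L2 Omega)).

Lemma L2D u v : L2 Omega u -> L2 Omega v -> L2 Omega (u + v).
Proof.
move=> Lu Lv i; have := sq_integrableD mO (Lu i) (Lv i).
by congr sq_integrable; apply/funext => x; rewrite fctE mxE.
Qed.

Lemma L2Z a u : L2 Omega u -> L2 Omega (a *: u).
Proof.
move=> Lu i; have := sq_integrableZ mO a (Lu i).
by congr sq_integrable; apply/funext => x; rewrite fctE mxE.
Qed.

Lemma L2N u : L2 Omega u -> L2 Omega (- u).
Proof. by move=> Lu; rewrite -scaleN1r; exact: L2Z. Qed.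

Lemma L2B u v : L2 Omega u -> L2 Omega v -> L2 Omega (u - v).
Proof. by move=> Lu Lv; apply: L2D => //; exact: L2N. Qed.

Lemma L20 : L2 Omega (0 : vf3 R).
Proof.
move=> i; have := sq_integrable0 mu (Omega : set (borel3 R)).
by congr sq_integrable; apply/funext => x; rewrite mxE.
Qed.

Lemma L2_sum (I : Type) (s : seq I) (F : I -> vf3 R) :
  (forall i, L2 Omega (F i)) -> L2 Omega (\sum_(i <- s) F i).
Proof.
move=> LF; elim: s => [|a s IH]; first by rewrite big_nil; exact: L20.
by rewrite big_cons; exact: L2D.
Qed.

Lemma ip_sum u v : L2 Omega u -> L2 Omega v ->
  <|u, v|> = \sum_i \int[mu]_(x in Omega) (u x i 0 * v x i 0).
Proof.
move=> Lu Lv; rewrite /ip /dot /Rintegral.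
under eq_integral do rewrite -sumEFin.
rewrite (integral_sum mO); last by move=> i; exact: (sq_integrableM mO (Lu i) (Lv i)).
rewrite (@sum_fine _ _ _ xpredT)// => i _.
by apply: integrable_fin_num => //; exact: (sq_integrableM mO (Lu i) (Lv i)).
Qed.

Lemma integrable_dot u v : L2 Omega u -> L2 Omega v ->
  mu.-integrable Omega (fun x => (dot (u x) (v x))%:E).
Proof.
move=> Lu Lv; rewrite /dot; under eq_fun do rewrite -sumEFin.
apply: (integrable_sum mO) => i _; exact: (sq_integrableM mO (Lu i) (Lv i)).
Qed.

Lemma ipC u v : <|u, v|> = <|v, u|>.
Proof.
by apply: eq_Rintegral => x _; apply: eq_bigr => i _; rewrite mulrC.
Qed.

Lemma ipDl u v w : L2 Omega u -> L2 Omega v -> L2 Omega w ->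
  <|u + v, w|> = <|u, w|> + <|v, w|>.
Proof.
move=> Lu Lv Lw; rewrite /ip.
rewrite -(RintegralD mO (integrable_dot Lu Lw) (integrable_dot Lv Lw)).
apply: eq_Rintegral => x _; rewrite /dot -big_split/=.
by apply: eq_bigr => i _; rewrite fctE mxE mulrDl.
Qed.

Lemma ipZl a u w : L2 Omega u -> L2 Omega w -> <|a *: u, w|> = a * <|u, w|>.
Proof.
move=> Lu Lw; rewrite /ip -(RintegralZl _ mO (integrable_dot Lu Lw)).
apply: eq_Rintegral => x _; rewrite /dot mulr_sumr.
by apply: eq_bigr => i _; rewrite fctE mxE mulrA.
Qed.

Lemma ipNl u w : L2 Omega u -> L2 Omega w -> <|- u, w|> = - <|u, w|>.
Proof. by move=> Lu Lw; rewrite -scaleN1r ipZl// mulN1r. Qed.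

Lemma ipBl u v w : L2 Omega u -> L2 Omega v -> L2 Omega w ->
  <|u - v, w|> = <|u, w|> - <|v, w|>.
Proof. by move=> Lu Lv Lw; rewrite ipDl ?ipNl//; exact: L2N. Qed.

Lemma ipDr u v w : L2 Omega u -> L2 Omega v -> L2 Omega w ->
  <|w, u + v|> = <|w, u|> + <|w, v|>.
Proof. by move=> *; rewrite ipC ipDl// !(ipC w). Qed.

Lemma ipZr a u w : L2 Omega u -> L2 Omega w -> <|w, a *: u|> = a * <|w, u|>.
Proof. by move=> *; rewrite ipC ipZl// ipC. Qed.

Lemma ipBr u v w : L2 Omega u -> L2 Omega v -> L2 Omega w ->
  <|w, u - v|> = <|w, u|> - <|w, v|>.
Proof. by move=> *; rewrite ipC ipBl// !(ipC w). Qed.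

Lemma ip0l w : L2 Omega w -> <|0, w|> = 0.
Proof. by move=> Lw; rewrite -(scale0r (0 : vf3 R)) ipZl ?mul0r//; exact: L20. Qed.

Lemma ip_suml (I : Type) (s : seq I) (F : I -> vf3 R) w :
  (forall i, L2 Omega (F i)) -> L2 Omega w ->
  <|\sum_(i <- s) F i, w|> = \sum_(i <- s) <|F i, w|>.
Proof.
move=> LF Lw; elim: s => [|a s IH]; first by rewrite !big_nil ip0l.
by rewrite !big_cons ipDl ?IH//; exact: L2_sum.
Qed.

Lemma ip_ge0 u : 0 <= <|u, u|>.
Proof.
by apply: Rintegral_ge0 => x _; apply: sumr_ge0 => i _; rewrite -expr2 sqr_ge0.
Qed.

Lemma nrm_ge0 u : 0 <= nrm u.
Proof. exact: sqrtr_ge0. Qed.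

Lemma nrm_sqr u : nrm u ^+ 2 = <|u, u|>.
Proof. by rewrite sqr_sqrtr// ip_ge0. Qed.

Lemma ip_le u v : L2 Omega u -> L2 Omega v -> `|<|u, v|>| <= nrm u * nrm v.
Proof.
move=> Lu Lv.
rewrite -(@ler_pXn2r _ 2)// ?nnegrE ?mulr_ge0 ?nrm_ge0//.
rewrite exprMn !nrm_sqr real_normK ?num_real//.
set a := <|u, u|>; set b := <|v, v|>; set c := <|u, v|>.
(* the discriminant argument; [quad b c] avoids dividing by [b] *)
have quad (s t : R) : 0 <= s ^+ 2 * a - 2 * s * t * c + t ^+ 2 * b.
  have := ip_ge0 (s *: u - t *: v).
  have Lsu := L2Z s Lu; have Ltv := L2Z t Lv.
  have Lsut := L2B Lsu Ltv.
  rewrite ipBl// !ipBr// !ipZl// !ipZr// (ipC v u) -/a -/b -/c.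
  by congr (_ <= _); ring.
have a0 : 0 <= a := ip_ge0 u; have b0 : 0 <= b := ip_ge0 v.
have [b_gt0|b_le0] := ltP 0 b.
  by have := quad b c; rewrite -(@ler_pM2l _ b)//; nra.
(* if [b = 0] the form is affine in [t], so that [c] must vanish *)
have b_eq0 : b = 0 by lra.
have := quad c (a + 1); rewrite b_eq0; nra.
Qed.

Lemma nrmD u v : L2 Omega u -> L2 Omega v -> nrm (u + v) <= nrm u + nrm v.
Proof.
move=> Lu Lv; rewrite -(@ler_pXn2r _ 2)// ?nnegrE ?addr_ge0 ?nrm_ge0//.
have Luv := L2D Lu Lv.
rewrite nrm_sqr ipDl// !ipDr// (ipC v u) sqrrD !nrm_sqr.
have := ip_le Lu Lv; have := ler_norm <|u, v|>; lra.
Qed.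

Lemma nrmZ a u : L2 Omega u -> nrm (a *: u) = `|a| * nrm u.
Proof.
move=> Lu; have LZ := L2Z a Lu; rewrite /= ipZl// ipZr// mulrA -expr2 sqrtrM ?sqr_ge0//.
by rewrite sqrtr_sqr.
Qed.

Lemma nrmN u : L2 Omega u -> nrm (- u) = nrm u.
Proof. by move=> Lu; rewrite -scaleN1r nrmZ// normrN1 mul1r. Qed.

Lemma nrmB u v : L2 Omega u -> L2 Omega v -> nrm (u - v) <= nrm u + nrm v.
Proof.
by move=> Lu Lv; rewrite -(nrmN Lv); apply: nrmD => //; exact: L2N.
Qed.

(** The inner product is definite up to null sets only. *)
Lemma ip_eq0_ae u : L2 Omega u -> <|u, u|> = 0 ->
  {ae mu, forall x, Omega x -> u x = 0}.
Proof.
move=> Lu; rewrite ip_sum// => /eqP; rewrite psumr_eq0; last first.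
  by move=> i _; apply: Rintegral_ge0 => x _; rewrite -expr2 sqr_ge0.
move=> /allP u0.
have ui i : {ae mu, forall x, Omega x -> u x i 0 = 0}.
  apply: (Rintegral_sq_eq0 mO (Lu i)).
  by have /eqP := u0 i (mem_index_enum _).
have : {ae mu, forall x i, Omega x -> u x i 0 = 0}.
  apply: filterS (filterI (ui 0) (filterI (ui 1) (ui 2%:R))) => x [u00 [u1 u2]] i.
  case: i => -[|[|[|//]]] i3 Ox.
  - by rewrite -(u00 Ox); congr (u x _ 0); apply: val_inj.
  - by rewrite -(u1 Ox); congr (u x _ 0); apply: val_inj.
  - by rewrite -(u2 Ox); congr (u x _ 0); apply: val_inj.
apply: filterS => x ux Ox; apply/matrixP => i j.
by rewrite (ord1 j) ux// mxE.
Qed.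

Lemma nrm_eq0_ip u v : L2 Omega u -> L2 Omega v -> <|u, u|> = 0 -> <|u, v|> = 0.
Proof.
move=> Lu Lv u0; apply/eqP; rewrite -normr_le0 (le_trans (ip_le Lu Lv))//.
by rewrite /= u0 sqrtr0 mul0r.
Qed.

(** Componentwise from the scalar case. *)
Lemma L2_complete (U : nat -> vf3 R) : (forall n, L2 Omega (U n)) ->
  (forall e : R, 0 < e -> exists N, forall m n, (N <= m)%N -> (N <= n)%N ->
     nrm (U m - U n) <= e) ->
  exists2 u, L2 Omega u & nrm (U n - u) @[n --> \oo] --> 0.
Proof.
move=> LU cU.
have sqE u v : L2 Omega u -> L2 Omega v ->
    nrm (u - v) ^+ 2 = \sum_i \int[mu]_(x in Omega) (u x i 0 - v x i 0) ^+ 2.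
  move=> Lu Lv; have Luv := L2B Lu Lv.
  rewrite nrm_sqr ip_sum//; apply: eq_bigr => i _; apply: eq_Rintegral => x _.
  by rewrite -expr2 fctE mxE fctE mxE.
have int_ge0 (f : pt3 R -> R) : 0 <= \int[mu]_(x in Omega) (f x ^+ 2).
  by apply: Rintegral_ge0 => x _; exact: sqr_ge0.
have comp i : exists2 g, sqi g &
    forall e : R, 0 < e -> exists N, forall n, (N <= n)%N ->
      \int[mu]_(x in Omega) (U n x i 0 - g x) ^+ 2 <= e.
  apply: (sq_integrable_complete mO (fun n => LU n i)) => e e0.
  have [|N NP] := cU (Num.sqrt e); first by rewrite sqrtr_gt0.
  exists N => m n Nm Nn.
  have : nrm (U m - U n) ^+ 2 <= e.
    rewrite -[leRHS]sqr_sqrtr ?(ltW e0)//.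
    by apply: lerXn2r; rewrite ?nnegrE ?nrm_ge0 ?sqrtr_ge0//; exact: NP.
  rewrite sqE//; apply: le_trans.
  by rewrite (bigD1 i)//= lerDl; apply: sumr_ge0 => j _; exact: int_ge0.
have /choice[g gP] : forall i, exists g, sqi g /\
    forall e : R, 0 < e -> exists N, forall n, (N <= n)%N ->
      \int[mu]_(x in Omega) (U n x i 0 - g x) ^+ 2 <= e.
  by move=> i; have [g ? ?] := comp i; exists g.
pose u : vf3 R := fun x => \col_i g i x.
have Lu : L2 Omega u.
  move=> i; have [+ _] := gP i.
  by congr sq_integrable; apply/funext => x; rewrite mxE.
exists u => //; apply/cvgrPdist_le => e e0.
have e3 : 0 < e ^+ 2 / 3 by rewrite divr_gt0// exprn_gt0.
have /choice[N NP] i := (gP i).2 _ e3.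
exists (\max_i N i) => // n /= Nn.
rewrite sub0r normrN ger0_norm ?nrm_ge0//.
rewrite -(@ler_pXn2r _ 2)// ?nnegrE ?nrm_ge0 ?(ltW e0)// sqE//.
apply: (@le_trans _ _ (\sum_(i < 3) e ^+ 2 / 3)).
  apply: ler_sum => i _; apply: le_trans (NP i n _).
    by under eq_Rintegral do rewrite mxE.
  by apply: leq_trans Nn; exact: leq_bigmax.
by rewrite sumr_const card_ord -mulr_natr; lra.
Qed.

End InnerProduct.

(** * Boxes and bump functions *)

Section DominatedSq.
Context d (T : measurableType d) (R : realType) (mu : {measure set T -> \bar R}).
Variables (D : set T) (mD : measurable D).

(** Dominated convergence for the squares, with bound [4 h^2]. *)
Lemma sq_integrable_dominated (f : nat -> T -> R) (g h : T -> R) :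
  (forall n, measurable_fun D (f n)) -> sq_integrable mu D h ->
  (forall n x, D x -> `|f n x| <= `|h x|) ->
  (forall x, D x -> f n x @[n --> \oo] --> g x) ->
  sq_integrable mu D g /\
  \int[mu]_(x in D) (f n x - g x) ^+ 2 @[n --> \oo] --> 0.
Proof.
move=> mf Lh fh fg.
have mg : measurable_fun D g by apply: measurable_fun_cvg fg.
have gh x : D x -> `|g x| <= `|h x|.
  move=> Dx.
  have c : `|f n x| @[n --> \oo] --> `|g x| by apply: cvg_norm; exact: fg.
  apply: (closed_cvg (fun z : R => z <= `|h x|)) c; first exact: closed_le.
  by near=> n; exact: fh.
have Lg := sq_integrable_le mD mg Lh gh; split => //.
have i4 : mu.-integrable D (fun x => (4 * h x ^+ 2)%:E).
  by apply: integrable_EFinZ => //; case: Lh.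
have [] := @dominated_convergence _ _ _ mu D mD
  (fun n x => ((f n x - g x) ^+ 2)%:E) (cst 0%E) (fun x => (4 * h x ^+ 2)%:E).
- move=> n; apply/measurable_EFinP/measurable_funX.
  exact: measurable_funB.
- exact: measurable_cst.
- apply: aeW => x Dx; apply/fine_cvgP; split; first by near=> n.
  rewrite /=; have : (f n x - g x) ^+ 2 @[n --> \oo] --> (g x - g x) ^+ 2.
    by apply: cvgM; apply: cvgB; do ?[exact: fg|exact: cvg_cst].
  by rewrite subrr expr0n/=; apply: cvg_trans.
- exact: i4.
- apply: aeW => x n Dx; rewrite abse_EFin lee_fin.
  rewrite ger0_norm ?sqr_ge0// -(@real_normK _ (f n x - g x)) ?num_real//.
  rewrite -(@real_normK _ (h x)) ?num_real//.
  have : `|f n x - g x| <= 2 * `|h x|.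
    apply: le_trans (ler_normB _ _) _.
    by have := fh n _ Dx; have := gh _ Dx; lra.
  have := normr_ge0 (f n x - g x); nra.
move=> _ _; rewrite integral0 => /fine_cvgP[_]; apply: cvg_trans.
by [].
Unshelve. all: by end_near. Qed.

End DominatedSq.

Section Boxes.
Context {R : realType}.
Implicit Types a b x : pt3 R.

Definition open_box a b : set (pt3 R) :=
  (`]a.1.1, b.1.1[%classic `*` `]a.1.2, b.1.2[%classic) `*` `]a.2, b.2[%classic.
Definition closed_box a b : set (pt3 R) :=
  (`[a.1.1, b.1.1]%classic `*` `[a.1.2, b.1.2]%classic) `*` `[a.2, b.2]%classic.

Lemma open_box_sub a b : open_box a b `<=` closed_box a b.
Proof.
by move=> x [[x1 x2] x3]; split; [split|]; exact: subset_itv_oo_cc.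
Qed.

Lemma compact_closed_box a b : compact (closed_box a b).
Proof. by do ?apply: compact_setX; exact: segment_compact. Qed.

Lemma measurable_open_box a b : measurable (open_box a b : set (borel3 R)).
Proof. by apply: measurableX; [apply: measurableX|]; exact: measurable_itv. Qed.

Lemma measurable_closed_box a b : measurable (closed_box a b : set (borel3 R)).
Proof. by apply: measurableX; [apply: measurableX|]; exact: measurable_itv. Qed.

Lemma leb3_closed_box_lty a b : (leb3 R (closed_box a b) < +oo)%E.
Proof.
have itv (x y : R) : (leb1 R `[x, y]%classic < +oo)%E.
  by rewrite lebesgue_measure_itv; case: ifPn => _; rewrite ltry.
have -> : leb3 R (closed_box a b) = ((leb1 R \x leb1 R)
    (`[a.1.1, b.1.1]%classic `*` `[a.1.2, b.1.2]%classic) * leb1 R `[a.2, b.2]%classic)%E.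
  by apply: product_measure1E; [apply: measurableX|]; exact: measurable_itv.
have -> : (leb1 R \x leb1 R)%E (`[a.1.1, b.1.1]%classic `*` `[a.1.2, b.1.2]%classic) =
    (leb1 R `[a.1.1, b.1.1]%classic * leb1 R `[a.1.2, b.1.2]%classic)%E.
  by apply: product_measure1E; exact: measurable_itv.
by rewrite !lte_mul_pinfty ?mule_ge0 ?fin_numM// ge0_fin_numE.
Qed.

(** Boxes with rational corners, enumerated, of which only those are kept whose
    closure lies in [U]. They cover an open [U], which reduces open sets to
    countably many boxes. *)
Definition rational_box (U : set (pt3 R)) (n : nat) : set (pt3 R) :=
  if @unpickle (rat * rat * rat * (rat * rat * rat))%type n is Some (p, q) then
    let a := (ratr p.1.1, ratr p.1.2, ratr p.2) : pt3 R in
    let b := (ratr q.1.1, ratr q.1.2, ratr q.2) : pt3 R in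
    if `[< closed_box a b `<=` U >] then open_box a b else set0
  else set0.

Lemma rational_boxP (U : set (pt3 R)) n : exists a b,
  closed_box a b `<=` U /\ rational_box U n = open_box a b \/ rational_box U n = set0.
Proof.
rewrite /rational_box; case: unpickle => [[p q]|]; last by exists 0, 0; right.
set a := (_, _, _); set b := (_, _, _); exists a, b.
by case: ifPn => [/asboolP|]; [left|right].
Qed.

Lemma bigcup_rational_box (U : set (pt3 R)) : open U -> \bigcup_n rational_box U n = U.
Proof.
move=> oU; apply/seteqP; split=> [x [n _]|x Ux].
  have [a [b [[abU ->]|->//]]] := rational_boxP U n.
  by move/open_box_sub/abU.
have /nbhs_ballP[r /= r0 rU] : nbhs x U by exact: open_nbhs_nbhs.
have lo (y : R) : {q : rat | ratr q \in `]y - r, y[}.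
  by apply/cid/rat_in_itvoo; lra.
have hi (y : R) : {q : rat | ratr q \in `]y, y + r[}.
  by apply/cid/rat_in_itvoo; lra.
pose p := (sval (lo x.1.1), sval (lo x.1.2), sval (lo x.2)).
pose q := (sval (hi x.1.1), sval (hi x.1.2), sval (hi x.2)).
have [n En] : exists n, unpickle n = Some (p, q) by exists (pickle (p, q)); exact: pickleK.
exists n; first by [].
rewrite /rational_box En.
rewrite asboolT.
  by split; [split|] => /=; rewrite in_itv/=; do 2?[case: (lo _) => ? /=; rewrite in_itv/= => /andP[_ ->]]; case: (hi _) => ? /=; rewrite in_itv/= => /andP[-> _].
move=> y [[]]/=; rewrite !in_itv/=.
case: (lo x.1.1) => l1 /=; rewrite in_itv/= => /andP[l11 l12].
case: (lo x.1.2) => l2 /=; rewrite in_itv/= => /andP[l21 l22].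
case: (lo x.2) => l3 /=; rewrite in_itv/= => /andP[l31 l32].
case: (hi x.1.1) => h1 /=; rewrite in_itv/= => /andP[h11 h12].
case: (hi x.1.2) => h2 /=; rewrite in_itv/= => /andP[h21 h22].
case: (hi x.2) => h3 /=; rewrite in_itv/= => /andP[h31 h32].
move=> /andP[y1 y1'] /andP[y2 y2'] /andP[y3 y3'].
by apply: rU; split; [split|]; rewrite /ball/= ltr_norml; apply/andP; split; lra.
Qed.

Lemma measurable_rational_box U n : measurable (rational_box U n : set (borel3 R)).
Proof.
have [a [b [[_ ->]|->]]] := rational_boxP U n; last exact: measurable0.
exact: measurable_open_box.
Qed.

(** Relates the product topology to the product sigma-algebra. *)
Lemma open_measurable3 (U : set (pt3 R)) : open U -> measurable (U : set (borel3 R)).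
Proof.
move=> /bigcup_rational_box <-; apply: bigcupT_measurable => n.
exact: measurable_rational_box.
Qed.

Lemma continuous_measurable3 (D : set (pt3 R)) (f : pt3 R -> R) :
  measurable (D : set (borel3 R)) -> continuous f ->
  measurable_fun (D : set (borel3 R)) f.
Proof.
move=> mD cf; apply: (measurability (@RGenOInfty.G R)).
  exact: RGenOInfty.measurableE.
move=> _ [_ [x ->] <-]; apply: measurableI => //.
apply: open_measurable3; move: cf => /continuousP; apply.
exact: interval_open.
Qed.

End Boxes.

Section BumpFunctions.
Context {R : realType}.

Lemma elementary_linear (V : normedModType R) (f : V -> R) :
  linear f -> continuous f -> elementary f.
Proof.
move=> lf cf.
pose F : {linear V -> R} := HB.pack f (GRing.isLinear.Build R V R _ f lf).
have dF x : differentiable f x by exact: (@linear_differentiable _ _ _ F).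
apply: (@elementary_affine _ _ _ f) => // x v.
by rewrite deriveE// (@diff_lin _ _ _ F).
Qed.

Lemma elementary_coord1 : elementary (fun x : pt3 R => x.1.1).
Proof.
apply: elementary_linear => // x.
by apply: (@continuous_comp _ _ _ fst fst); exact: cvg_fst.
Qed.

Lemma elementary_coord2 : elementary (fun x : pt3 R => x.1.2).
Proof.
apply: elementary_linear => // x.
by apply: (@continuous_comp _ _ _ fst snd); [exact: cvg_fst|exact: cvg_snd].
Qed.

Lemma elementary_coord3 : elementary (fun x : pt3 R => x.2).
Proof. by apply: elementary_linear => // x; exact: cvg_snd. Qed.

(** Smooth and supported in [a, b], with the indicator of the open interval as its
    limit. *)
Definition plateau (n : nat) (a b x : R) : R :=
  step (n%:R * (x - a)) * step (n%:R * (b - x)).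

Lemma elementary_plateau (V : normedModType R) n a b (f : V -> R) :
  elementary f -> elementary (fun x => plateau n a b (f x)).
Proof.
move=> ef; apply: elementaryM; apply: elementary_step.
  apply: (@elementaryM _ _ (cst n%:R)); first exact: elementary_cst.
  by apply: (@elementaryD _ _ f (cst (- a))) => //; exact: elementary_cst.
apply: (@elementaryM _ _ (cst n%:R)); first exact: elementary_cst.
apply: (@elementaryD _ _ (cst b)); first exact: elementary_cst.
have -> : (fun x => - f x) = (fun x => cst (-1) x * f x).
  by apply/funext => x; rewrite mulN1r.
by apply: elementaryM => //; exact: elementary_cst.
Qed.

Lemma plateau_ge0 n a b x : 0 <= plateau n a b x.
Proof. by rewrite mulr_ge0// step_ge0. Qed.

Lemma plateau_le1 n a b x : plateau n a b x <= 1.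
Proof. by rewrite mulr_ile1 ?step_ge0 ?step_le1. Qed.

Lemma plateau_out n a b x : x \notin `]a, b[ -> plateau n a b x = 0.
Proof.
rewrite in_itv/= negb_and -!leNgt => /orP[xa|bx]; rewrite /plateau.
  by rewrite step_le0 ?mul0r// mulr_ge0_le0// subr_le0.
by rewrite (@step_le0 _ (_ * (b - x))) ?mulr0// mulr_ge0_le0// subr_le0.
Qed.

Lemma cvg_step (x : R) : 0 < x -> step (n%:R * x) @[n --> \oo] --> (1 : R).
Proof.
move=> x0; apply: cvg_near_cst; near=> n; apply: step_ge1.
rewrite -ler_pdivrMr// mul1r; near: n; exact: nbhs_infty_ger.
Unshelve. all: by end_near. Qed.

Lemma plateau_cvg a b x : plateau n a b x @[n --> \oo] --> (\1_(`]a, b[%classic) x : R).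
Proof.
rewrite indicE; case: (boolP (x \in `]a, b[)) => [xab|xab].
  rewrite mem_set//=; move: xab; rewrite in_itv/= => /andP[ax xb].
  by rewrite -[1%:R]mulr1; apply: cvgM; apply: cvg_step; rewrite subr_gt0.
rewrite memNset; last exact/negP.
under eq_fun do rewrite plateau_out//.
exact: cvg_cst.
Qed.

Definition box_plateau (n : nat) (a b x : pt3 R) : R :=
  plateau n a.1.1 b.1.1 x.1.1 * plateau n a.1.2 b.1.2 x.1.2 * plateau n a.2 b.2 x.2.

Lemma box_plateau_cvg a b x :
  box_plateau n a b x @[n --> \oo] --> (\1_(open_box a b) x : R).
Proof.
have -> : \1_(open_box a b) x = \1_(`]a.1.1, b.1.1[%classic) x.1.1 *
    \1_(`]a.1.2, b.1.2[%classic) x.1.2 * \1_(`]a.2, b.2[%classic) x.2 :> R.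
  rewrite !indicE !in_setX -!natrM; congr (_%:R).
  by case: (_ \in _); case: (_ \in _); case: (_ \in _).
by apply: cvgM; [apply: cvgM|]; exact: plateau_cvg.
Qed.

Lemma box_plateau_out n a b x : ~ open_box a b x -> box_plateau n a b x = 0.
Proof.
move=> xab; rewrite /box_plateau.
case: (boolP (x.1.1 \in `]a.1.1, b.1.1[)) => h1; last by rewrite plateau_out ?mul0r.
case: (boolP (x.1.2 \in `]a.1.2, b.1.2[)) => h2; last first.
  by rewrite (plateau_out _ h2) mulr0 mul0r.
case: (boolP (x.2 \in `]a.2, b.2[)) => h3; last by rewrite (plateau_out _ h3) mulr0.
by exfalso; apply: xab.
Qed.

Lemma box_plateau_norm n a b x : `|box_plateau n a b x| <= `|\1_(open_box a b) x : R|.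
Proof.
have [xab|xab] := pselect (open_box a b x); last first.
  by rewrite box_plateau_out// normr0.
have p0 i y z t : 0 <= plateau i y z t := plateau_ge0 i y z t.
have p1 i y z t : plateau i y z t <= 1 := plateau_le1 i y z t.
have q0 : 0 <= box_plateau n a b x by apply: mulr_ge0; [exact: mulr_ge0|exact: p0].
rewrite indicE mem_set//= normr1 (ger0_norm q0).
apply: mulr_ile1 (p0 _ _ _ _) _ (p1 _ _ _ _); first exact: mulr_ge0.
exact: mulr_ile1.
Qed.

Lemma elementary_box_plateau n a b : elementary (box_plateau n a b).
Proof.
apply: elementaryM; [apply: elementaryM|]; apply: elementary_plateau.
- exact: elementary_coord1.
- exact: elementary_coord2.
- exact: elementary_coord3.
Qed.

(** Test functions of an explicit kind: elementary and supported in a compact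
    subset of [U]. They form a vector space that contains the box plateaus. *)
Definition bump_in (U : set (pt3 R)) (f : pt3 R -> R) : Prop :=
  elementary f /\ exists K, [/\ compact K, K `<=` U & forall x, ~ K x -> f x = 0].

Lemma bump_test_function U f : bump_in U f -> test_function U f.
Proof.
move=> [ef [K [cK KU f0]]].
have sK : closure [set x | f x != 0] `<=` K.
  rewrite closureE; apply: smallest_sub.
    by apply: compact_closed => //; exact: norm_hausdorff.
  by move=> x /= fx; apply: contrapT => /f0; move/eqP: fx.
split; [exact: elementary_smooth| |exact: subset_trans KU].
by apply: subclosed_compact sK => //; exact: closed_closure.
Qed.

Lemma bump_box U n a b : closed_box a b `<=` U -> bump_in U (box_plateau n a b).
Proof.
move=> abU; split; first exact: elementary_box_plateau.
exists (closed_box a b); split=> //; first exact: compact_closed_box.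
by move=> x xab; apply: box_plateau_out => /open_box_sub.
Qed.

Lemma bump_in0 U : bump_in U (fun=> 0).
Proof.
by split; [exact: elementary_cst|exists set0; split => //; exact: compact0].
Qed.

Lemma bump_inD U f g : bump_in U f -> bump_in U g -> bump_in U (fun x => f x + g x).
Proof.
move=> [ef [K [cK KU f0]]] [eg [L [cL LU g0]]]; split; first exact: elementaryD.
exists (K `|` L); split; first exact: compactU.
  by move=> x [/KU|/LU].
by move=> x /not_orP[/f0 -> /g0 ->]; rewrite addr0.
Qed.

Lemma bump_inZ U k f : bump_in U f -> bump_in U (fun x => k * f x).
Proof.
move=> [ef [K [cK KU f0]]]; split.
  by apply: (@elementaryM _ _ (cst k)) => //; exact: elementary_cst.
by exists K; split => // x /f0 ->; rewrite mulr0.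
Qed.

End BumpFunctions.

Section TestFunctionsBounded.
Context {R : realType}.

Lemma test_function_continuous (U : set (pt3 R)) f : test_function U f -> continuous f.
Proof. by move=> [/(_ [::])[]]. Qed.

Lemma compact_sub_closed_box (K : set (pt3 R)) : compact K ->
  exists a b, K `<=` closed_box a b.
Proof.
move=> /compact_bounded[M [_ MK]]; pose m := M + 1.
have Mm : M < m by rewrite ltrDl.
exists (- m, - m, - m), (m, m, m) => x Kx.
have := MK _ Mm _ Kx; rewrite /= !prod_normE/= !ge_max => /andP[/andP[h1 h2] h3].
by split; [split|] => /=; rewrite in_itv/= -ler_norml.
Qed.

Lemma integrable_closed_box (D : set (pt3 R)) a b : measurable (D : set (borel3 R)) ->
  (leb3 R).-integrable D (fun x : borel3 R => (\1_(closed_box a b) x)%:E).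
Proof.
move=> mD; have mbox : measurable_fun (D : set (borel3 R)) (\1_(closed_box a b) : pt3 R -> R).
  by apply: measurable_indic; exact: measurable_closed_box.
apply/integrableP; split; first exact/measurable_EFinP.
under eq_integral do rewrite gee0_abs ?lee_fin//.
rewrite integral_indic//; last exact: measurable_closed_box.
apply: le_lt_trans (leb3_closed_box_lty a b); apply: le_measure => //;
  rewrite inE; last exact: measurable_closed_box.
by apply: measurableI => //; exact: measurable_closed_box.
Qed.

Lemma sq_integrable_closed_box (D : set (pt3 R)) a b : measurable (D : set (borel3 R)) ->
  sq_integrable (leb3 R) (D : set (borel3 R)) (\1_(closed_box a b) : pt3 R -> R).
Proof.
move=> mD; split; first by apply: measurable_indic; exact: measurable_closed_box.
have -> : (fun x => (\1_(closed_box a b) x ^+ 2)%:E) =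
    (fun x : borel3 R => (\1_(closed_box a b) x)%:E :> \bar R).
  by apply/funext => x; rewrite indicE; case: (_ \in _); rewrite ?expr0n ?expr1n.
exact: integrable_closed_box.
Qed.

(** A continuous function with compact support is bounded, and dominated by a
    multiple of the indicator of a box. *)
Lemma compact_support_sq_integrable (D : set (pt3 R)) K (f : pt3 R -> R) :
  measurable (D : set (borel3 R)) -> continuous f -> compact K ->
  (forall x, ~ K x -> f x = 0) -> L2scalar D f.
Proof.
move=> mD cf cK f0.
have [C C0 fC] : exists2 C : R, 0 <= C & forall x, `|f x| <= C.
  have /compact_bounded[M [_ Mf]] : compact (f @` K).
    by apply: continuous_compact => //; exact: continuous_subspaceT.
  exists (`|M| + 1); first by rewrite addr_ge0.
  move=> x; have [Kx|/f0 ->] := pselect (K x); last by rewrite normr0 addr_ge0.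
  by apply: (Mf (`|M| + 1)) => /=; [rewrite ltr_pwDr// ler_norm|exists x].
have [a [b Kab]] := compact_sub_closed_box cK.
have mf := continuous_measurable3 mD cf.
have ibox := sq_integrableZ mD C (sq_integrable_closed_box a b mD).
apply: (sq_integrable_le mD mf ibox) => x _; rewrite indicE.
have [xab|xab] := pselect (closed_box a b x).
  by rewrite mem_set// mulr1 (ger0_norm C0).
by rewrite f0 ?normr0// => /Kab.
Qed.

Lemma compact_support_integrable (D : set (pt3 R)) K (f : pt3 R -> R) :
  measurable (D : set (borel3 R)) -> continuous f -> compact K ->
  (forall x, ~ K x -> f x = 0) -> (leb3 R).-integrable D (fun x : borel3 R => (f x)%:E).
Proof.
move=> mD cf cK f0; have [a [b Kab]] := compact_sub_closed_box cK.
have := sq_integrableM mD (compact_support_sq_integrable mD cf cK f0)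
  (sq_integrable_closed_box a b mD).
apply: eq_integrable => // x _; rewrite indicE; congr EFin.
have [xab|xab] := pselect (closed_box a b x); first by rewrite mem_set// mulr1.
by rewrite f0 ?mul0r// => /Kab.
Qed.

Lemma test_function_L2 (D U : set (pt3 R)) f :
  measurable (D : set (borel3 R)) -> test_function U f -> L2scalar D f.
Proof.
move=> mD tf; have [_ cK _] := tf.
apply: (compact_support_sq_integrable mD (test_function_continuous tf) cK).
move=> x Kx; apply/eqP; apply: contrapT => fx; apply: Kx.
by apply: subset_closure; exact/negP.
Qed.

End TestFunctionsBounded.

(** * Density of bump functions *)

Section Density.
Context {R : realType} (U : set (pt3 R)).
Hypothesis oU : open U.

Local Notation mu := (leb3 R).
Local Notation sqi := (sq_integrable (leb3 R) (U : set (borel3 R))).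

Let mU : measurable (U : set (borel3 R)) := open_measurable3 oU.

(** The closure of the bump functions in [L^2(U)], with squared distances. *)
Definition approximable (f : pt3 R -> R) : Prop :=
  sqi f /\ forall e : R, 0 < e ->
    exists2 theta, bump_in U theta & \int[mu]_(x in U) (f x - theta x) ^+ 2 <= e.

Lemma bump_sq_integrable theta : bump_in U theta -> sqi theta.
Proof. by move=> /bump_test_function; exact: test_function_L2. Qed.

(** The closure is stable under dominated pointwise limits; this is how all
    limits are taken below. *)
Lemma approximable_limit (f : nat -> pt3 R -> R) (g h : pt3 R -> R) :
  (forall n, approximable (f n)) -> sqi h ->
  (forall n x, U x -> `|f n x| <= `|h x|) ->
  (forall x, U x -> f n x @[n --> \oo] --> g x) -> approximable g.
Proof.
move=> af Lh fh fg.
have mf n : measurable_fun (U : set (borel3 R)) (f n) by case: (af n) => -[].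
have [Lg /cvgrPdist_le c] := sq_integrable_dominated mU mf Lh fh fg.
split=> // e e0; have [N _ HN] := c _ (divr_gt0 e0 (ltr0Sn _ 3)).
have [Lf /(_ _ (divr_gt0 e0 (ltr0Sn _ 3)))[th bth fth]] := af N.
exists th => //; have Lth := bump_sq_integrable bth.
apply: le_trans (sq_triangle mU Lg Lf Lth) _.
have := HN N (leqnn N); rewrite /= sub0r normrN ger0_norm; last first.
  by apply: Rintegral_ge0 => x _; exact: sqr_ge0.
have -> : \int[mu]_(x in U) (f N x - g x) ^+ 2 = \int[mu]_(x in U) (g x - f N x) ^+ 2.
  by apply: eq_Rintegral => x _; rewrite -sqrrN opprB.
by move: fth; lra.
Qed.

Lemma approximable0 : approximable (fun=> 0).
Proof.
split=> [|e e0]; first exact: sq_integrable0.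
exists (fun=> 0); first exact: bump_in0.
by under eq_Rintegral do rewrite subrr expr0n/=; rewrite Rintegral_cst// mul0r ltW.
Qed.

Lemma approximableD f g : approximable f -> approximable g ->
  approximable (fun x => f x + g x).
Proof.
move=> [Lf af] [Lg ag]; split=> [|e e0]; first exact: sq_integrableD.
have [th bth fth] := af _ (divr_gt0 e0 (ltr0Sn _ 3)).
have [ph bph gph] := ag _ (divr_gt0 e0 (ltr0Sn _ 3)).
exists (fun x => th x + ph x); first exact: bump_inD.
have Lth := bump_sq_integrable bth; have Lph := bump_sq_integrable bph.
have := sq_triangle mU (sq_integrableD mU Lf Lg) (sq_integrableD mU Lth Lg)
  (sq_integrableD mU Lth Lph).
have -> : \int[mu]_(x in U) (f x + g x - (th x + g x)) ^+ 2 = \int[mu]_(x in U) (f x - th x) ^+ 2.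
  by apply: eq_Rintegral => x _; congr (_ ^+ 2); ring.
have -> : \int[mu]_(x in U) (th x + g x - (th x + ph x)) ^+ 2 = \int[mu]_(x in U) (g x - ph x) ^+ 2.
  by apply: eq_Rintegral => x _; congr (_ ^+ 2); ring.
move: fth gph; lra.
Qed.

Lemma approximableZ k f : approximable f -> approximable (fun x => k * f x).
Proof.
move=> [Lf af]; split=> [|e e0]; first exact: sq_integrableZ.
have k1 : 0 < k ^+ 2 + 1 by rewrite ltr_wpDl ?sqr_ge0.
have [th bth fth] := af _ (divr_gt0 e0 k1).
exists (fun x => k * th x); first exact: bump_inZ.
have [_ i] := sq_integrableB mU Lf (bump_sq_integrable bth).
under eq_Rintegral do rewrite -mulrBr exprMn.
rewrite (RintegralZl _ mU i).
have := ler_wpM2l (sqr_ge0 k) fth; move/le_trans; apply.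
rewrite mulrCA ger_pMr// ler_pdivrMr// mul1r; lra.
Qed.

Definition approximable_set (A : set (pt3 R)) : Prop := approximable (\1_A : pt3 R -> R).

Lemma indic_normS (A B : set (pt3 R)) x : A `<=` B -> `|\1_A x : R| <= `|\1_B x : R|.
Proof.
move=> AB; rewrite !indicE; have [xA|xA] := pselect (A x).
  by rewrite !mem_set//; exact: AB.
by rewrite memNset// normr0 normr_ge0.
Qed.

Lemma approximable_set_box a b : closed_box a b `<=` U -> approximable_set (open_box a b).
Proof.
move=> abU; apply: (@approximable_limit (fun n => box_plateau n a b) _
  (\1_(closed_box a b))).
- move=> n; have bn := bump_box n abU; split; first exact: bump_sq_integrable.
  move=> e e0; exists (box_plateau n a b) => //.
  by under eq_Rintegral do rewrite subrr expr0n/=; rewrite Rintegral_cst// mul0r ltW.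
- exact: sq_integrable_closed_box.
- move=> n x _; apply: le_trans (box_plateau_norm n a b x) _.
  by apply: indic_normS; exact: open_box_sub.
- by move=> x _; exact: box_plateau_cvg.
Qed.

Lemma approximable_set0 : approximable_set set0.
Proof. by rewrite /approximable_set indic0; exact: approximable0. Qed.

Lemma approximable_setD A B : B `<=` A -> approximable_set A -> approximable_set B ->
  approximable_set (A `\` B).
Proof.
move=> BA aA aB; have := approximableD aA (approximableZ (-1) aB).
congr approximable; apply/funext => x; rewrite mulN1r !indicE in_setD.
by case: (boolP (x \in B)) => xB; rewrite ?andbT ?andbF ?subr0// mem_set ?subrr//; apply: BA; rewrite inE in xB.
Qed.

Lemma approximable_setU A B : A `&` B = set0 -> approximable_set A -> approximable_set B ->
  approximable_set (A `|` B).
Proof.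
move=> AB aA aB; have := approximableD aA aB.
congr approximable; apply/funext => x; rewrite !indicE in_setU.
case: (boolP (x \in A)) => xA; case: (boolP (x \in B)) => xB; rewrite ?addr0 ?add0r//.
have : (A `&` B) x by rewrite !inE in xA xB.
by rewrite AB.
Qed.

(** Inside [L], complements and countable disjoint unions of approximable sets are
    approximable, the latter by [approximable_limit] with bound the indicator of
    [L]; so the Dynkin class theorem applies. *)
Lemma approximable_set_dynkin d (X : measurableType d) (pr : borel3 R -> X)
    (G : set (set X)) (L : set (pt3 R)) :
  @measurable _ X = <<s G >> -> setI_closed G ->
  approximable_set L ->
  (forall A, G A -> approximable_set (pr @^-1` A `&` L)) ->
  forall A, measurable A -> approximable_set (pr @^-1` A `&` L).
Proof.
move=> GE GI aL aG A; rewrite GE => sA.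
apply: (@dynkin_induction _ X G (fun A => approximable_set (pr @^-1` A `&` L)) GE GI _ aG _ _ A sA).
- by rewrite preimage_setT setTI.
- move=> B mB aB; have -> : pr @^-1` (~` B) `&` L = L `\` (pr @^-1` B `&` L).
    by apply/seteqP; split=> x /=; [move=> [? ?]; split => // -[]|move=> [? h]; split => // ?; apply: h].
  by apply: approximable_setD.
- move=> F mF tF aF.
  pose S n := \big[setU/set0]_(i < n) (pr @^-1` F i `&` L).
  have SE n : S n = pr @^-1` (\bigcup_(i in `I_n) F i) `&` L.
    rewrite /S -(bigcup_mkord n (fun i => pr @^-1` F i `&` L)); apply/seteqP; split=> x.
      by move=> [i ? [? ?]]; split => //; exists i.
    by move=> [[i ? ?] ?]; exists i.
  have aS n : approximable_set (S n).
    elim: n => [|n IH]; first by rewrite /S big_ord0; exact: approximable_set0.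
    rewrite /S big_ord_recr/=; apply: approximable_setU => //.
    rewrite -[\big[_/_]_(_ < _) _]/(S n) SE; apply/seteqP; split=> // x [[[i /= ni Fi] _] [Fn _]].
    have := trivIsetP.1 tF i n I I; rewrite neq_ltn ni => /(_ isT) /seteqP[+ _].
    by apply; split; [exact: Fi|exact: Fn].
  apply: (@approximable_limit (fun n => \1_(S n)) _ (\1_L)).
  + by move=> n; exact: aS.
  + by case: aL.
  + by move=> n x _; apply: indic_normS; rewrite SE; exact: subIsetr.
  + move=> x _; rewrite indicE.
    have [xS|xS] := pselect ((pr @^-1` (\bigcup_k F k) `&` L) x).
      have [[i _ Fi] Lx] := xS; rewrite [x \in _]mem_set//; apply: cvg_near_cst; near=> n.
      rewrite indicE mem_set// SE; split=> //; exists i => //=.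
      by near: n; exact: nbhs_infty_gt.
    rewrite [x \in _]memNset//; apply: cvg_near_cst; near=> n; rewrite indicE memNset// SE.
    by move=> [[i _ Fi] Lx]; apply: xS; split => //; exists i.
Unshelve. all: by end_near. Qed.

Lemma rays_setI_closed : setI_closed (@RGenOInfty.G R).
Proof.
move=> _ _ [x ->] [y ->]; exists (Num.max x y); apply/seteqP; split=> z/=.
  by rewrite !in_itv/= !andbT gt_max => -[-> ->].
by rewrite !in_itv/= !andbT gt_max => /andP[].
Qed.

Lemma rays_generate : @measurable _ (measurableTypeR R) = <<s @RGenOInfty.G R >>.
Proof. exact: RGenOInfty.measurableE. Qed.

Lemma closed_box_mono (a a' b : pt3 R) : a.1.1 <= a'.1.1 -> a.1.2 <= a'.1.2 -> a.2 <= a'.2 ->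
  closed_box a' b `<=` closed_box a b.
Proof.
move=> h1 h2 h3 x [[]]/=; rewrite !in_itv/= => /andP[k1 k1'] /andP[k2 k2'] /andP[k3 k3'].
by split; [split|] => /=; rewrite in_itv/=; apply/andP; split=> //;
  [exact: le_trans k1|exact: le_trans k2|exact: le_trans k3].
Qed.

Lemma ray1_box (r : R) a b : (fun x => x.1.1) @^-1` `]r, +oo[ `&` open_box a b =
  open_box (Num.max r a.1.1, a.1.2, a.2) b.
Proof.
apply/seteqP; split=> x /=.
  rewrite in_itv/= andbT => -[rx [[]]]; rewrite /= !in_itv/= => /andP[h k] h2 h3.
  by split; [split|] => /=; rewrite in_itv/= ?gt_max ?rx ?h ?k.
move=> [[]]; rewrite /= !in_itv/= gt_max => /andP[/andP[-> h] k] h2 h3.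
by split => //; split; [split|] => /=; rewrite in_itv/= ?h.
Qed.

Lemma ray2_box (r : R) a b : (fun x => x.1.2) @^-1` `]r, +oo[ `&` open_box a b =
  open_box (a.1.1, Num.max r a.1.2, a.2) b.
Proof.
apply/seteqP; split=> x /=.
  rewrite in_itv/= andbT => -[rx [[]]]; rewrite /= !in_itv/= => h2 /andP[h k] h3.
  by split; [split|] => /=; rewrite in_itv/= ?gt_max ?rx ?h ?k.
move=> [[]]; rewrite /= !in_itv/= gt_max => h2 /andP[/andP[-> h] k] h3.
by split => //; split; [split|] => /=; rewrite in_itv/= ?h.
Qed.

Lemma ray3_box (r : R) a b : (fun x => x.2) @^-1` `]r, +oo[ `&` open_box a b =
  open_box (a.1, Num.max r a.2) b.
Proof.
apply/seteqP; split=> x /=.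
  rewrite in_itv/= andbT => -[rx [[]]]; rewrite /= !in_itv/= => h2 h3 /andP[h k].
  by split; [split|] => /=; rewrite in_itv/= ?gt_max ?rx ?h ?k.
move=> [[]]; rewrite /= !in_itv/= gt_max => h2 h3 /andP[/andP[-> h] k].
by split => //; split; [split|] => /=; rewrite in_itv/= ?h.
Qed.

Lemma setICA' {X : Type} (A B C : set X) : A `&` (B `&` C) = B `&` (A `&` C).
Proof. by rewrite !setIA (setIC A). Qed.

(** One Dynkin argument for each coordinate, then one for each of the two products
    that build the sigma-algebra of the space. *)
Lemma approximable_set_trace a b (A : set (borel3 R)) : closed_box a b `<=` U ->
  measurable A -> approximable_set (A `&` open_box a b).
Proof.
pose c1 (x : borel3 R) : measurableTypeR R := x.1.1.
pose c2 (x : borel3 R) : measurableTypeR R := x.1.2.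
pose c3 (x : borel3 R) : measurableTypeR R := x.2.
have GE := rays_generate; have GI := rays_setI_closed.
(* rays in one coordinate cut a box into a box, so each coordinate can be
   treated in turn; the box varies because the later cuts shrink it *)
have st1 (A1 : set (measurableTypeR R)) a' b' : closed_box a' b' `<=` U -> measurable A1 ->
    approximable_set (c1 @^-1` A1 `&` open_box a' b').
  move=> abU mA1; apply: (approximable_set_dynkin GE GI _ _ mA1).
    exact: approximable_set_box.
  move=> _ [r ->]; rewrite ray1_box; apply: approximable_set_box.
  by apply: subset_trans abU; apply: closed_box_mono; rewrite //= le_max lexx orbT.
have st2 (A1 A2 : set (measurableTypeR R)) a' b' : closed_box a' b' `<=` U ->
    measurable A1 -> measurable A2 ->
    approximable_set (c2 @^-1` A2 `&` (c1 @^-1` A1 `&` open_box a' b')).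
  move=> abU mA1 mA2; apply: (approximable_set_dynkin GE GI _ _ mA2).
    exact: st1.
  move=> _ [r ->]; rewrite setICA' ray2_box; apply: st1 => //.
  by apply: subset_trans abU; apply: closed_box_mono; rewrite //= le_max lexx orbT.
have st3 (A1 A2 A3 : set (measurableTypeR R)) a' b' : closed_box a' b' `<=` U ->
    measurable A1 -> measurable A2 -> measurable A3 ->
    approximable_set (c3 @^-1` A3 `&` (c2 @^-1` A2 `&` (c1 @^-1` A1 `&` open_box a' b'))).
  move=> abU mA1 mA2 mA3; apply: (approximable_set_dynkin GE GI _ _ mA3).
    exact: st2.
  move=> _ [r ->]; rewrite setICA' (setICA' (c3 @^-1` _)) ray3_box; apply: st2 => //.
  by apply: subset_trans abU; apply: closed_box_mono; rewrite //= le_max lexx orbT.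
move=> abU mA.
(* from rectangles to the product sigma-algebras, first of the plane *)
have st4 (S : set (measurableTypeR R * measurableTypeR R)%type) (A3 : set (measurableTypeR R)) :
    measurable S -> measurable A3 ->
    approximable_set ((fst : borel3 R -> _) @^-1` S `&` (c3 @^-1` A3 `&` open_box a b)).
  move=> mS mA3.
  apply: (approximable_set_dynkin (@measurable_prod_measurableType _ _ (measurableTypeR R) (measurableTypeR R)) _ _ _ mS).
  - move=> _ _ [A1 mA1 [A2 mA2 <-]] [B1 mB1 [B2 mB2 <-]]; rewrite -setXI.
    by exists (A1 `&` B1); [exact: measurableI|exists (A2 `&` B2) => //; exact: measurableI].
  - by have := st3 setT setT A3 a b abU measurableT measurableT mA3; rewrite !preimage_setT !setTI.
  - move=> _ [A1 mA1 [A2 mA2 <-]].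
    have := st3 A1 A2 A3 a b abU mA1 mA2 mA3; congr approximable_set.
    by apply/seteqP; split=> x; rewrite /c1 /c2 /c3 /=; tauto.
apply: (approximable_set_dynkin (pr := id)
  (@measurable_prod_measurableType _ _ (measurableTypeR R * measurableTypeR R)%type (measurableTypeR R)) _ _ _ mA).
- move=> _ _ [A1 mA1 [A2 mA2 <-]] [B1 mB1 [B2 mB2 <-]]; rewrite -setXI.
  by exists (A1 `&` B1); [exact: measurableI|exists (A2 `&` B2) => //; exact: measurableI].
- exact: approximable_set_box.
- move=> _ [S mS [A3 mA3 <-]]; have := st4 S A3 mS mA3; congr approximable_set.
  by apply/seteqP; split=> x; rewrite /c3 /=; tauto.
Qed.

Let exhaust (n : nat) : set (pt3 R) := \bigcup_(i in `I_n) rational_box U i.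

Let measurable_exhaust n : measurable (exhaust n : set (borel3 R)).
Proof. by apply: bigcup_measurable => i _; exact: measurable_rational_box. Qed.

(** The boxes overlap, so the sets are cut along the differences of successive
    unions of boxes. *)
Let approximable_set_exhaust n (A : set (borel3 R)) : measurable A ->
  approximable_set (A `&` exhaust n).
Proof.
elim: n A => [|n IH] A mA.
  have -> : exhaust 0 = set0 by rewrite /exhaust II0 bigcup_set0.
  by rewrite setI0; exact: approximable_set0.
have -> : A `&` exhaust n.+1 =
    (A `&` exhaust n) `|` ((A `\` exhaust n) `&` rational_box U n).
  apply/seteqP; split=> x.
    move=> [Ax [i /= /ltnSE]]; rewrite leq_eqVlt => /predU1P[->|ni] Ki.
      by have [En|En] := pselect (exhaust n x); [left|right].
    by left; split => //; exists i.
  move=> [[Ax [i /= ni Ki]]|[[Ax _] Kn]]; split => //.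
    by exists i => //=; exact: ltnW.
  by exists n => /=.
apply: approximable_setU.
- by apply/seteqP; split=> // x [[_ ?] [[_ ?] _]].
- exact: IH.
- have [a [b [[abU ->]|->]]] := rational_boxP U n.
    by apply: approximable_set_trace => //; exact: measurableD.
  by rewrite setI0; exact: approximable_set0.
Qed.

Import HBNNSimple.

Let approximable_sfun n (s : {nnsfun borel3 R >-> R}) :
  approximable (fun x => s x * \1_(exhaust n) x).
Proof.
have -> : (fun x => s x * \1_(exhaust n) x) = (fun x : pt3 R =>
    \sum_(y <- finmap.enum_fset (fset_set (range s))) (y * \1_((s @^-1` [set y]) `&` exhaust n) x)).
  apply/funext => x; rewrite [in LHS]fimfunE fsbig_finite//= mulr_suml.
  apply: eq_bigr => y _; rewrite -mulrA; congr (_ * _).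
  by rewrite !indicE in_setI -natrM mulnb.
elim: (finmap.enum_fset _) => [|y l IH].
  by under eq_fun do rewrite big_nil; exact: approximable0.
under eq_fun do rewrite big_cons.
apply: approximableD => //; apply: approximableZ.
exact: approximable_set_exhaust.
Qed.

(** Simple functions, restricted to finitely many boxes, increase to the positive
    and to the negative part of [f]. *)
Lemma approximable_sq_integrable (f : pt3 R -> R) : sqi f -> approximable f.
Proof.
have pos (g : pt3 R -> R) : sqi g -> (forall x, 0 <= g x) -> approximable g.
  move=> Lg g0; have mg : measurable_fun (U : set (borel3 R)) (EFin \o g).
    by apply/measurable_EFinP; case: Lg.
  pose s (n : nat) : {nnsfun borel3 R >-> R} := nnsfun_approx mU mg n.
  have sg x : U x -> s n x @[n --> \oo] --> g x.
    move=> Ux; have := @cvg_nnsfun_approx _ _ _ _ mU _ mg (fun x _ => g0 x) x Ux.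
    by move/fine_cvgP => [_]; apply: cvg_trans.
  have sle n x : U x -> s n x <= g x.
    move=> Ux; have nd : nondecreasing_seq (s ^~ x).
      by move=> i j ij; apply/lefP/(nd_nnsfun_approx mU mg ij).
    have := nondecreasing_cvgn_le nd (cvgP _ (sg x Ux)) n.
    by rewrite (cvg_lim _ (sg x Ux)).
  apply: (@approximable_limit (fun n x => s n x * \1_(exhaust n) x) _ g) => //.
  - move=> n x Ux; rewrite normrM !ger0_norm//.
    by apply: le_trans (sle n x Ux); rewrite ler_piMr.
  - move=> x Ux; rewrite -[g x]mulr1; apply: cvgM; first exact: sg.
  have [i _ Ki] : (\bigcup_n rational_box U n) x by rewrite bigcup_rational_box.
  apply: cvg_near_cst; near=> n; rewrite indicE mem_set//; exists i => //=.
  by near: n; exact: nbhs_infty_gt.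
move=> Lf; have mf : measurable_fun (U : set (borel3 R)) f by case: Lf.
have -> : f = (fun x => Num.max (f x) 0 + -1 * Num.max (- f x) 0).
  by apply/funext => x; have [|] := leP (f x) 0; have [|] := leP (- f x) 0; lra.
apply: approximableD; last apply: approximableZ; apply: pos.
- apply: (sq_integrable_le mU _ Lf); first by apply: measurable_maxr.
  move=> x _; rewrite ger0_norm ?le_max ?lexx ?orbT//.
  by rewrite ge_max ler_norm normr_ge0.
- by move=> x; rewrite le_max lexx orbT.
- apply: (sq_integrable_le mU _ Lf); first by apply: measurable_maxr => //; exact: measurable_funN.
  move=> x _; rewrite ger0_norm ?le_max ?lexx ?orbT//.
  by rewrite ge_max normr_ge0 andbT -normrN ler_norm.
- by move=> x; rewrite le_max lexx orbT.
Unshelve. all: by end_near. Qed.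

End Density.

(** * Integration by parts *)

Section IntegrationByParts.
Context {R : realType}.

(** The two difference quotients coincide. *)
Lemma derive_line (V : normedModType R) (f : V -> R) (c : R -> V) (v : V) (a : R) :
  (forall s, c (s + a) = s *: v + c a) -> derivable f (c a) v ->
  derivable (f \o c) a 1 /\ 'D_1 (f \o c) a = 'D_v f (c a).
Proof.
move=> cE df.
have E : (fun h : R => h^-1 *: (((f \o c) \o shift a) (h *: 1) - (f \o c) a)) =
    (fun h : R => h^-1 *: ((f \o shift (c a)) (h *: v) - f (c a))).
  by apply/funext => h /=; rewrite /GRing.scale/= mulr1 cE.
by split; [rewrite /derivable E|rewrite /derive E].
Qed.

(** The complement of [K] is open, so [f] is zero near any point off [K]. *)
Lemma derive_out (V : normedModType R) (f : V -> R) (K : set V) (x v : V) :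
  closed K -> (forall y, ~ K y -> f y = 0) -> ~ K x -> 'D_v f x = 0.
Proof.
move=> cK f0 Kx; have [->|v0] := eqVneq v 0; first by rewrite derive0.
rewrite (@near_eq_derive _ _ _ _ (cst (0 : R))) ?derive_cst//.
have : nbhs x (~` K) by apply: open_nbhs_nbhs; split => //; exact: closed_openC.
by apply: filterS => y /f0.
Qed.

(** The fundamental theorem of calculus on an interval that contains the support. *)
Lemma integral_derive_compact (f : R -> R) (M : R) : 0 < M ->
  (forall x, derivable f x 1) -> continuous ('D_1 f) ->
  (forall x, M < `|x| -> f x = 0) -> (\int[leb1 R]_x ('D_1 f x)%:E = 0)%E.
Proof.
move=> M0 df cf f0; pose m := M + 1.
have out x : x \notin `[- m, m] -> 'D_1 f x = 0.
  move=> xm; apply: (@derive_out _ _ `[- M, M]).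
  - exact: interval_closed.
  - move=> y yM; apply: f0; rewrite ltNge; apply/negP => h; apply: yM.
    by rewrite /= in_itv/= -ler_norml.
  - move=> /= xM; move/negP: xm; apply; move: xM; rewrite !in_itv/= /m => /andP[? ?].
    by apply/andP; split; lra.
rewrite (_ : (fun x => ('D_1 f x)%:E) = ((fun x => ('D_1 f x)%:E) \_ `[- m, m]%classic)); last first.
  apply/funext => x; rewrite patchE; case: ifPn => // xm; rewrite out//.
  by apply: contra xm => xm; rewrite inE.
rewrite -integral_mkcond (@continuous_FTC2 _ _ f).
- have fm : f m = 0 by apply: f0; rewrite gtr0_norm /m; lra.
  have fNm : f (- m) = 0 by apply: f0; rewrite normrN gtr0_norm /m; lra.
  by rewrite fm fNm subee.
- by rewrite /m; lra.
- exact: continuous_subspaceT.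
- have cvf : continuous f.
    by move=> x; apply: differentiable_continuous; exact/derivable1_diffP.
  split => //; first by apply: cvg_at_right_filter; exact: cvf.
  by apply: cvg_at_left_filter; exact: cvf.
- by move=> x _; rewrite derive1E.
Qed.

(** The inner factor of [leb3], named so that it can carry its structure of
    sigma-finite measure. *)
Definition leb2 : set (measurableTypeR R * measurableTypeR R)%type -> \bar R :=
  (leb1 R \x leb1 R)%E.

HB.instance Definition _ := Measure.on leb2.

Let leb2_sigma_finite : sigma_finite setT leb2.
Proof.
exists (fun n : nat => `[- n%:R, n%:R]%classic `*` `[- n%:R, n%:R]%classic).
  apply/esym/seteqP; split=> // -[x y] _.
  exists (Num.truncn (Num.max `|x| `|y|)).+1 => //.
  have := truncnS_gt (Num.max `|x| `|y|); rewrite gt_max => /andP[hx hy].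
  by split; rewrite /= in_itv/= -ler_norml ltW.
move=> k; set J := `[_, _]%classic.
have mJ : measurable (J : set (measurableTypeR R)) by exact: measurable_itv.
split; first exact: measurableX.
have -> : leb2 (J `*` J) = (leb1 R J * leb1 R J)%E by exact: product_measure1E.
have itv : (leb1 R J < +oo)%E.
  by rewrite lebesgue_measure_itv; case: ifPn => _; rewrite ltry.
by rewrite lte_mul_pinfty// ge0_fin_numE.
Qed.
HB.instance Definition _ := Measure_isSigmaFinite.Build _ _ _ leb2 leb2_sigma_finite.

Lemma unitpE : [/\ unitp 0 = (1, 0, 0) :> pt3 R, unitp 1 = (0, 1, 0) :> pt3 R
  & unitp 2%:R = (0, 0, 1) :> pt3 R].
Proof. by split. Qed.

Lemma scale_add3 (s : R) (u v : pt3 R) : s *: u + v =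
  (s * u.1.1 + v.1.1, s * u.1.2 + v.1.2, s * u.2 + v.2).
Proof. by []. Qed.

Lemma continuous_triple (a b c : R -> R) : continuous a -> continuous b ->
  continuous c -> continuous (fun s => (a s, b s, c s) : pt3 R).
Proof. by move=> ca cb cc s; exact: (cvg_pair (cvg_pair (ca s) (cb s)) (cc s)). Qed.

(** By Fubini one integrates first along the direction of derivation, where
    [integral_derive_compact] applies. *)
Lemma integral_partial_eq0 (i : 'I_3) (f : pt3 R -> R) (K : set (pt3 R)) :
  (forall x, derivable f x (unitp i)) -> continuous (partial i f) ->
  compact K -> (forall x, ~ K x -> f x = 0) ->
  (\int[leb3 R]_x (partial i f x)%:E = 0)%E.
Proof.
move=> df cf cK f0.
have clK : closed K by apply: compact_closed => //; exact: norm_hausdorff.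
have ig : (leb3 R).-integrable setT (fun x : borel3 R => (partial i f x)%:E).
  apply: (compact_support_integrable _ cf cK) => //.
  by move=> x Kx; exact: (derive_out _ clK f0).
have [M M0 KM] : exists2 M : R, 0 < M & forall x, K x ->
    [/\ `|x.1.1| <= M, `|x.1.2| <= M & `|x.2| <= M].
  have /compact_bounded[M [_ KM]] := cK; exists (`|M| + 1); first by rewrite ltr_wpDl.
  move=> x Kx; have := KM (`|M| + 1) _ _ Kx; rewrite /= !prod_normE/= !ge_max.
  by rewrite ltr_pwDr ?ler_norm// => /(_ isT)/andP[/andP[]].
(* [c] runs along a line parallel to the i-th axis *)
have line (c : R -> pt3 R) :
    (forall s a, c (s + a) = s *: unitp i + c a) -> continuous c ->
    (forall r, M < `|r| -> ~ K (c r)) ->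
    (\int[leb1 R]_r (partial i f (c r))%:E = 0)%E.
  move=> cE cc cM; have dl r := derive_line (fun s => cE s r) (df (c r)).
  under eq_integral do rewrite /partial -(dl _).2.
  apply: (integral_derive_compact M0) => [r|r|r rM]; first by have [] := dl r.
    have -> : 'D_1 (f \o c) = partial i f \o c by apply/funext => s; rewrite (dl s).2.
    by apply: continuous_comp; [exact: cc|exact: cf].
  by apply: f0; exact: cM.
have i3 : [\/ i = 0, i = 1 | i = 2%:R].
  by case: i {df cf ig line} => -[|[|[|//]]] ilt;
    [constructor 1|constructor 2|constructor 3]; exact: val_inj.
have [e0 e1 e2] := unitpE; case: i3 => iE.
- rewrite -[LHS](integral21_prod_meas1 (m1 := leb2) (m2 := leb1 R) ig).
  rewrite (@ae_eq_integral _ _ _ (leb1 R) setT (cst 0%E))// ?integral0//.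
    exact: (measurable_fubini_G (m1 := leb2) (m2 := leb1 R) ig).
  have := ae_integrable2 (m1 := leb2) (m2 := leb1 R) ig.
  apply: filterS => r ir _.
  rewrite /fubini_G -[LHS](integral21_prod_meas1 (m1 := leb1 R) (m2 := leb1 R) ir).
  apply: integral0_eq => q _; rewrite /fubini_G/=.
  apply: (line (fun s => (s, q, r))).
  + by move=> s a; rewrite iE ?e0 ?e1 scale_add3/= !(mulr1, mulr0, add0r).
  + by apply: continuous_triple => s; do ?[exact: cvg_id|exact: cvg_cst].
  + by move=> s sM /KM[/=]; rewrite leNgt sM.
- rewrite -[LHS](integral21_prod_meas1 (m1 := leb2) (m2 := leb1 R) ig).
  rewrite (@ae_eq_integral _ _ _ (leb1 R) setT (cst 0%E))// ?integral0//.
    exact: (measurable_fubini_G (m1 := leb2) (m2 := leb1 R) ig).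
  have := ae_integrable2 (m1 := leb2) (m2 := leb1 R) ig.
  apply: filterS => r ir _.
  rewrite /fubini_G -[LHS](integral12_prod_meas1 (m1 := leb1 R) (m2 := leb1 R) ir).
  apply: integral0_eq => q _; rewrite /fubini_F/=.
  apply: (line (fun s => (q, s, r))).
  + by move=> s a; rewrite iE ?e0 ?e1 scale_add3/= !(mulr1, mulr0, add0r).
  + by apply: continuous_triple => s; do ?[exact: cvg_id|exact: cvg_cst].
  + by move=> s sM /KM[/= _]; rewrite leNgt sM.
- rewrite -[LHS](integral12_prod_meas1 (m1 := leb2) (m2 := leb1 R) ig).
  apply: integral0_eq => q _; rewrite /fubini_F/=.
  apply: (line (fun s => (q, s))).
  + by case: q => q1 q2 s a; rewrite iE e2 scale_add3/= !(mulr1, mulr0, add0r).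
  + by case: q => q1 q2; apply: continuous_triple => s; do ?[exact: cvg_id|exact: cvg_cst].
  + by move=> s sM /KM[/= _ _]; rewrite leNgt sM.
Qed.

Variables (Omega : set (pt3 R)).
Hypothesis oO : open Omega.
Let mO : measurable (Omega : set (borel3 R)) := open_measurable3 oO.

Lemma test_function_derivable (U : set (pt3 R)) f x v : test_function U f -> derivable f x v.
Proof. by move=> [/(_ [::])[_]]. Qed.

Lemma test_function_partial_continuous (U : set (pt3 R)) f i :
  test_function U f -> continuous (partial i f).
Proof. by move=> [/(_ [:: unitp i])[]]. Qed.

Lemma test_function_support (U : set (pt3 R)) f : test_function U f ->
  exists K, [/\ compact K, closed K, K `<=` U & forall x, ~ K x -> f x = 0].
Proof.
move=> [_ cK KU]; exists (closure [set x | f x != 0]).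
split=> //; first exact: closed_closure.
move=> x Kx; apply/eqP; apply: contrapT => fx; apply: Kx.
by apply: subset_closure; exact/negP.
Qed.

Lemma test_function_partial_L2 (U : set (pt3 R)) f i :
  test_function U f -> L2scalar Omega (partial i f).
Proof.
move=> tf; have [K [cK clK _ f0]] := test_function_support tf.
apply: (compact_support_sq_integrable mO (test_function_partial_continuous tf) cK).
by move=> x Kx; exact: (derive_out _ clK f0).
Qed.

(** The product of two test functions is compactly supported, and so the integral
    of its partial derivative vanishes. *)
Lemma test_function_weak_partial (U : set (pt3 R)) i f : test_function U f ->
  weak_partial Omega i f (partial i f).
Proof.
move=> tf theta tth.
have [K [cK clK KO th0]] := test_function_support tth.
have dM x : 'D_(unitp i) (f * theta) x = f x * partial i theta x + theta x * partial i f x.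
  by rewrite deriveM//; [exact: test_function_derivable tf|exact: test_function_derivable tth].
have h0 x : ~ K x -> (f * theta) x = 0 by move=> Kx; rewrite fctE th0 ?mulr0.
have ch : continuous (partial i (f * theta)).
  have -> : partial i (f * theta) = (fun x => f x * partial i theta x + theta x * partial i f x).
    by apply/funext => x; rewrite /partial dM.
  move=> x; apply: cvgD; apply: cvgM.
  - exact: (test_function_continuous tf).
  - exact: (test_function_partial_continuous tth).
  - exact: (test_function_continuous tth).
  - exact: (test_function_partial_continuous tf).
have := @integral_partial_eq0 i (f * theta) K.
move=> /(_ _ ch cK h0); rewrite (_ : (\int[leb3 R]_x _)%E =
  (\int[leb3 R]_(x in Omega) ((f x * partial i theta x + partial i f x * theta x)%:E))%E); last first.
  rewrite [RHS]integral_mkcond; apply: eq_integral => x _; rewrite patchE.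
  case: ifPn => [xO|xO]; first by rewrite /partial dM (mulrC (theta x)).
  rewrite /partial (derive_out _ clK h0)// => /KO Ox.
  by move: xO; rewrite mem_set.
have i1 : (leb3 R).-integrable Omega (fun x : borel3 R => (f x * partial i theta x)%:E).
  apply: (sq_integrableM mO); first exact: (test_function_L2 mO tf).
  exact: test_function_partial_L2 tth.
have i2 : (leb3 R).-integrable Omega (fun x : borel3 R => (partial i f x * theta x)%:E).
  apply: (sq_integrableM mO); first exact: test_function_partial_L2 tf.
  exact: (test_function_L2 mO tth).
move=> H.
have {}H : \int[leb3 R]_(x in Omega) (f x * partial i theta x + partial i f x * theta x) = 0.
  rewrite /Rintegral H// => x.
  by apply: derivableM; [exact: test_function_derivable tf|exact: test_function_derivable tth].
by apply/eqP; rewrite -addr_eq0 -(RintegralD mO i1 i2) H.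
Qed.

End IntegrationByParts.

(** * The spaces H(curl) and H_0(curl) *)

Section CurlSpaces.
Context {R : realType} (Omega : set (pt3 R)).
Hypothesis oO : open Omega.
Let mO : measurable (Omega : set (borel3 R)) := open_measurable3 oO.
Implicit Types u v w : vf3 R.

Local Notation mu := (leb3 R).
Local Notation "<| u , v |>" := (ip Omega u v) (at level 0, format "<| u ,  v |>").
Local Notation nrm := (nnorm (L2 Omega)).

Lemma test_function0 : test_function Omega (fun=> 0).
Proof. exact: (bump_test_function (bump_in0 Omega)). Qed.

Lemma test_field_L2 theta : test_field Omega theta -> L2 Omega theta.
Proof. by move=> tth i; exact: (test_function_L2 mO (tth i)). Qed.

Lemma L2_curl theta : test_field Omega theta -> L2 Omega (curl theta).
Proof.
move=> tth i; have := sq_integrableB mO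
  (test_function_partial_L2 oO (i + 1) (tth (i + 2%:R)))
  (test_function_partial_L2 oO (i + 2%:R) (tth (i + 1))).
by congr sq_integrable; apply/funext => x; rewrite mxE.
Qed.

(** Componentwise, from the density of bump functions. *)
Lemma test_field_dense u (e : R) : L2 Omega u -> 0 < e ->
  exists2 theta, test_field Omega theta & nrm (u - theta) <= e.
Proof.
move=> Lu e0; have e3 : 0 < e ^+ 2 / 3 by rewrite divr_gt0// exprn_gt0.
have /choice[th thP] : forall i, exists th, bump_in Omega th /\
    \int[mu]_(x in Omega) (u x i 0 - th x) ^+ 2 <= e ^+ 2 / 3.
  move=> i; have [_ /(_ _ e3)[th bth h]] := approximable_sq_integrable oO (Lu i).
  by exists th.
pose theta : vf3 R := fun x => \col_i th i x.
have tth : test_field Omega theta.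
  move=> i; have [/bump_test_function + _] := thP i.
  by congr test_function; apply/funext => x; rewrite mxE.
have Lth := test_field_L2 tth.
exists theta => //; rewrite -(@ler_pXn2r _ 2)// ?nnegrE ?nrm_ge0 ?(ltW e0)//.
have Lut := L2B mO Lu Lth.
rewrite nrm_sqr (ip_sum mO)//; apply: (@le_trans _ _ (\sum_(i < 3) e ^+ 2 / 3)).
  apply: ler_sum => i _; have [_] := thP i; apply: le_trans.
  rewrite le_eqVlt; apply/orP; left; apply/eqP.
  by apply: eq_Rintegral => x _; rewrite -expr2 fctE mxE fctE !mxE.
by rewrite sumr_const card_ord -mulr_natr; lra.
Qed.

(** The fundamental lemma of the calculus of variations, as a consequence of the
    density of test fields. *)
Lemma ip_eq_test w w' v : L2 Omega w -> L2 Omega w' -> L2 Omega v ->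
  (forall theta, test_field Omega theta -> <|w, theta|> = <|w', theta|>) ->
  <|w, v|> = <|w', v|>.
Proof.
move=> Lw Lw' Lv ww'; apply/eqP; rewrite -subr_eq0 -ipBl// -normr_le0.
have Lww' := L2B mO Lw Lw'; have n0 := nrm_ge0 Omega (w - w').
apply/ler_addgt0Pr => e e0; rewrite add0r.
have e1 : 0 < e / (nrm (w - w') + 1) by rewrite divr_gt0// ltr_wpDl.
have [th tth vth] := test_field_dense Lv e1.
have Lth := test_field_L2 tth; have Lvth := L2B mO Lv Lth.
have -> : <|w - w', v|> = <|w - w', v - th|>.
  by rewrite ipBr// [X in _ = _ - X]ipBl// ww'// subrr subr0.
apply: le_trans (ip_le mO Lww' Lvth) _.
apply: le_trans (ler_wpM2l n0 vth) _.
rewrite mulrCA ger_pMr// ler_pdivrMr ?ltr_wpDl// mul1r lerDl//.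
Qed.

(** The components of the curl are differences of partial derivatives, also in
    the weak sense. It serves twice: for [H^1] and for test fields. *)
Lemma weak_partials_curl u (g : 'I_3 -> 'I_3 -> pt3 R -> R) : L2 Omega u ->
  (forall i j, L2scalar Omega (g i j)) ->
  (forall i j, weak_partial Omega j (fun x => u x i 0) (g i j)) ->
  let w : vf3 R := fun x => \col_i (g (i + 2%:R) (i + 1) x - g (i + 1) (i + 2%:R) x) in
  L2 Omega w /\ weak_curl Omega u w.
Proof.
move=> Lu Lg wg w.
have Lw : L2 Omega w.
  move=> i; have := sq_integrableB mO (Lg (i + 2%:R) (i + 1)) (Lg (i + 1) (i + 2%:R)).
  by congr sq_integrable; apply/funext => x; rewrite mxE.
split => // theta tth.
have Lth := test_field_L2 tth; have Lcth := L2_curl tth.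
pose G i j k := \int[mu]_(x in Omega) (g i j x * theta x k 0).
have iG i j k : mu.-integrable Omega (fun x => (g i j x * theta x k 0)%:E).
  exact: (sq_integrableM mO (Lg i j) (Lth k)).
have lhs : <|u, curl theta|> = \sum_i (G i (i + 2%:R) (i + 1) - G i (i + 1) (i + 2%:R)).
  rewrite (ip_sum mO)//; apply: eq_bigr => i _.
  have i1 := sq_integrableM mO (Lu i) (test_function_partial_L2 oO (i + 1) (tth (i + 2%:R))).
  have i2 := sq_integrableM mO (Lu i) (test_function_partial_L2 oO (i + 2%:R) (tth (i + 1))).
  transitivity (\int[mu]_(x in Omega) (u x i 0 * partial (i + 1) (fun y => theta y (i + 2%:R) 0) x -
      u x i 0 * partial (i + 2%:R) (fun y => theta y (i + 1) 0) x)).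
    by apply: eq_Rintegral => x _; rewrite mxE mulrBr.
  rewrite (RintegralB mO i1 i2) (wg i (i + 1) _ (tth (i + 2%:R))).
  by rewrite (wg i (i + 2%:R) _ (tth (i + 1))) opprK addrC.
have rhs : <|w, theta|> = \sum_i (G (i + 2%:R) (i + 1) i - G (i + 1) (i + 2%:R) i).
  rewrite (ip_sum mO)//; apply: eq_bigr => i _.
  rewrite -(RintegralB mO (iG _ _ _) (iG _ _ _)).
  by apply: eq_Rintegral => x _; rewrite mxE mulrBl.
(* the two sums agree up to a cyclic shift of the index *)
rewrite lhs rhs !sumrB; congr (_ - _).
- rewrite [RHS](reindex_inj (addIr 1)); apply: eq_bigr => i _.
  by case: i => -[|[|[|//]]] ilt; congr (G _ _ _); exact: val_inj.
- rewrite [RHS](reindex_inj (addIr 2%:R)); apply: eq_bigr => i _.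
  by case: i => -[|[|[|//]]] ilt; congr (G _ _ _); exact: val_inj.
Qed.

Lemma H1_Hcurl u : H1 Omega u -> Hcurl Omega u.
Proof.
move=> [Lu du]; split => //.
have /choice[g gP] : forall i, exists g : 'I_3 -> pt3 R -> R, forall j,
    L2scalar Omega (g j) /\ weak_partial Omega j (fun x => u x i 0) (g j).
  move=> i; have /choice[g gP] : forall j, exists g, L2scalar Omega g /\
      weak_partial Omega j (fun x => u x i 0) g.
    by move=> j; have [g ? ?] := du i j; exists g.
  by exists g.
have := @weak_partials_curl u g Lu (fun i j => (gP i j).1) (fun i j => (gP i j).2).
by move=> [Lw ww]; eexists; [exact: Lw|exact: ww].
Qed.

Lemma test_field_weak_curl theta : test_field Omega theta -> weak_curl Omega theta (curl theta).
Proof.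
move=> tth; have Lth := test_field_L2 tth.
have [_] := @weak_partials_curl theta (fun i j => partial j (fun x => theta x i 0)) Lth
  (fun i j => test_function_partial_L2 oO j (tth i))
  (fun i j => test_function_weak_partial oO j (tth i)).
by [].
Qed.

Lemma test_field_Hcurl theta : test_field Omega theta -> Hcurl Omega theta.
Proof.
move=> tth; split; first exact: test_field_L2.
by exists (curl theta); [exact: L2_curl|exact: test_field_weak_curl].
Qed.

Lemma curlwP u : Hcurl Omega u -> L2 Omega (curlw Omega u) /\ weak_curl Omega u (curlw Omega u).
Proof.
move=> [Lu [w Lw uw]]; rewrite /curlw.
exact: (@getPex _ [set w | L2 Omega w /\ weak_curl Omega u w]
  (ex_intro _ w (conj Lw uw))).
Qed.

Lemma Hcurl_L2 u : Hcurl Omega u -> L2 Omega u. Proof. by case. Qed.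

Lemma curlw_L2 u : Hcurl Omega u -> L2 Omega (curlw Omega u).
Proof. by case/curlwP. Qed.

(** [curlw] is a choice among representatives; only its inner products with
    square integrable fields are meaningful. *)
Lemma curlw_unique u w v : Hcurl Omega u -> L2 Omega w -> weak_curl Omega u w ->
  L2 Omega v -> <|curlw Omega u, v|> = <|w, v|>.
Proof.
move=> /curlwP[Lc uc] Lw uw Lv; apply: ip_eq_test => // theta tth.
by rewrite -uc// -uw.
Qed.

Lemma weak_curl_lin a u v w w' : L2 Omega u -> L2 Omega v -> L2 Omega w -> L2 Omega w' ->
  weak_curl Omega u w -> weak_curl Omega v w' -> weak_curl Omega (a *: u + v) (a *: w + w').
Proof.
move=> Lu Lv Lw Lw' uw vw' theta tth.
have Lth := test_field_L2 tth; have Lc := L2_curl tth.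
have Lau := L2Z mO a Lu; have Law := L2Z mO a Lw.
by rewrite !ipDl// !ipZl// uw// vw'.
Qed.

Lemma Hcurl_lin a u v : Hcurl Omega u -> Hcurl Omega v -> Hcurl Omega (a *: u + v).
Proof.
move=> [Lu [w Lw uw]] [Lv [w' Lw' vw']]; split.
  by apply: L2D => //; exact: L2Z.
by exists (a *: w + w'); [apply: L2D => //; exact: L2Z|exact: weak_curl_lin].
Qed.

Lemma Hcurl0 : Hcurl Omega (0 : vf3 R).
Proof.
apply: test_field_Hcurl => i.
rewrite (_ : (fun x => _) = (fun=> 0)); first exact: test_function0.
by apply/funext => x; rewrite mxE.
Qed.

Lemma HcurlZ a u : Hcurl Omega u -> Hcurl Omega (a *: u).
Proof. by move=> Hu; have := Hcurl_lin a Hu Hcurl0; rewrite addr0. Qed.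

Lemma ip_curlw_lin a u v z : Hcurl Omega u -> Hcurl Omega v -> L2 Omega z ->
  <|curlw Omega (a *: u + v), z|> = a * <|curlw Omega u, z|> + <|curlw Omega v, z|>.
Proof.
move=> Hu Hv Lz; have [Lcu wu] := curlwP Hu; have [Lcv wv] := curlwP Hv.
have Lacu := L2Z mO a Lcu; have Lu := Hcurl_L2 Hu; have Lv := Hcurl_L2 Hv.
rewrite (curlw_unique (Hcurl_lin a Hu Hv) (L2D mO Lacu Lcv))//.
  by rewrite ipDl// ipZl.
exact: weak_curl_lin.
Qed.

Lemma ip_curlwZ a u z : Hcurl Omega u -> L2 Omega z ->
  <|curlw Omega (a *: u), z|> = a * <|curlw Omega u, z|>.
Proof.
move=> Hu Lz; have [Lcu wu] := curlwP Hu; have Lu := Hcurl_L2 Hu.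
rewrite (curlw_unique (HcurlZ a Hu) (L2Z mO a Lcu))// ?ipZl// => theta tth.
by rewrite !ipZl ?wu//; [exact: test_field_L2|exact: L2_curl].
Qed.

Lemma nnorm_HcurlZ a u : Hcurl Omega u ->
  nnorm (Hcurl Omega) (a *: u) = `|a| * nnorm (Hcurl Omega) u.
Proof.
move=> Hu; have Lu := Hcurl_L2 Hu; have LZ := L2Z mO a Lu.
have Lcu := curlw_L2 Hu; have Lcau := curlw_L2 (HcurlZ a Hu).
have -> : nnorm (Hcurl Omega) (a *: u) = Num.sqrt (a ^+ 2 *
    (<|u, u|> + <|curlw Omega u, curlw Omega u|>)).
  congr Num.sqrt; rewrite mulrDr expr2 -!mulrA; congr (_ + _).
    by rewrite ipZl// ipZr.
  by rewrite ip_curlwZ// (ipC _ (curlw _ u)) ip_curlwZ.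
by rewrite sqrtrM ?sqr_ge0// sqrtr_sqr.
Qed.

Lemma H0curl_Hcurl u : H0curl Omega u -> Hcurl Omega u. Proof. by case. Qed.

Lemma H0curl_lin a u v : H0curl Omega u -> H0curl Omega v -> H0curl Omega (a *: u + v).
Proof.
move=> [Hu tu] [Hv tv]; split; first exact: Hcurl_lin.
move=> phi H1phi; have := tu _ H1phi; have := tv _ H1phi; rewrite /tangential_trace.
have Hphi := H1_Hcurl H1phi; have Lphi := Hcurl_L2 Hphi; have Lcphi := curlw_L2 Hphi.
have Lu := Hcurl_L2 Hu; have Lv := Hcurl_L2 Hv; have Lau := L2Z mO a Lu.
rewrite ip_curlw_lin// ipDl// ipZl// => h1 h2.
have -> : forall p q r s : R, a * p + q - (a * r + s) = a * (p - r) + (q - s).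
  by move=> *; ring.
by rewrite h1 h2 mulr0 addr0.
Qed.

Lemma test_field_H0curl theta : test_field Omega theta -> H0curl Omega theta.
Proof.
move=> tth; have Hth := test_field_Hcurl tth; split=> // phi /H1_Hcurl Hphi.
have Lth := test_field_L2 tth; have Lcth := L2_curl tth.
have [Lcphi wphi] := curlwP Hphi; have Lphi := Hcurl_L2 Hphi.
rewrite /tangential_trace (curlw_unique Hth Lcth (test_field_weak_curl tth))//.
by rewrite ipC -wphi// ipC subrr.
Qed.

Lemma H0curl0 : H0curl Omega (0 : vf3 R).
Proof.
apply: test_field_H0curl => i.
rewrite (_ : (fun x => _) = (fun=> 0)); first exact: test_function0.
by apply/funext => x; rewrite mxE.
Qed.

(** Test fields suffice to identify [w] as the curl of [u]. The remaining [phi],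
    among which are all fields of [H^1], then say that the tangential trace
    vanishes. This is how the boundary condition is recovered from an identity
    tested without boundary conditions. *)
Lemma H0curl_by_parts u w : L2 Omega u -> L2 Omega w ->
  (forall phi, Hcurl Omega phi -> <|w, phi|> = <|u, curlw Omega phi|>) ->
  H0curl Omega u /\ weak_curl Omega u w.
Proof.
move=> Lu Lw uw.
have wuw : weak_curl Omega u w.
  move=> theta tth; have Hth := test_field_Hcurl tth; rewrite uw//.
  rewrite ipC [RHS]ipC; apply/esym/curlw_unique => //; first exact: L2_curl.
  exact: test_field_weak_curl.
have Hu : Hcurl Omega u by split => //; exists w.
split => //; split=> // phi /H1_Hcurl Hphi; have Lphi := Hcurl_L2 Hphi.
by rewrite /tangential_trace (curlw_unique Hu Lw wuw)// uw// subrr.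
Qed.

End CurlSpaces.

(** * Tensor coefficients *)

Section Tensors.
Context {R : realType} (Omega : set (pt3 R)).
Hypothesis mO : measurable (Omega : set (borel3 R)).
Implicit Types (u v : vf3 R) (A : tf3 R).

Local Notation mu := (leb3 R).
Local Notation "<| u , v |>" := (ip Omega u v) (at level 0, format "<| u ,  v |>").
Local Notation nrm := (nnorm (L2 Omega)).

Lemma dotE (a b : 'cV[R]_3) : dot a b = (a^T *m b) 0 0.
Proof. by rewrite mxE; apply: eq_bigr => i _; rewrite mxE. Qed.

Lemma dot_sqr_le (a : 'cV[R]_3) i : a i 0 ^+ 2 <= dot a a.
Proof.
rewrite /dot (bigD1 i)//= -expr2 lerDl.
by apply: sumr_ge0 => j _; rewrite -expr2 sqr_ge0.
Qed.

Lemma dot_eq0 (a : 'cV[R]_3) : dot a a <= 0 -> a = 0.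
Proof.
move=> a0; apply/matrixP => i j; rewrite (ord1 j) mxE.
by apply/eqP; rewrite -sqrf_eq0 eq_le sqr_ge0 andbT (le_trans (dot_sqr_le a i)).
Qed.

Lemma ae_ge0_Rintegral (f : borel3 R -> R) : measurable_fun (Omega : set (borel3 R)) f ->
  {ae mu, forall x, Omega x -> 0 <= f x} -> 0 <= \int[mu]_(x in Omega) f x.
Proof.
move=> mf f0.
have -> : \int[mu]_(x in Omega) f x = \int[mu]_(x in Omega) (Num.max (f x) 0).
  apply: (eq_ae_Rintegral mO) => //; first exact: measurable_maxr.
  by apply: filterS f0 => x + Ox => /(_ Ox) fx; rewrite max_l.
by apply: Rintegral_ge0 => x _; rewrite le_max lexx orbT.
Qed.

Lemma ae_le_Rintegral (f g : borel3 R -> R) :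
  mu.-integrable Omega (fun x => (f x)%:E) -> mu.-integrable Omega (fun x => (g x)%:E) ->
  {ae mu, forall x, Omega x -> f x <= g x} ->
  \int[mu]_(x in Omega) f x <= \int[mu]_(x in Omega) g x.
Proof.
move=> fi gi fg; rewrite -subr_ge0 -(RintegralB mO gi fi); apply: ae_ge0_Rintegral.
  by apply/measurable_EFinP; exact: (measurable_int _ (integrable_EFinB mO gi fi)).
by apply: filterS fg => x + Ox => /(_ Ox); rewrite subr_ge0.
Qed.

Lemma ae_le_sq_integrable (f g : borel3 R -> R) :
  measurable_fun (Omega : set (borel3 R)) f -> sq_integrable mu Omega g ->
  {ae mu, forall x, Omega x -> `|f x| <= `|g x|} -> sq_integrable mu Omega f.
Proof.
move=> mf [mg g2] fg; split=> //.
have mf2 : measurable_fun (Omega : set (borel3 R)) (fun x => (f x ^+ 2)%:E).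
  exact/measurable_EFinP/measurable_funX.
apply/integrableP; split=> //; have /integrableP[mg2] := g2; apply: le_lt_trans.
apply: ae_ge0_le_integral => //; [exact: measurableT_comp|exact: measurableT_comp|].
apply: filterS fg => x + Ox => /(_ Ox) fgx; rewrite !abse_EFin lee_fin !normrX.
by rewrite lerXn2r ?nnegrE.
Qed.

Lemma tappE A u x i : tapp A u x i 0 = \sum_j A x i j * u x j 0.
Proof. by rewrite /tapp mxE. Qed.

Section Bounded.
Variable A : tf3 R.
Hypothesis AL : Linf_tensor Omega A.

Lemma tapp_L2 u : L2 Omega u -> L2 Omega (tapp A u).
Proof.
have [mA [M AM]] := AL; move=> Lu i.
have : sq_integrable mu Omega (fun x => \sum_j A x i j * u x j 0).
  apply: (sq_integrable_sum mO) => j.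
  apply: (@ae_le_sq_integrable _ (fun x => M * u x j 0)).
  - apply: measurable_funM; [exact: mA|by case: (Lu j)].
  - by apply: sq_integrableZ => //; exact: Lu.
  - apply: filterS AM => x + Ox => /(_ Ox) AxM; rewrite !normrM.
    by rewrite ler_wpM2r// (le_trans (AxM i j))// ler_norm.
by congr sq_integrable; apply/funext => x; rewrite tappE.
Qed.

Lemma tapp_bounded : exists2 C : R, 0 <= C &
  forall u, L2 Omega u -> nrm (tapp A u) <= C * nrm u.
Proof.
have [mA [M AM]] := AL; exists (3 * `|M|); first by rewrite mulr_ge0.
move=> u Lu; have Lau := tapp_L2 Lu.
have C0 : 0 <= 3 * `|M| * nrm u by rewrite !mulr_ge0 ?nrm_ge0.
rewrite -(@ler_pXn2r _ 2)// ?nnegrE ?nrm_ge0//.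
rewrite exprMn !nrm_sqr /ip.
rewrite -(RintegralZl _ mO (integrable_dot mO Lu Lu)).
apply: ae_le_Rintegral; first exact: integrable_dot.
  exact: (integrable_EFinZ mO _ (integrable_dot mO Lu Lu)).
apply: filterS AM => x + Ox => /(_ Ox) AxM.
have comp i : tapp A u x i 0 ^+ 2 <= 3 * M ^+ 2 * dot (u x) (u x).
  have AM2 j : (A x i j * u x j 0) ^+ 2 <= M ^+ 2 * u x j 0 ^+ 2.
    rewrite exprMn ler_wpM2r ?sqr_ge0// -(@real_normK _ (A x i j)) ?num_real//.
    rewrite -(@real_normK _ M) ?num_real// lerXn2r ?nnegrE//.
    by rewrite (le_trans (AxM i j))// ler_norm.
  rewrite tappE /dot !big_ord_recl !big_ord0 !addr0.
  set a := A x i _ * _; set b := A x i _ * _; set c := A x i _ * _.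
  have := AM2 ord0; have := AM2 (lift ord0 ord0); have := AM2 (lift ord0 (lift ord0 ord0)).
  rewrite -/a -/b -/c.
  have := sqr_ge0 (a - b); have := sqr_ge0 (a - c); have := sqr_ge0 (b - c).
  nra.
rewrite {1}/dot; apply: (@le_trans _ _ (\sum_(i < 3) (3 * M ^+ 2 * dot (u x) (u x)))).
  by apply: ler_sum => i _; rewrite -expr2 comp.
rewrite sumr_const card_ord -mulr_natr exprMn real_normK ?num_real//.
by rewrite le_eqVlt; apply/orP; left; apply/eqP; ring.
Qed.

Lemma tapp_sym u v : {ae mu, forall x, Omega x -> (A x)^T = A x} ->
  L2 Omega u -> L2 Omega v -> <|tapp A u, v|> = <|u, tapp A v|>.
Proof.
move=> As Lu Lv; apply: (eq_ae_Rintegral mO).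
- by apply/measurable_EFinP; exact: (measurable_int _ (integrable_dot mO (tapp_L2 Lu) Lv)).
- by apply/measurable_EFinP; exact: (measurable_int _ (integrable_dot mO Lu (tapp_L2 Lv))).
apply: filterS As => x + Ox => /(_ Ox) Ax.
by rewrite !dotE /tapp trmx_mul Ax mulmxA.
Qed.

Lemma tapp_coercive (c : R) u : {ae mu, forall x, Omega x ->
    forall xi, c * dot xi xi <= dot xi (A x *m xi)} ->
  L2 Omega u -> c * <|u, u|> <= <|u, tapp A u|>.
Proof.
move=> Ac Lu; rewrite /ip -(RintegralZl _ mO (integrable_dot mO Lu Lu)).
apply: ae_le_Rintegral.
- exact: (integrable_EFinZ mO _ (integrable_dot mO Lu Lu)).
- exact: (integrable_dot mO Lu (tapp_L2 Lu)).
by apply: filterS Ac => x + Ox => /(_ Ox (u x)).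
Qed.

Lemma tapp_psd u : {ae mu, forall x, Omega x -> forall xi, 0 <= dot xi (A x *m xi)} ->
  L2 Omega u -> 0 <= <|u, tapp A u|>.
Proof.
move=> Ap Lu; have := @tapp_coercive 0 u; rewrite mul0r; apply => //.
by apply: filterS Ap => x + Ox xi => /(_ Ox xi); rewrite mul0r.
Qed.

End Bounded.

(** A row vector in the kernel is annihilated by the quadratic form. *)
Lemma coercive_unitmx (c : R) (M : 'M[R]_3) : 0 < c ->
  (forall xi, c * dot xi xi <= dot xi (M *m xi)) -> M \in unitmx.
Proof.
move=> c0 Mc; rewrite -row_free_unit -kermx_eq0; apply/eqP/row_matrixP => i.
rewrite row0; set w := row i (kermx M).
have wM : w *m M = 0 by rewrite /w -row_mul mulmx_ker row0.
have := Mc w^T; rewrite (dotE _ (M *m _)) trmxK mulmxA wM mul0mx mxE.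
rewrite pmulr_rle0// => /dot_eq0 w0.
by rewrite -[w]trmxK w0 trmx0.
Qed.

Lemma coercive_invmx_le (c : R) (M : 'M[R]_3) i j : 0 < c ->
  (forall xi, c * dot xi xi <= dot xi (M *m xi)) -> `|invmx M i j| <= c^-1.
Proof.
move=> c0 Mc; have Mu := coercive_unitmx c0 Mc.
(* for the j-th column [z] of the inverse, [c |z|^2 <= z . M z = z_j <= |z|] *)
pose z : 'cV[R]_3 := col j (invmx M).
have Mz : M *m z = delta_mx j 0 by rewrite /z colE mulmxA mulmxV// mul1mx.
have dz : dot z (M *m z) = z j 0.
  rewrite Mz /dot (bigD1 j)//= [X in _ * X]mxE !eqxx mulr1 big1 ?addr0// => k kj.
  by rewrite [X in _ * X]mxE (negPf kj) mulr0.
have zj := dot_sqr_le z j; have zi := dot_sqr_le z i; have := Mc z; rewrite dz => zM.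
have -> : invmx M i j = z i 0 by rewrite mxE.
set D := dot z z in zj zi zM; have D0 : 0 <= D by apply: le_trans zi; exact: sqr_ge0.
have cD : c ^+ 2 * D <= 1.
  have [D_gt0|D_le0] := ltP 0 D; last first.
    by rewrite (_ : D = 0) ?mulr0//; apply/eqP; rewrite eq_le D_le0.
  have h : (c * D) ^+ 2 <= D.
    apply: le_trans zj; rewrite -[leRHS]real_normK ?num_real//.
    rewrite lerXn2r ?nnegrE ?mulr_ge0 ?(ltW c0)//.
    by apply: le_trans zM _; rewrite ler_norm.
  by rewrite -(ler_pM2r D_gt0) mul1r -mulrA -expr2 -exprMn.
rewrite -(@ler_pXn2r _ 2)// ?nnegrE ?invr_ge0 ?(ltW c0)//.
rewrite real_normK ?num_real// exprVn -[leRHS]mul1r ler_pdivlMr ?exprn_gt0//.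
by rewrite mulrC; apply: le_trans cD; rewrite ler_wpM2l ?sqr_ge0.
Qed.

Lemma measurable_invr : measurable_fun [set: R] (fun x : R => x^-1).
Proof.
(* the power function is used at [x ^+ 2], since it is unrelated to the inverse
   at negative arguments *)
have -> : (fun x : R => x^-1) = (fun x => x * (x ^+ 2) `^ (- 1)).
  apply/funext => x; rewrite powR_inv1 ?sqr_ge0// expr2 invfM.
  have [->|x0] := eqVneq x 0; first by rewrite invr0 mul0r.
  by rewrite mulrA divff// mul1r.
apply: measurable_funM => //.
apply: (@measurableT_comp _ _ _ _ _ _ (@powR R ^~ (-1))); first exact: measurable_powR.
exact: measurable_funX.
Qed.

Lemma measurable_det n (B : borel3 R -> 'M[R]_n) :
  (forall i j, measurable_fun (Omega : set (borel3 R)) (fun x => B x i j)) ->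
  measurable_fun (Omega : set (borel3 R)) (fun x => \det (B x)).
Proof.
move=> mB; rewrite /determinant; apply: measurable_sum => s.
apply: measurable_funM; first exact: measurable_cst.
by apply: measurable_prod => i _; exact: mB.
Qed.

(** Boundedness is [coercive_invmx_le]; measurability follows from the adjugate
    formula. *)
Lemma Linf_tensor_invmx (A : tf3 R) (c : R) : 0 < c -> Linf_tensor Omega A ->
  {ae mu, forall x, Omega x -> forall xi, c * dot xi xi <= dot xi (A x *m xi)} ->
  Linf_tensor Omega (fun x => invmx (A x)).
Proof.
move=> c0 [mA _] Ac; split; last first.
  exists c^-1; apply: filterS Ac => x + Ox => /(_ Ox) Axc i j.
  exact: coercive_invmx_le.
move=> i j.
have mdet : measurable_fun (Omega : set (borel3 R)) (fun x : borel3 R => \det (A x)).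
  exact: measurable_det.
have madj : measurable_fun (Omega : set (borel3 R)) (fun x : borel3 R => (\adj (A x)) i j).
  have -> : (fun x : borel3 R => (\adj (A x)) i j) =
      (fun x => (-1) ^+ (j + i) * \det (row' j (col' i (A x)))).
    by apply/funext => x; rewrite mxE.
  apply: measurable_funM => //; apply: measurable_det => k l.
  by under eq_fun do rewrite !mxE; exact: mA.
(* [invmx] is the identity on singular matrices *)
have -> : (fun x : pt3 R => invmx (A x) i j) = (fun x =>
    if \det (A x) == 0 then A x i j else (\det (A x))^-1 * (\adj (A x)) i j).
  apply/funext => x; rewrite /invmx unitmxE unitfE.
  by case: eqP => //= _; rewrite mxE.
apply: measurable_fun_if => //.
- by apply: measurable_fun_eqr => //; exact: measurable_cst.
- apply: (measurable_funS mO); first exact: subIsetl.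
  exact: mA.
- apply: (measurable_funS mO); first exact: subIsetl.
  by apply: measurable_funM => //; exact: (measurableT_comp measurable_invr mdet).
Qed.

Lemma invmx_sym (A : tf3 R) : {ae mu, forall x, Omega x -> (A x)^T = A x} ->
  {ae mu, forall x, Omega x -> (invmx (A x))^T = invmx (A x)}.
Proof.
by apply: filterS => x + Ox => /(_ Ox) Ax; rewrite trmx_inv Ax.
Qed.

(** With [eta = A^-1 xi], one has [xi . A^-1 xi = eta . A eta]. *)
Lemma invmx_psd (A : tf3 R) (c : R) : 0 < c ->
  {ae mu, forall x, Omega x -> forall xi, c * dot xi xi <= dot xi (A x *m xi)} ->
  {ae mu, forall x, Omega x -> forall xi, 0 <= dot xi (invmx (A x) *m xi)}.
Proof.
move=> c0; apply: filterS => x + Ox xi => /(_ Ox) Axc.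
have Au := coercive_unitmx c0 Axc.
have -> : dot xi (invmx (A x) *m xi) =
    dot (invmx (A x) *m xi) (A x *m (invmx (A x) *m xi)).
  by rewrite mulmxA mulmxV// mul1mx; apply: eq_bigr => i _; rewrite mulrC.
apply: le_trans (Axc _); apply: mulr_ge0; first exact: ltW.
by apply: sumr_ge0 => i _; rewrite -expr2 sqr_ge0.
Qed.

End Tensors.

(** * Antiderivatives of scalar functions of time *)

Section DominatedBounded.
Context d (T : measurableType d) (R : realType) (mu : {measure set T -> \bar R}).
Variables (D : set T) (mD : measurable D) (fD : (mu D < +oo)%E).

Lemma bounded_integrable (f : T -> R) (K : R) : measurable_fun D f ->
  (forall x, D x -> `|f x| <= K) -> mu.-integrable D (fun x => (f x)%:E).
Proof.
move=> mf fK; apply: measurable_bounded_integrable => //.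
exists K; split; first exact: num_real.
by move=> L KL x Dx; apply: le_trans (ltW KL); exact: fK.
Qed.

Lemma Rintegral_bounded_cvg (f : nat -> T -> R) (g : T -> R) (K : R) :
  (forall n, measurable_fun D (f n)) -> (forall n x, D x -> `|f n x| <= K) ->
  (forall x, D x -> f n x @[n --> \oo] --> g x) ->
  \int[mu]_(x in D) f n x @[n --> \oo] --> \int[mu]_(x in D) g x.
Proof.
move=> mf fK fg.
have mg : measurable_fun D g by apply: measurable_fun_cvg fg.
have iK : mu.-integrable D (fun=> K%:E).
  by apply: (@bounded_integrable (cst K) `|K|).
have [] := @dominated_convergence _ _ _ mu D mD
  (fun n x => (f n x)%:E) (fun x => (g x)%:E) (fun=> K%:E).
- by move=> n; exact/measurable_EFinP.
- exact/measurable_EFinP.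
- by apply: aeW => x Dx; apply: cvg_EFin; [near=> n|exact: fg].
- exact: iK.
- by apply: aeW => x n Dx; rewrite abse_EFin lee_fin; exact: fK.
move=> ig _; have fing : (\int[mu]_(x in D) (g x)%:E \is a fin_num)%E.
  exact: integrable_fin_num.
by rewrite -[X in _ --> X -> _](fineK fing) => /fine_cvgP[_]; apply: cvg_trans.
Unshelve. all: by end_near. Qed.

Lemma Rintegral_le_bound (f : T -> R) (K : R) : measurable_fun D f ->
  (forall x, D x -> `|f x| <= K) ->
  `|\int[mu]_(x in D) f x| <= K * fine (mu D).
Proof.
move=> mf fK; have fi := bounded_integrable mf fK.
apply: le_trans (le_normr_Rintegral mD fi) _.
rewrite -Rintegral_cst//; apply: le_Rintegral => //.
  exact: (integrable_norm fi).
by apply: (@bounded_integrable (cst K) `|K|).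
Qed.

Lemma Rintegral_sum (n : nat) (f : 'I_n -> T -> R) :
  (forall i, mu.-integrable D (fun x => (f i x)%:E)) ->
  \int[mu]_(x in D) (\sum_(i < n) f i x) = \sum_(i < n) \int[mu]_(x in D) f i x.
Proof.
move=> fi; rewrite /Rintegral sum_fine//; last by move=> i _; exact: integrable_fin_num.
rewrite -(integral_sum mD fi); congr fine; apply: eq_integral => x _.
by rewrite sumEFin.
Qed.

End DominatedBounded.

Section TimePrimitive.
Context {R : realType} (T : R) (J : set R).
Hypothesis T0 : 0 < T.
Hypothesis mJ : measurable (J : set (measurableTypeR R)).
Hypothesis JT : J `<=` `]0, T[.
Local Notation mu := (leb1 R).

Lemma times_lty : (mu J < +oo)%E.
Proof.
apply: (@le_lt_trans _ _ (mu `]0, T[%classic)).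
  by apply: le_measure => //; rewrite inE//; exact: measurable_itv.
by rewrite lebesgue_measure_itv/=; case: ifPn => _; rewrite ltry.
Qed.

Section Cutoff.
Variables (t : R) (n : nat).
Hypothesis t0T : 0 < t < T.
Let N : R := n.+1%:R.

(** A smooth approximation of [r |-> max (t - r) 0] that vanishes near [0]. The
    smoothing near [t] is harmless because [t - r] is small there. The derivative
    of the factor that cuts off at [0] forms [cutoff_head], and the rest of the
    derivative is [cutoff_body]. *)
Definition cutoff (r : R) : R := (t - r) * (step (N * (t - r)) * step (N * r - 1)).

Definition cutoff_body (r : R) : R :=
  - (step (N * (t - r)) * step (N * r - 1))
  - (N * (t - r)) * derive1 step (N * (t - r)) * step (N * r - 1).

Definition cutoff_head (r : R) : R :=
  N * (t - r) * step (N * (t - r)) * derive1 step (N * r - 1).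

Let N0 : 0 < N. Proof. by rewrite ltr0n. Qed.

Lemma is_derive_step (x : R) : is_derive x 1 (@step R) (derive1 step x).
Proof. by rewrite derive1E; apply: derivableP; exact: derivable_step. Qed.

Lemma derive1_cutoff r : derive1 cutoff r = cutoff_body r + cutoff_head r.
Proof.
have d1 : is_derive r 1 (fun s : R => t - s) (-1).
  have := @is_deriveB _ _ _ (cst t) id r 1 _ _ (is_derive_cst t r 1) (is_derive_id r 1).
  by rewrite sub0r.
have d2 : is_derive r 1 (fun s : R => N * (t - s)) (- N).
  by have := @is_deriveZ _ _ _ _ N _ _ _ d1; rewrite /GRing.scale/= mulrN1.
have d3 : is_derive r 1 (fun s : R => N * s - 1) N.
  have dN := @is_deriveZ _ _ _ id N r 1 _ (is_derive_id r 1).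
  have := @is_deriveB _ _ _ _ (cst (1 : R)) r 1 _ _ dN (is_derive_cst (1 : R) r 1).
  by rewrite /GRing.scale/= mulr1 subr0.
have d4 := @is_derive1_comp R (@step R) _ r _ _ (is_derive_step (N * (t - r))) d2.
have d5 := @is_derive1_comp R (@step R) _ r _ _ (is_derive_step (N * r - 1)) d3.
have d6 := @is_deriveM _ _ (step \o (fun s => N * (t - s))) (step \o (fun s => N * s - 1)) r 1 _ _ d4 d5.
have d7 := @is_deriveM _ _ (fun s => t - s) _ r 1 _ _ d1 d6.
rewrite derive1E; apply: (etrans (@derive_val _ _ _ _ _ _ _ d7)).
rewrite /cutoff_body /cutoff_head /GRing.scale/=.
rewrite -[X in _ + X * _ = _]/(step (N * (t - r)) * step (N * r - 1)).
set a := step _; set b := step _; set a' := derive1 _ _; set b' := derive1 _ _.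
ring.
Qed.

Lemma elementary_cutoff : elementary cutoff.
Proof.
have eN : elementary (fun r : R => - r).
  have -> : (fun r : R => - r) = (fun x => cst (-1) x * id x).
    by apply/funext => x; rewrite mulN1r.
  by apply: elementaryM; [exact: elementary_cst|exact: elementary_id].
have et : elementary (fun r : R => t - r).
  by apply: (@elementaryD _ _ (cst t)) => //; exact: elementary_cst.
apply: elementaryM => //; apply: elementaryM; apply: elementary_step.
  by apply: (@elementaryM _ _ (cst N)) => //; exact: elementary_cst.
apply: (@elementaryD _ _ _ (cst (-1))); last exact: elementary_cst.
by apply: (@elementaryM _ _ (cst N)); [exact: elementary_cst|exact: elementary_id].
Qed.

Lemma cutoff_out r : r \notin `[N^-1, t] -> cutoff r = 0.
Proof.
rewrite in_itv/= negb_and -!ltNge /cutoff => /orP[rN|tr].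
  rewrite (@step_le0 _ (N * r - 1)) ?mulr0// subr_le0 -ler_pdivlMl// mulr1.
  exact: ltW.
by rewrite (@step_le0 _ (N * (t - r))) ?mul0r ?mulr0// mulr_ge0_le0 ?(ltW N0)// subr_le0 ltW.
Qed.

Lemma test_function_cutoff : test_function `]0, T[%classic cutoff.
Proof.
have sK : closure [set x | cutoff x != 0] `<=` `[N^-1, t]%classic.
  rewrite closureE; apply: smallest_sub; first exact: interval_closed.
  by move=> x /= fx; apply: contraNT fx => xN; rewrite cutoff_out.
split; first exact: (elementary_smooth elementary_cutoff).
  by apply: subclosed_compact sK; [exact: closed_closure|exact: segment_compact].
apply: subset_trans sK _ => x /=; rewrite !in_itv/= => /andP[h1 h2].
move/andP: t0T => [_ tT]; rewrite (le_lt_trans h2 tT) andbT.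
by apply: lt_le_trans h1; rewrite invr_gt0.
Qed.

Lemma measurable_cutoff : measurable_fun (J : set (measurableTypeR R)) cutoff.
Proof.
apply: measurable_funTS; apply: continuous_measurable_fun => x.
by apply: differentiable_continuous; apply: elementary_differentiable; exact: elementary_cutoff.
Qed.

Lemma continuous_step_affine (f : R -> R) (a b : R) : continuous f ->
  continuous (fun r => f (a * r + b)).
Proof.
move=> cf x; apply: continuous_comp; last exact: cf.
by apply: cvgD; [apply: cvgM; [exact: cvg_cst|exact: cvg_id]|exact: cvg_cst].
Qed.

Let E1 (f : R -> R) : (fun r => f (N * (t - r))) = (fun r => f (- N * r + N * t)).
Proof. by apply/funext => r; congr f; ring. Qed.

Let measurable_affine (f : R -> R) (a b : R) : continuous f ->
  measurable_fun (J : set (measurableTypeR R)) (fun r => f (a * r + b)).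
Proof.
move=> cf; apply: measurable_funTS; apply: continuous_measurable_fun.
exact: continuous_step_affine.
Qed.

Lemma measurable_cutoff_body : measurable_fun (J : set (measurableTypeR R)) cutoff_body.
Proof.
have m1 : measurable_fun (J : set (measurableTypeR R)) (fun r => step (N * (t - r))).
  by rewrite (E1 (@step R)); apply: measurable_affine; exact: continuous_step.
have m2 : measurable_fun (J : set (measurableTypeR R)) (fun r => derive1 step (N * (t - r))).
  by rewrite (E1 (derive1 (@step R))); apply: measurable_affine; exact: continuous_derive1_step.
have m3 : measurable_fun (J : set (measurableTypeR R)) (fun r => step (N * r - 1)).
  exact: (@measurable_affine (@step R) N (-1) continuous_step).
have m4 : measurable_fun (J : set (measurableTypeR R)) (fun r => N * (t - r)).
  by rewrite (E1 id); apply: (@measurable_affine id) => x; exact: cvg_id.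
apply: measurable_funB; first by apply: measurable_funN; exact: measurable_funM.
by apply: measurable_funM => //; exact: measurable_funM.
Qed.

Lemma measurable_cutoff_head : measurable_fun (J : set (measurableTypeR R)) cutoff_head.
Proof.
have m1 : measurable_fun (J : set (measurableTypeR R)) (fun r => step (N * (t - r))).
  by rewrite (E1 (@step R)); apply: measurable_affine; exact: continuous_step.
have m3 : measurable_fun (J : set (measurableTypeR R)) (fun r => derive1 step (N * r - 1)).
  exact: (@measurable_affine (derive1 (@step R)) N (-1) continuous_derive1_step).
have m4 : measurable_fun (J : set (measurableTypeR R)) (fun r => N * (t - r)).
  by rewrite (E1 id); apply: (@measurable_affine id) => x; exact: cvg_id.
by apply: measurable_funM => //; exact: measurable_funM.
Qed.

Variable C : R.
Hypothesis C0 : 0 < C.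
Hypothesis CP : forall x, `|derive1 (@step R) x| <= C.

(** This makes [cutoff_body] bounded uniformly in [n]: the derivative of the step
    in [N (t - r)] is multiplied by [N (t - r)] itself. *)
Lemma mul_derive1_step_le (x : R) : `|x * derive1 step x| <= C.
Proof.
have [x0|x0] := ltP x 0.
  by rewrite derive1_step_out ?mulr0 ?normr0 ?(ltW C0)//; left.
have [x1|x1] := ltP 1 x.
  by rewrite derive1_step_out ?mulr0 ?normr0 ?(ltW C0)//; right.
rewrite normrM ger0_norm// -[leRHS]mul1r.
by apply: ler_pM.
Qed.

Let step_norm_le1 (x : R) : `|step x| <= 1.
Proof. by rewrite ger0_norm ?step_ge0 ?step_le1. Qed.

Lemma cutoff_body_le r : `|cutoff_body r| <= 1 + C.
Proof.
rewrite /cutoff_body; apply: le_trans (ler_normB _ _) _; apply: lerD.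
  by rewrite normrN normrM; apply: mulr_ile1; rewrite ?step_norm_le1.
rewrite normrM -[leRHS]mulr1; apply: ler_pM => //.
exact: mul_derive1_step_le.
Qed.

Lemma cutoff_le r : 0 <= r <= T -> `|cutoff r| <= T.
Proof.
move=> /andP[r0 rT]; have /andP[t0 tT] := t0T.
rewrite /cutoff normrM -[leRHS]mulr1; apply: ler_pM => //.
  by rewrite ler_norml; apply/andP; split; lra.
by rewrite normrM; apply: mulr_ile1; rewrite ?step_norm_le1.
Qed.

Lemma cutoff_head_le r : 0 <= r <= T -> `|cutoff_head r| <= N * T * C.
Proof.
move=> /andP[r0 rT]; have /andP[t0 tT] := t0T.
rewrite /cutoff_head normrM; apply: ler_pM => //.
rewrite normrM -[leRHS]mulr1; apply: ler_pM => //.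
rewrite normrM (gtr0_norm N0) ler_wpM2l ?(ltW N0)//.
by rewrite ler_norml; apply/andP; split; lra.
Qed.

Lemma cutoff_head_out r : 2 / N < r -> cutoff_head r = 0.
Proof.
move=> rN; rewrite /cutoff_head derive1_step_out ?mulr0//; right.
by move: rN; rewrite ltr_pdivrMr// => h; rewrite ltrBrDr mulrC (_ : 1 + 1 = 2).
Qed.

End Cutoff.

Lemma cvg_cutoff t r : 0 < r -> cutoff t n r @[n --> \oo] --> Num.max (t - r) 0.
Proof.
move=> r0; have [tr|rt] := leP t r.
  rewrite max_r ?subr_le0//; apply: cvg_near_cst; near=> n.
  by rewrite /cutoff (@step_le0 _ (_ * (t - r))) ?mul0r ?mulr0// mulr_ge0_le0 ?subr_le0.
rewrite max_l ?subr_ge0 ?(ltW rt)//; apply: cvg_near_cst; near=> n.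
rewrite /cutoff !step_ge1 ?mulr1//.
- have : 2 / r <= n.+1%:R.
    apply: le_trans (_ : n%:R <= _); last by rewrite ler_nat.
    by near: n; exact: nbhs_infty_ger.
  rewrite ler_pdivrMr//; lra.
- have tr0 : 0 < t - r by rewrite subr_gt0.
  rewrite -ler_pdivrMr// mul1r.
  apply: le_trans (_ : n%:R <= _); last by rewrite ler_nat.
  by near: n; exact: nbhs_infty_ger.
Unshelve. all: by end_near. Qed.

Lemma cvg_cutoff_body t r : 0 < r ->
  cutoff_body t n r @[n --> \oo] --> - (\1_(`]-oo, t[%classic) r : R).
Proof.
move=> r0; have [tr|rt] := leP t r.
  rewrite indicE memNset ?oppr0; last by rewrite /= in_itv/= ltNge tr.
  apply: cvg_near_cst; near=> n.
  rewrite /cutoff_body (@step_le0 _ (_ * (t - r))) ?mulr_ge0_le0 ?subr_le0//.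
  rewrite mul0r oppr0 sub0r; move: tr; rewrite le_eqVlt => /predU1P[->|tr].
    by rewrite subrr mulr0 !mul0r oppr0.
  rewrite derive1_step_out ?mulr0 ?mul0r ?oppr0//; left.
  by rewrite pmulr_rlt0 ?ltr0n// subr_lt0.
rewrite indicE mem_set ?mulr1n/=; last by rewrite in_itv.
apply: cvg_near_cst; near=> n.
have tr0 : 0 < t - r by rewrite subr_gt0.
have h1 : 1 < n.+1%:R * (t - r).
  rewrite -ltr_pdivrMr// mul1r.
  apply: lt_le_trans (_ : n%:R <= _); last by rewrite ler_nat.
  by near: n; exact: nbhs_infty_gtr.
rewrite /cutoff_body (@step_ge1 _ (_ * (t - r))) ?(ltW h1)//.
rewrite derive1_step_out; last by right.
rewrite mulr0 mul0r subr0 mul1r step_ge1//.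
have : 2 / r <= n.+1%:R.
  apply: le_trans (_ : n%:R <= _); last by rewrite ler_nat.
  by near: n; exact: nbhs_infty_ger.
rewrite ler_pdivrMr//; lra.
Unshelve. all: by end_near. Qed.

(** A weak antiderivative is determined by its trace at the initial time. Testing
    with the cutoffs, [cutoff_body] converges boundedly to minus the indicator of
    the times before [t], while [cutoff_head] contributes nothing in the limit
    since [e] tends to zero at [0]. *)
Lemma time_primitive (e d : R -> R) (M : R) :
  measurable_fun (J : set (measurableTypeR R)) e ->
  measurable_fun (J : set (measurableTypeR R)) d ->
  (forall r, J r -> `|e r| <= M) -> (forall r, J r -> `|d r| <= M) ->
  (forall theta, test_function `]0, T[%classic theta ->
    \int[mu]_(r in J) (derive1 theta r * e r) = - \int[mu]_(r in J) (theta r * d r)) ->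
  (forall del : R, 0 < del -> exists2 tau : R, 0 < tau &
     forall r, J r -> r < tau -> `|e r| <= del) ->
  forall t, 0 < t < T ->
  \int[mu]_(r in J) (\1_(`]-oo, t[%classic) r * e r) =
  \int[mu]_(r in J) (Num.max (t - r) 0 * d r).
Proof.
move=> me md eM dM ed e0 t t0T.
have Jr r : J r -> 0 < r /\ 0 <= r <= T.
  by move=> /JT; rewrite /= in_itv/= => /andP[r0 rT]; rewrite r0 !ltW.
have fJ := times_lty.
have [C C0 CP] := @derive1_step_bounded R.
have lim_d : \int[mu]_(r in J) (cutoff t n r * d r) @[n --> \oo] -->
    \int[mu]_(r in J) (Num.max (t - r) 0 * d r).
  apply: (@Rintegral_bounded_cvg _ _ _ mu J mJ fJ _ _ (T * M)).
  - by move=> n; apply: measurable_funM => //; exact: measurable_cutoff.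
  - move=> n r Jrr; rewrite normrM; apply: ler_pM => //; last exact: dM.
    by apply: cutoff_le => //; case: (Jr _ Jrr).
  - move=> r /Jr[r0 _]; apply: cvgM; [exact: cvg_cutoff|exact: cvg_cst].
have lim_e : \int[mu]_(r in J) (cutoff_body t n r * e r) @[n --> \oo] -->
    \int[mu]_(r in J) (- \1_(`]-oo, t[%classic) r * e r).
  apply: (@Rintegral_bounded_cvg _ _ _ mu J mJ fJ _ _ ((1 + C) * M)).
  - by move=> n; apply: measurable_funM => //; exact: measurable_cutoff_body.
  - move=> n r Jrr; by rewrite normrM; apply: ler_pM => //; [exact: cutoff_body_le|exact: eM].
  - move=> r /Jr[r0 _]; apply: cvgM; [exact: cvg_cutoff_body|exact: cvg_cst].
(* the head is of order [n] on a set of measure [2 / n], where [e] is small *)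
have lim_h : \int[mu]_(r in J) (cutoff_head t n r * e r) @[n --> \oo] --> 0.
  apply/cvgrPdist_le => eta eta0.
  have del0 : 0 < eta / (2 * T * C) by rewrite divr_gt0// !mulr_gt0.
  have [tau tau0 eP] := e0 _ del0.
  near=> n; rewrite sub0r normrN.
  have N0 : 0 < n.+1%:R :> R by rewrite ltr0n.
  pose Jn := J `&` `]0, 2 / n.+1%:R]%classic.
  have mJn : measurable (Jn : set (measurableTypeR R)).
    by apply: measurableI => //; exact: measurable_itv.
  have muJn : (mu Jn <= (2 / n.+1%:R)%:E)%E.
    apply: (@le_trans _ _ (mu `]0, 2 / n.+1%:R]%classic)).
      by apply: le_measure; rewrite ?inE//; exact: subIsetr.
    by rewrite lebesgue_measure_itv/= lte_fin divr_gt0// sube0.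
  have -> : \int[mu]_(r in J) (cutoff_head t n r * e r) =
      \int[mu]_(r in Jn) (cutoff_head t n r * e r).
    rewrite Rintegral_mkcondr; apply: eq_Rintegral => r; rewrite inE => Jrr.
    rewrite patchE; case: ifPn => // rn; rewrite cutoff_head_out ?mul0r//.
    rewrite ltNge; apply: contra rn => rn; rewrite inE /= in_itv/= rn andbT.
    by case: (Jr _ Jrr).
  have finJn : (mu Jn < +oo)%E by apply: le_lt_trans muJn _; rewrite ltry.
  apply: le_trans (@Rintegral_le_bound _ _ _ mu Jn mJn finJn _ (n.+1%:R * T * C * (eta / (2 * T * C))) _ _) _.
  - apply: (measurable_funS mJ); first exact: subIsetl.
    by apply: measurable_funM => //; exact: measurable_cutoff_head.
  - move=> r [Jrr]; rewrite /= in_itv/= => /andP[r0 rn].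
    rewrite normrM; apply: ler_pM => //; first by apply: cutoff_head_le => //; case: (Jr _ Jrr).
    apply: eP => //; apply: le_lt_trans rn _.
    rewrite ltr_pdivrMr// -ltr_pdivrMl// mulrC.
    apply: lt_le_trans (_ : n%:R <= _); last by rewrite ler_nat.
    by near: n; exact: nbhs_infty_gtr.
  - have : fine (mu Jn) <= 2 / n.+1%:R.
      by rewrite -lee_fin fineK// ge0_fin_numE.
    set m := fine _ => mn.
    have K0 : 0 <= n.+1%:R * T * C * (eta / (2 * T * C)).
      by rewrite !mulr_ge0 ?invr_ge0 ?mulr_ge0// ltW.
    apply: le_trans (ler_wpM2l K0 mn) _.
    rewrite le_eqVlt; apply/orP; left; apply/eqP.
    by field; rewrite !gt_eqF.
have sum_eq n : \int[mu]_(r in J) (cutoff_body t n r * e r) +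
    \int[mu]_(r in J) (cutoff_head t n r * e r) = - \int[mu]_(r in J) (cutoff t n r * d r).
  rewrite -(ed _ (test_function_cutoff n t0T)) -RintegralD//.
  - apply: eq_Rintegral => r _; rewrite (derive1_cutoff t n r); exact/esym/mulrDl.
  - apply: (@bounded_integrable _ _ _ mu J mJ fJ _ ((1 + C) * M)).
      by apply: measurable_funM => //; exact: measurable_cutoff_body.
    by move=> r Jrr; rewrite normrM; apply: ler_pM => //; [exact: cutoff_body_le|exact: eM].
  - apply: (@bounded_integrable _ _ _ mu J mJ fJ _ (n.+1%:R * T * C * M)).
      by apply: measurable_funM => //; exact: measurable_cutoff_head.
    move=> r Jrr; rewrite normrM; apply: ler_pM => //; last exact: eM.
    by apply: cutoff_head_le => //; case: (Jr _ Jrr).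
have L1 := cvgD (FF := eventually_filter) lim_e lim_h.
have L2 : (fun n => \int[mu]_(r in J) (cutoff_body t n r * e r) +
    \int[mu]_(r in J) (cutoff_head t n r * e r)) @ \oo -->
    - \int[mu]_(r in J) (Num.max (t - r) 0 * d r).
  by under eq_fun do rewrite sum_eq; exact: cvgN.
have := cvg_unique (@Rhausdorff R) (F := _ @ \oo) L1 L2; rewrite addr0 => H.
apply: oppr_inj; rewrite -H -[LHS]mulN1r -RintegralZl//.
  by apply: eq_Rintegral => r _; rewrite mulN1r mulNr.
apply: (@bounded_integrable _ _ _ mu J mJ fJ _ M).
  by apply: measurable_funM => //; apply: measurable_indic; exact: measurable_itv.
move=> r Jrr; rewrite normrM -[leRHS]mul1r; apply: ler_pM => //; last exact: eM.
by rewrite indicE; case: (_ \in _); rewrite ?normr1 ?normr0.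
Unshelve. all: by end_near. Qed.

End TimePrimitive.

(** * Time integrals of bounded fields *)

Section StrongIntegral.
Context {R : realType} (Omega : set (pt3 R)) (J : set R).
Hypothesis mO : measurable (Omega : set (borel3 R)).
Hypothesis mJ : measurable (J : set (measurableTypeR R)).
Hypothesis fJ : (leb1 R J < +oo)%E.
Implicit Types (v eta : vf3 R) (k : R -> R).

Local Notation mu := (leb1 R).
Local Notation "<| u , v |>" := (ip Omega u v) (at level 0, format "<| u ,  v |>").
Local Notation nrm := (nnorm (L2 Omega)).
Local Notation mfun f := (measurable_fun (J : set (measurableTypeR R)) f).
Local Notation sfun := (@simple_fun R (vf3 R)).

Lemma sf_eval_L2 (s : sfun) t : sf_wf (L2 Omega) s -> L2 Omega (sf_eval s t).
Proof. by move=> ws; apply: (L2_sum mO) => i; apply: (L2Z mO); case: (ws i). Qed.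

Lemma ip_sf_eval (s : sfun) eta t : sf_wf (L2 Omega) s -> L2 Omega eta ->
  <|sf_eval s t, eta|> = \sum_(i < sf_size s) \1_(sf_dom i) t * <|sf_val i, eta|>.
Proof.
move=> ws Le; rewrite /sf_eval (ip_suml mO)//; last first.
  by move=> i; apply: (L2Z mO); case: (ws i).
by apply: eq_bigr => i _; rewrite (ipZl mO)//; case: (ws i).
Qed.

Lemma measurable_ip_sf_eval (s : sfun) (f : 'I_(sf_size s) -> R -> R) :
  sf_wf (L2 Omega) s -> (forall i, mfun (f i)) ->
  mfun (fun t => \sum_(i < sf_size s) \1_(sf_dom i) t * f i t).
Proof.
move=> ws mf; apply: measurable_sum => i; apply: measurable_funM; last exact: mf.
by apply: measurable_indic; case: (ws i).
Qed.

(** The difference of simple functions, on the disjoint union of their index sets. *)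
Definition sf_sub (s1 s2 : sfun) : sfun :=
  @SimpleFun R (vf3 R) (sf_size s1 + sf_size s2)
    (fun i => match fintype.split i with inl j => sf_dom j | inr j => sf_dom j end)
    (fun i => match fintype.split i with inl j => sf_val j | inr j => - sf_val j end).

Lemma sf_sub_wf s1 s2 : sf_wf (L2 Omega) s1 -> sf_wf (L2 Omega) s2 ->
  sf_wf (L2 Omega) (sf_sub s1 s2).
Proof.
move=> w1 w2 i; rewrite /sf_sub /=; case: (fintype.split i) => j; first exact: w1.
by have [? ?] := w2 j; split => //; exact: L2N.
Qed.

Lemma sf_eval_sub s1 s2 t : sf_eval (sf_sub s1 s2) t = sf_eval s1 t - sf_eval s2 t.
Proof.
rewrite /sf_eval /= big_split_ord/= -sumrN; congr (_ + _); apply: eq_bigr => i _.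
  by rewrite (unsplitK (inl i)).
by rewrite (unsplitK (inr i)) scalerN.
Qed.

(** Strong measurability and boundedness of [u], freed of the almost everywhere:
    both are assumed at every time of [J]. *)
Record strong_limit (s : nat -> sfun) (u : R -> vf3 R) (M : R) : Prop := {
  sl_wf : forall n, sf_wf (L2 Omega) (s n);
  sl_L2 : forall t, J t -> L2 Omega (u t);
  sl_le : forall t, J t -> nrm (u t) <= M;
  sl_cvg : forall t, J t -> nrm (sf_eval (s n) t - u t) @[n --> \oo] --> 0 }.

Lemma strong_limitB s1 s2 u1 u2 M1 M2 : strong_limit s1 u1 M1 -> strong_limit s2 u2 M2 ->
  strong_limit (fun n => sf_sub (s1 n) (s2 n)) (fun t => u1 t - u2 t) (M1 + M2).
Proof.
move=> [w1 L1 b1 c1] [w2 L2' b2 c2]; split.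
- by move=> n; exact: sf_sub_wf.
- by move=> t Jt; apply: (L2B mO); [exact: L1|exact: L2'].
- move=> t Jt; apply: le_trans (nrmB mO (L1 _ Jt) (L2' _ Jt)) _.
  by apply: lerD; [exact: b1|exact: b2].
- move=> t Jt; have := cvgD (FF := eventually_filter) (c1 _ Jt) (c2 _ Jt); rewrite addr0.
  apply: squeeze_cvgr; last exact: cvg_cst.
  near=> n; rewrite nrm_ge0/= sf_eval_sub.
  have -> : sf_eval (s1 n) t - sf_eval (s2 n) t - (u1 t - u2 t) =
      (sf_eval (s1 n) t - u1 t) - (sf_eval (s2 n) t - u2 t).
    by rewrite !opprD !opprK !addrA; congr (_ + _); rewrite -!addrA; congr (_ + _); rewrite addrC.
  by apply: (nrmB mO); apply: (L2B mO); do ?[exact: sf_eval_L2|exact: L1|exact: L2'].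
Unshelve. all: by end_near. Qed.

Variables (s : nat -> sfun) (u : R -> vf3 R) (M : R).
Hypothesis su : strong_limit s u M.

Lemma strong_limit_ip_cvg eta t : J t -> L2 Omega eta ->
  <|sf_eval (s n) t, eta|> @[n --> \oo] --> <|u t, eta|>.
Proof.
move=> Jt Le; have [ws Lu _ /(_ _ Jt) c] := su; have {}Lu := Lu _ Jt.
apply/cvgrPdist_le => e e0.
have e1 : 0 < e / (nrm eta + 1) by rewrite divr_gt0// ltr_wpDl// nrm_ge0.
move/cvgrPdist_le : c => /(_ _ e1); apply: filterS => n.
rewrite sub0r normrN ger0_norm ?nrm_ge0// => h.
have Ls := sf_eval_L2 t (ws n); have Lsu := L2B mO Ls Lu.
rewrite distrC -(ipBl mO)//; apply: le_trans (ip_le mO Lsu Le) _.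
apply: le_trans (ler_wpM2r (nrm_ge0 _ _) h) _.
rewrite mulrAC -mulrA ger_pMr// ler_pdivrMr ?mul1r ?lerDl//.
by rewrite ltr_wpDl// nrm_ge0.
Qed.

Lemma strong_limit_measurable eta : L2 Omega eta -> mfun (fun t => <|u t, eta|>).
Proof.
move=> Le; have [ws _ _ _] := su.
apply: (@measurable_fun_cvg _ _ _ _ (fun n t => <|sf_eval (s n) t, eta|>)).
  move=> n; under eq_fun do rewrite ip_sf_eval//.
  by apply: measurable_ip_sf_eval.
by move=> t Jt; exact: strong_limit_ip_cvg.
Qed.

Lemma strong_limit_ip_le eta t : J t -> L2 Omega eta -> `|<|u t, eta|>| <= M * nrm eta.
Proof.
move=> Jt Le; have [_ Lu uM _] := su.
apply: le_trans (ip_le mO (Lu _ Jt) Le) _.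
by rewrite ler_wpM2r ?nrm_ge0// uM.
Qed.

Lemma strong_limit_ge0 t : J t -> 0 <= M.
Proof. by move=> Jt; apply: le_trans (sl_le su Jt); exact: nrm_ge0. Qed.

(** [<u t, u t>] is the limit of [<sf_eval (s n) t, u t>], a combination of the
    vanishing terms. So countably many fields detect whether [u t] is zero. *)
Lemma strong_limit_eq0 t : J t ->
  (forall n (i : 'I_(sf_size (s n))), <|u t, sf_val i|> = 0) -> <|u t, u t|> = 0.
Proof.
move=> Jt u0; have [ws Lu _ _] := su; have {}Lu := Lu _ Jt.
have c := strong_limit_ip_cvg Jt Lu.
have c0 : <|sf_eval (s n) t, u t|> @[n --> \oo] --> (0 : R).
  apply: cvg_near_cst; near=> n; rewrite ip_sf_eval//.
  by apply: big1 => i _; rewrite ipC u0 mulr0.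
exact: (cvg_unique (@Rhausdorff R) c c0).
Unshelve. all: by end_near. Qed.

(** The approximants are truncated where their norm exceeds [M + 1]; since [u] is
    bounded by [M], the truncation affects finitely many [n] for each time, and
    it provides the domination needed to integrate. *)
Let chi n (t : R) : R := (<|sf_eval (s n) t, sf_eval (s n) t|> <= (M + 1) ^+ 2)%R%:R.

Let chi01 n t : chi n t = 0 \/ chi n t = 1.
Proof. by rewrite /chi; case: (_ <= _); [right|left]. Qed.

Let mchi n : mfun (chi n).
Proof.
have [ws _ _ _] := su.
have mq : mfun (fun t => <|sf_eval (s n) t, sf_eval (s n) t|>).
  have -> : (fun t => <|sf_eval (s n) t, sf_eval (s n) t|>) = (fun t =>
      \sum_(i < sf_size (s n)) \1_(sf_dom i) t *
        \sum_(j < sf_size (s n)) \1_(sf_dom j) t * <|sf_val j, sf_val i|>).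
    apply/funext => t; rewrite ip_sf_eval//; last exact: sf_eval_L2.
    apply: eq_bigr => i _; congr (_ * _); rewrite ipC ip_sf_eval//.
    by case: (ws n i).
  apply: measurable_ip_sf_eval => // i; exact: measurable_ip_sf_eval.
have mb : measurable_fun (J : set (measurableTypeR R))
    (fun t => <|sf_eval (s n) t, sf_eval (s n) t|> <= (M + 1) ^+ 2).
  by apply: measurable_fun_ler => //; exact: measurable_cst.
have -> : chi n = (fun t => if <|sf_eval (s n) t, sf_eval (s n) t|> <= (M + 1) ^+ 2
    then 1 else 0) by apply/funext => t; rewrite /chi; case: (_ <= _).
by apply: measurable_fun_if => //; exact: measurable_cst.
Qed.

Let tr n t : vf3 R := chi n t *: sf_eval (s n) t.

Let tr_L2 n t : L2 Omega (tr n t).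
Proof. by apply: (L2Z mO); apply: sf_eval_L2; case: su. Qed.

Let M1 : R := M + 1 + M.

Let tr_le n t : J t -> nrm (tr n t - u t) <= M1.
Proof.
move=> Jt; have [ws Lu uM _] := su; have {}Lu := Lu _ Jt; have {}uM := uM _ Jt.
have M0 := strong_limit_ge0 Jt.
apply: le_trans (nrmB mO (tr_L2 n t) Lu) _; apply: lerD => //.
have Ls := sf_eval_L2 t (ws n).
rewrite /tr (nrmZ mO)// /chi; case: (lerP (ip _ _ _)) => h /=; last first.
  by rewrite normr0 mul0r addr_ge0.
rewrite normr1 mul1r -(@ler_pXn2r _ 2)// ?nnegrE ?nrm_ge0 ?addr_ge0//.
by rewrite nrm_sqr.
Qed.

Let tr_cvg t : J t -> nrm (tr n t - u t) @[n --> \oo] --> 0.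
Proof.
move=> Jt; have [ws Lu uM c] := su; have {}Lu := Lu _ Jt; have {}uM := uM _ Jt.
have {}c := c _ Jt; have M0 := strong_limit_ge0 Jt.
have c1 : \forall n \near \oo, nrm (sf_eval (s n) t - u t) <= 1.
  move/cvgrPdist_le : c => /(_ _ ltr01); apply: filterS => n.
  by rewrite sub0r normrN ger0_norm// nrm_ge0.
apply: cvg_trans c; apply: near_eq_cvg; near=> n.
rewrite /tr /chi (_ : (_ <= _)%R = true) ?scale1r//.
have Ls := sf_eval_L2 t (ws n).
rewrite -nrm_sqr lerXn2r ?nnegrE ?nrm_ge0 ?addr_ge0//.
have -> : sf_eval (s n) t = (sf_eval (s n) t - u t) + u t by rewrite subrK.
apply: le_trans (nrmD mO (L2B mO Ls Lu) Lu) _; rewrite addrC lerD//.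
by near: n.
Unshelve. all: by end_near. Qed.

Let mtr n eta : L2 Omega eta -> mfun (fun t => <|tr n t, eta|>).
Proof.
move=> Le; have [ws _ _ _] := su.
have -> : (fun t => <|tr n t, eta|>) = (fun t => chi n t *
    \sum_(i < sf_size (s n)) \1_(sf_dom i) t * <|sf_val i, eta|>).
  apply/funext => t; rewrite /tr (ipZl mO) ?ip_sf_eval//.
  exact: sf_eval_L2.
by apply: measurable_funM; [exact: mchi|exact: measurable_ip_sf_eval].
Qed.

Let mdist n : mfun (fun t => nrm (tr n t - u t)).
Proof.
have [ws Lu _ _] := su.
have mu_s m : mfun (fun t => <|u t, sf_eval (s m) t|>).
  have -> : (fun t => <|u t, sf_eval (s m) t|>) = (fun t => <|sf_eval (s m) t, u t|>).
    by apply/funext => t; rewrite ipC.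
  apply: (eq_measurable_fun (fun t => \sum_(i < sf_size (s m)) \1_(sf_dom i) t * <|sf_val i, u t|>)).
    by move=> t; rewrite inE => Jt; rewrite ip_sf_eval//; exact: Lu.
  apply: measurable_ip_sf_eval => // i.
  have -> : (fun t => <|sf_val i, u t|>) = (fun t => <|u t, sf_val i|>).
    by apply/funext => t; rewrite ipC.
  by apply: strong_limit_measurable; case: (ws m i).
have mss m : mfun (fun t => <|sf_eval (s m) t, sf_eval (s m) t|>).
  have -> : (fun t => <|sf_eval (s m) t, sf_eval (s m) t|>) = (fun t =>
      \sum_(i < sf_size (s m)) \1_(sf_dom i) t *
        \sum_(j < sf_size (s m)) \1_(sf_dom j) t * <|sf_val j, sf_val i|>).
    apply/funext => t; rewrite ip_sf_eval//; last exact: sf_eval_L2.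
    apply: eq_bigr => i _; congr (_ * _); rewrite ipC ip_sf_eval//.
    by case: (ws m i).
  by apply: measurable_ip_sf_eval => // i; exact: measurable_ip_sf_eval.
have muu : mfun (fun t => <|u t, u t|>).
  apply: (@measurable_fun_cvg _ _ _ _ (fun m t => <|u t, sf_eval (s m) t|>)) => // t Jt.
  under eq_fun do rewrite ipC.
  by apply: strong_limit_ip_cvg => //; exact: Lu.
have msq : mfun (fun t => chi n t * chi n t * <|sf_eval (s n) t, sf_eval (s n) t|>
    - 2 * (chi n t * <|u t, sf_eval (s n) t|>) + <|u t, u t|>).
  apply: measurable_funD => //; apply: measurable_funB.
    by apply: measurable_funM => //; exact: measurable_funM.
  by apply: measurable_funM => //; exact: measurable_funM.
have -> : (fun t => nrm (tr n t - u t)) = Num.sqrt \o (fun t => <|tr n t - u t, tr n t - u t|>).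
  by [].
apply: (measurableT_comp (continuous_measurable_fun (@sqrt_continuous R))).
apply: eq_measurable_fun msq => t; rewrite inE => Jt.
have {}Lu := Lu _ Jt; have Ls := sf_eval_L2 t (ws n); have Lt := tr_L2 n t.
have Ltu := L2B mO Lt Lu.
rewrite (ipBl mO)// !(ipBr mO)// /tr !(ipZl mO)// !(ipZr mO)//.
rewrite (ipC Omega _ (u t)); ring.
Qed.

Let dst n : R := \int[mu]_(t in J) nrm (tr n t - u t).

Let dst_cvg : dst n @[n --> \oo] --> (0 : R).
Proof.
rewrite /dst; have -> : 0 = \int[mu]_(t in J) (0 : R) by rewrite Rintegral_cst// mul0r.
apply: (@Rintegral_bounded_cvg _ _ _ mu J mJ fJ _ _ M1).
- exact: mdist.
- by move=> n t Jt; rewrite ger0_norm ?nrm_ge0//; exact: tr_le.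
- by move=> t Jt; exact: tr_cvg.
Qed.

Variables (k : R -> R) (K : R).
Hypothesis mk : mfun k.
Hypothesis kK : forall t, J t -> `|k t| <= K.

Let integrable_kip eta : L2 Omega eta -> mu.-integrable J (fun t => (k t * <|u t, eta|>)%:E).
Proof.
move=> Le; apply: (@bounded_integrable _ _ _ mu J mJ fJ _ (K * (M * nrm eta))).
  by apply: measurable_funM => //; exact: strong_limit_measurable.
by move=> t Jt; rewrite normrM; apply: ler_pM => //; [exact: kK|exact: strong_limit_ip_le].
Qed.

Let integrable_dist n : mu.-integrable J (fun t => (nrm (tr n t - u t))%:E).
Proof.
apply: (@bounded_integrable _ _ _ mu J mJ fJ _ M1); first exact: mdist.
by move=> t Jt; rewrite ger0_norm ?nrm_ge0//; exact: tr_le.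
Qed.

(** The integral of [k] times the truncated simple function. *)
Let U n : vf3 R := \sum_(i < sf_size (s n))
  (\int[mu]_(t in J) (k t * chi n t * \1_(sf_dom i) t)) *: sf_val i.

Let U_L2 n : L2 Omega (U n).
Proof. by apply: (L2_sum mO) => i; apply: (L2Z mO); case: su => /(_ n i)[]. Qed.

Let dist_sub_le (x y I c N a b : R) : `|x - I| <= c * N * a -> `|y - I| <= c * N * b ->
  x - y <= c * (a + b) * N.
Proof.
move=> h1 h2; have := ler_norm (x - I); have := ler_norm (- (y - I)); rewrite normrN.
have -> : c * (a + b) * N = c * N * a + c * N * b by ring.
lra.
Qed.

Let ip_U n eta : L2 Omega eta -> <|U n, eta|> = \int[mu]_(t in J) (k t * <|tr n t, eta|>).
Proof.
move=> Le; have [ws _ _ _] := su.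
have icoef i : mu.-integrable J (fun t => (k t * chi n t * \1_(sf_dom (s := s n) i) t)%:E).
  apply: (@bounded_integrable _ _ _ mu J mJ fJ _ K).
    apply: measurable_funM; first exact: measurable_funM.
    by apply: measurable_indic; case: (ws n i).
  move=> t Jt; rewrite -mulrA normrM -[leRHS]mulr1; apply: ler_pM => //; first exact: kK.
  rewrite indicE; case: (chi01 n t) => ->; case: (_ \in _);
    by rewrite ?mul0r ?mulr0 ?mulr1 ?normr0 ?normr1.
rewrite /U (ip_suml mO)//; last by move=> i; apply: (L2Z mO); case: (ws n i).
transitivity (\sum_(i < sf_size (s n))
    \int[mu]_(t in J) (k t * chi n t * \1_(sf_dom i) t * <|sf_val i, eta|>)).
  apply: eq_bigr => i _; rewrite (ipZl mO)//; last by case: (ws n i).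
  by rewrite (RintegralZr _ mJ (icoef i)).
rewrite -Rintegral_sum//; last first.
  move=> i; under eq_fun do rewrite mulrC; exact: integrable_EFinZ.
apply: eq_Rintegral => t _.
rewrite /tr (ipZl mO)//; last exact: sf_eval_L2.
rewrite ip_sf_eval// !mulr_sumr; apply: eq_bigr => i _; ring.
Qed.

Let ip_U_dist n eta : L2 Omega eta ->
  `|<|U n, eta|> - \int[mu]_(t in J) (k t * <|u t, eta|>)| <=
  `|K| * nrm eta * dst n.
Proof.
move=> Le; rewrite ip_U// /dst.
have i1 : mu.-integrable J (fun t => (k t * <|tr n t, eta|>)%:E).
  apply: (@bounded_integrable _ _ _ mu J mJ fJ _ (K * ((M1 + M) * nrm eta))).
    by apply: measurable_funM => //; exact: mtr.
  move=> t Jt; rewrite normrM; apply: ler_pM => //; first exact: kK.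
  apply: le_trans (ip_le mO (tr_L2 n t) Le) _; rewrite ler_wpM2r ?nrm_ge0//.
  have -> : tr n t = (tr n t - u t) + u t by rewrite subrK.
  have Lu := sl_L2 su Jt.
  apply: le_trans (nrmD mO (L2B mO (tr_L2 n t) Lu) Lu) _.
  by apply: lerD; [exact: tr_le|exact: (sl_le su)].
rewrite -(RintegralB mJ i1 (integrable_kip Le)).
have i2 := integrable_EFinB mJ i1 (integrable_kip Le).
apply: le_trans (le_normr_Rintegral mJ i2) _.
rewrite -(RintegralZl _ mJ (integrable_dist n)); apply: le_Rintegral => //.
- exact: (integrable_norm i2).
- exact: (integrable_EFinZ mJ _ (integrable_dist n)).
move=> t Jt; have Lu := sl_L2 su Jt; have Lt := tr_L2 n t.
rewrite -mulrBr -(ipBl mO)// normrM -mulrA; apply: ler_pM => //.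
  by apply: le_trans (kK Jt) _; exact: ler_norm.
rewrite mulrC; apply: ip_le => //; exact: L2B.
Qed.

(** The Bochner integral of [k * u] over [J]. It exists by completeness of [L^2],
    as the limit of the integrals of the truncated approximants; these form a
    Cauchy sequence by duality ([ip_U_dist]). *)
Lemma strong_integral : exists2 V, L2 Omega V &
  forall eta, L2 Omega eta -> <|V, eta|> = \int[mu]_(t in J) (k t * <|u t, eta|>).
Proof.
have K0 : 0 <= `|K| by [].
have d0 n : 0 <= dst n.
  by apply: Rintegral_ge0 => t _; exact: nrm_ge0.
have UU m n : nrm (U m - U n) <=
    `|K| * (dst m + dst n).
  have LU := L2B mO (U_L2 m) (U_L2 n).
  have [->|N0] := eqVneq (nrm (U m - U n)) 0; first by rewrite mulr_ge0// addr_ge0.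
  have Npos : 0 < nrm (U m - U n) by rewrite lt_neqAle eq_sym N0 nrm_ge0.
  rewrite -(ler_pM2r Npos) -expr2 nrm_sqr.
  have h1 := ip_U_dist m LU; have h2 := ip_U_dist n LU.
  rewrite (ipBl mO)//.
  exact: dist_sub_le h1 h2.
have [|V LV UV] := L2_complete mO U_L2.
  move=> e e0; have e1 : 0 < e / (2 * (`|K| + 1)) by rewrite divr_gt0// mulr_gt0// ltr_wpDl.
  move/cvgrPdist_le : dst_cvg => /(_ _ e1)[N _ HN].
  have {}HN m : (N <= m)%N -> dst m <= e / (2 * (`|K| + 1)).
    by move=> /HN /=; rewrite sub0r normrN (ger0_norm (d0 m)).
  exists N => m n /HN hm /HN hn; apply: le_trans (UU m n) _.
  apply: le_trans (ler_wpM2l K0 (lerD hm hn)) _.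
  have -> : `|K| * (e / (2 * (`|K| + 1)) + e / (2 * (`|K| + 1))) = e * (`|K| / (`|K| + 1)).
    by field; rewrite gt_eqF// ltr_wpDl.
  by rewrite ger_pMr// ler_pdivrMr ?ltr_wpDl// mul1r lerDl.
exists V => // eta Le.
have c1 : <|U n, eta|> @[n --> \oo] --> <|V, eta|>.
  apply/cvgrPdist_le => e e0.
  have e1 : 0 < e / (nrm eta + 1) by rewrite divr_gt0// ltr_wpDl// nrm_ge0.
  move/cvgrPdist_le : UV => /(_ _ e1); apply: filterS => n.
  rewrite sub0r normrN ger0_norm ?nrm_ge0// => h.
  have LUV := L2B mO (U_L2 n) LV.
  rewrite distrC -(ipBl mO)//; apply: le_trans (ip_le mO LUV Le) _.
  apply: le_trans (ler_wpM2r (nrm_ge0 _ _) h) _.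
  rewrite mulrAC -mulrA ger_pMr// ler_pdivrMr ?mul1r ?lerDl//.
  by rewrite ltr_wpDl// nrm_ge0.
have c2 : <|U n, eta|> @[n --> \oo] --> \int[mu]_(t in J) (k t * <|u t, eta|>).
  apply/subr_cvg0; apply: norm_cvg0.
  have : `|K| * nrm eta * dst n @[n --> \oo] --> `|K| * nrm eta * 0.
    by apply: cvgM; [exact: cvg_cst|exact: dst_cvg].
  rewrite mulr0; apply: squeeze_cvgr; last exact: cvg_cst.
  by near=> n; rewrite normr_ge0/= ip_U_dist.
exact: (cvg_unique (@Rhausdorff R) c1 c2).
Unshelve. all: by end_near. Qed.

End StrongIntegral.

(** * Duals and Bochner integrals *)

Section DualPairing.
Context {R : realType} {W : lmodType R}.

(** The axioms of a seminormed space that a [nspace] only suggests. *)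
Record seminormed (X : nspace W) : Prop := {
  sn_lin : forall a u v, X u -> X v -> X (a *: u + v);
  sn_0 : X 0;
  sn_normZ : forall a u, X u -> nnorm X (a *: u) = `|a| * nnorm X u;
  sn_ge0 : forall u, X u -> 0 <= nnorm X u }.

Variable X : nspace W.
Hypothesis sX : seminormed X.

Lemma dualZ (l : W -> R) a u : dual X l -> X u -> l (a *: u) = a * l u.
Proof.
move=> [lin _] Xu; have X0 := sn_0 sX.
have l0 : l 0 = 0.
  by have := lin 1 0 0 X0 X0; rewrite scaler0 addr0 mul1r => /eqP; rewrite -subr_eq subrr => /eqP.
by have := lin a u 0 Xu X0; rewrite !addr0 l0 addr0.
Qed.

(** The norm of the dual is a supremum over the unit ball, so that vectors of norm
    zero have to be treated apart; there [l] vanishes because it is bounded. *)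
Lemma dual_le (l : W -> R) u : dual X l -> X u ->
  `|l u| <= nnorm (dual X) l * nnorm X u.
Proof.
move=> dl Xu; have [lin [C lC]] := dl.
pose S := [set `|l v| | v in [set v | X v /\ nnorm X v <= 1]].
have hs : has_ubound S.
  exists (`|C|) => _ [v [Xv v1] <-]; apply: le_trans (lC _ Xv) _.
  apply: le_trans (_ : `|C| * nnorm X v <= _).
    by rewrite ler_wpM2r ?ler_norm ?(sn_ge0 sX).
  by rewrite ler_piMr.
have [u0|u_neq0] := eqVneq (nnorm X u) 0.
  by have := lC _ Xu; rewrite u0 !mulr0.
have u_gt0 : 0 < nnorm X u by rewrite lt_neqAle eq_sym u_neq0 (sn_ge0 sX).
rewrite -ler_pdivrMr//.
have XZ : X ((nnorm X u)^-1 *: u).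
  by have := sn_lin sX (nnorm X u)^-1 Xu (sn_0 sX); rewrite addr0.
apply: (ub_le_sup hs); exists ((nnorm X u)^-1 *: u).
  split; first exact: XZ.
  by rewrite (sn_normZ sX)// gtr0_norm ?invr_gt0// mulVf.
by rewrite dualZ// normrM gtr0_norm ?invr_gt0// mulrC.
Qed.

Lemma dual_lin a (l l' : W -> R) : dual X l -> dual X l' -> dual X (a *: l + l').
Proof.
move=> [lin [C lC]] [lin' [C' lC']]; split.
  move=> b u v Xu Xv; rewrite !fctE !lin// !lin'// /GRing.scale/=; ring.
exists (`|a| * C + C') => u Xu; rewrite !fctE.
apply: le_trans (ler_normD _ _) _; rewrite mulrDl lerD ?lC'//.
by rewrite normrM -mulrA ler_wpM2l ?lC.
Qed.

Lemma dual0 : dual X (0 : W -> R).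
Proof.
split; first by move=> a u v _ _; rewrite mulr0 addr0.
by exists 0 => u _; rewrite normr0 mul0r.
Qed.

Lemma dual_scale a (l : W -> R) : dual X l -> dual X (a *: l).
Proof. by move=> dl; rewrite -[_ *: _]addr0; apply: dual_lin => //; exact: dual0. Qed.

Lemma dual_sub (l l' : W -> R) : dual X l -> dual X l' -> dual X (l - l').
Proof.
by move=> dl dl'; rewrite addrC -scaleN1r; exact: dual_lin.
Qed.

Lemma nnorm_dual_ge0 (l : W -> R) : 0 <= nnorm (dual X) l.
Proof.
rewrite /=; set S := [set _ | _ in _].
have [hS|hS] := pselect (has_sup S); last by rewrite sup_out.
have [[x Sx] uS] := hS; apply: le_trans (ub_le_sup uS Sx).
by case: Sx => v _ <-.
Qed.

End DualPairing.

(** The integral of a nonnegative function that need not be measurable is the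
    supremum of the integrals of the simple functions below it, hence monotone. *)
Lemma ge0_integral_mono {d} {T : measurableType d} {R : realType}
    (mu : {measure set T -> \bar R}) (D1 D2 : set T) (f g : T -> \bar R) :
  D1 `<=` D2 -> (forall x, D1 x -> (0 <= f x)%E) -> (forall x, D2 x -> (0 <= g x)%E) ->
  (forall x, D1 x -> (f x <= g x)%E) ->
  (\int[mu]_(x in D1) f x <= \int[mu]_(x in D2) g x)%E.
Proof.
move=> D12 f0 g0 fg; rewrite !ge0_integralE//; apply: ereal_sup_le.
move=> _ [h hf <-]; exists h => // x.
apply: le_trans (hf x) _; rewrite !patchE; case: ifPn => [|_].
  by rewrite inE => D1x; rewrite mem_set ?fg//; exact: D12.
by case: ifPn => //; rewrite inE; exact: g0.
Qed.

(** Almost everywhere statements are read on one measurable set of times, at all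
    of which they hold. *)
Lemma ae_full_set {R : realType} (T : R) (P : R -> Prop) :
  {ae leb1 R, forall t, `]0, T[%classic t -> P t} ->
  exists J : set R, [/\ measurable (J : set (measurableTypeR R)), J `<=` `]0, T[%classic,
    leb1 R (`]0, T[%classic `\` J) = 0%E & forall t, J t -> P t].
Proof.
move=> [N [mN N0 PN]].
exists (`]0, T[%classic `\` N); split.
- by apply: measurableD => //; exact: measurable_itv.
- by move=> t [].
- rewrite setDD; apply: (subset_measure0 _ mN) => //.
  by apply: measurableI => //; exact: measurable_itv.
- move=> t [It Nt]; apply: contrapT => nP; apply: Nt; apply: PN => /=.
  by move=> h; exact: nP (h It).
Qed.

Section BochnerApply.
Context {R : realType} {W : lmodType R} (X : nspace W) (T : R) (J : set R).
Hypothesis sX : seminormed X.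
Hypothesis mJ : measurable (J : set (measurableTypeR R)).
Hypothesis JT : J `<=` `]0, T[.
Hypothesis fullJ : leb1 R (`]0, T[%classic `\` J) = 0%E.
Implicit Types (psi : W) (s : @simple_fun R (W -> R)).

Local Notation mu := (leb1 R).
Local Notation I := (`]0, T[%classic : set R).
Local Notation mfun f := (measurable_fun (J : set (measurableTypeR R)) f).

Let mI : measurable (I : set (measurableTypeR R)). Proof. exact: measurable_itv. Qed.
Let fJ : (mu J < +oo)%E. Proof. exact: times_lty JT. Qed.

Lemma sf_eval_apply s t psi :
  sf_eval s t psi = \sum_(i < sf_size s) \1_(sf_dom i) t * sf_val i psi.
Proof. by rewrite /sf_eval fct_sumE. Qed.

Lemma sf_wf_dual s t : sf_wf (dual X) s -> dual X (sf_eval s t).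
Proof.
move=> ws; apply: (big_ind (fun l => dual X l)).
- exact: dual0.
- by move=> l l' dl dl'; rewrite -[l]scale1r; exact: dual_lin.
- by move=> i _; apply: dual_scale; case: (ws i).
Qed.

Lemma measurable_sf_eval_apply s psi : sf_wf (dual X) s -> mfun (fun t => sf_eval s t psi).
Proof.
move=> ws; under eq_fun do rewrite sf_eval_apply.
apply: measurable_sum => i; apply: measurable_funM => //.
by apply: measurable_indic; case: (ws i).
Qed.

Let integrable_term s psi i : sf_wf (dual X) s ->
  mu.-integrable J (fun t => (\1_(sf_dom (s := s) i) t * sf_val i psi)%:E).
Proof.
move=> ws; apply: (@bounded_integrable _ _ _ mu J mJ fJ _ `|sf_val (s := s) i psi|).
  by apply: measurable_funM => //; apply: measurable_indic; case: (ws i).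
move=> t _; rewrite normrM -[leRHS]mul1r ler_wpM2r// indicE.
by case: (_ \in _); rewrite ?normr0 ?normr1.
Qed.

Lemma integrable_sf_eval_apply s psi : sf_wf (dual X) s ->
  mu.-integrable J (fun t => (sf_eval s t psi)%:E).
Proof.
move=> ws; under eq_fun do rewrite sf_eval_apply -sumEFin.
by apply: integrable_sum => // i _; exact: integrable_term.
Qed.

Let mu_full (A : set R) : measurable (A : set (measurableTypeR R)) -> mu (A `&` I) = mu (A `&` J).
Proof.
move=> mA.
have -> : A `&` I = (A `&` J) `|` (A `&` (I `\` J)).
  rewrite -setIUr setDE setUIr setUv setIT; congr (_ `&` _).
  by rewrite setUC; apply/esym/setUidPl.
have mIJ : measurable (I `\` J : set (measurableTypeR R)) by exact: measurableD.
have mAIJ := measurableI _ _ mA mIJ.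
apply: measureU0 => //; first exact: measurableI.
by apply: (subset_measure0 mAIJ mIJ) => // x [].
Qed.

Lemma sf_integral_apply s psi : sf_wf (dual X) s ->
  sf_integral T s psi = \int[mu]_(t in J) sf_eval s t psi.
Proof.
move=> ws; under eq_Rintegral do rewrite sf_eval_apply.
rewrite Rintegral_sum//; last by move=> i; exact: integrable_term.
rewrite /sf_integral fct_sumE; apply: eq_bigr => i _.
have mi : measurable (sf_dom i : set (measurableTypeR R)) by case: (ws i).
have i1 : mu.-integrable J (fun t => (\1_(sf_dom i) t)%:E).
  apply: (@bounded_integrable _ _ _ mu J mJ fJ _ 1); first exact: measurable_indic.
  by move=> t _; rewrite indicE; case: (_ \in _); rewrite ?normr0 ?normr1.
rewrite (RintegralZr _ mJ i1) /Rintegral integral_indic// mu_full//.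
Qed.

Lemma strongly_measurable_apply (s : nat -> simple_fun) (u : R -> W -> R) psi :
  (forall n, sf_wf (dual X) (s n)) -> X psi ->
  (forall t, J t -> dual X (u t) /\
    nnorm (dual X) (sf_eval (s n) t - u t) @[n --> \oo] --> 0) ->
  mfun (fun t => u t psi).
Proof.
move=> ws Xpsi su.
apply: (@measurable_fun_cvg _ _ _ _ (fun n t => sf_eval (s n) t psi)).
  by move=> n; exact: measurable_sf_eval_apply.
move=> t Jt; have [du c] := su _ Jt.
apply/subr_cvg0; apply: norm_cvg0.
have : nnorm (dual X) (sf_eval (s n) t - u t) * nnorm X psi @[n --> \oo] --> 0 * nnorm X psi.
  by apply: cvgM => //; exact: cvg_cst.
rewrite mul0r; apply: squeeze_cvgr; last exact: cvg_cst.
near=> n; rewrite normr_ge0/=.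
by apply: (dual_le sX _ Xpsi); apply: dual_sub => //; exact: sf_wf_dual.
Unshelve. all: by end_near. Qed.

(** Evaluation at [psi] is bounded by the dual norm times [nnorm X psi], so it
    passes to the limit in the integrals of simple functions. As the dual norm
    along [v] need not be measurable, the error is compared with it through
    [ge0_integral_mono]. *)
Lemma bochner_apply (v : R -> W -> R) (w : W -> R) psi : X psi ->
  (forall t, J t -> dual X (v t)) -> mfun (fun t => v t psi) ->
  bochner_integral (dual X) T v w ->
  mu.-integrable J (fun t => (v t psi)%:E) /\
  w psi = \int[mu]_(t in J) v t psi.
Proof.
move=> Xpsi dv mv [s [[ws _] c0 dw cw]].
(* [N] replaces [nnorm X psi], which may vanish, as a divisor *)
pose N := nnorm X psi + 1.
have psi0 : 0 <= nnorm X psi by exact: sn_ge0.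
have N0 : 0 < N by rewrite ltr_wpDl.
pose df n t := sf_eval (s n) t psi - v t psi.
have mdf n : mfun (df n).
  by apply: measurable_funB => //; exact: measurable_sf_eval_apply.
pose L n := (\int[mu]_(t in J) (`|df n t| / N)%:E)%E.
have L0 n : (0 <= L n)%E.
  by apply: integral_ge0 => t _; rewrite lee_fin divr_ge0// ltW.
have Lc : L n @[n --> \oo] --> 0%E.
  apply: (squeeze_cvge _ (cvg_cst _) c0); near=> n; rewrite L0/=.
  apply: ge0_integral_mono => //.
  - by move=> t _; rewrite lee_fin divr_ge0// ltW.
  - by move=> t _; rewrite lee_fin nnorm_dual_ge0.
  move=> t Jt; rewrite lee_fin ler_pdivrMr//.
  have ds : dual X (sf_eval (s n) t - v t).
    by apply: dual_sub; [exact: sf_wf_dual|exact: dv].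
  apply: le_trans (dual_le sX ds Xpsi) _.
  by rewrite ler_wpM2l ?nnorm_dual_ge0// /N lerDl.
have [finL Lfc] : (\forall n \near \oo, L n \is a fin_num) /\ fine (L n) @[n --> \oo] --> 0.
  by move/fine_cvgP : Lc.
have idf : \forall n \near \oo, mu.-integrable J (fun t => (df n t)%:E).
  apply: filterS finL => n fin.
  have iN : mu.-integrable J (fun t => (`|df n t| / N)%:E).
    apply/integrableP; split.
      by apply/measurable_EFinP; apply: measurable_funM => //; exact: measurableT_comp.
    move: fin; rewrite ge0_fin_numE// => fin; apply: le_lt_trans fin.
    apply: ge0_le_integral => //.
    - by apply/measurable_EFinP; apply: measurableT_comp => //; apply: measurable_funM => //; exact: measurableT_comp.
    - by apply/measurable_EFinP; apply: measurable_funM => //; exact: measurableT_comp.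
    - by move=> t _; rewrite abse_EFin ger0_norm// divr_ge0// ltW.
  apply: (le_integrable mJ _ _ (integrable_EFinZ mJ N iN)); first exact/measurable_EFinP.
  move=> t _; rewrite !abse_EFin lee_fin /=.
  by rewrite [N * _]mulrC divfK ?gt_eqF// normr_id.
have iv : mu.-integrable J (fun t => (v t psi)%:E).
  have [n _ /(_ n (leqnn n)) idn] := idf.
  have := integrable_EFinB mJ (integrable_sf_eval_apply psi (ws n)) idn.
  by apply: eq_integrable => // t _; rewrite /df; congr EFin; ring.
split => //.
have c1 : sf_integral T (s n) psi @[n --> \oo] --> w psi.
  apply/subr_cvg0; apply: norm_cvg0.
  have : nnorm (dual X) (sf_integral T (s n) - w) * nnorm X psi @[n --> \oo] --> 0 * nnorm X psi.
    by apply: cvgM => //; exact: cvg_cst.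
  rewrite mul0r; apply: squeeze_cvgr; last exact: cvg_cst.
  near=> n; rewrite normr_ge0/=.
  apply: (dual_le sX _ Xpsi); apply: dual_sub => //.
  apply: (big_ind (fun l => dual X l)).
  - exact: dual0.
  - by move=> l l' dl dl'; rewrite -[l]scale1r; exact: dual_lin.
  - by move=> i _; apply: dual_scale; case: (ws n i).
have c2 : sf_integral T (s n) psi @[n --> \oo] --> \int[mu]_(t in J) v t psi.
  apply/subr_cvg0; apply: norm_cvg0.
  have : N * fine (L n) @[n --> \oo] --> N * 0 by apply: cvgM => //; exact: cvg_cst.
  rewrite mulr0; apply: squeeze_cvgr; last exact: cvg_cst.
  near=> n; rewrite normr_ge0/= sf_integral_apply//.
  have idn : mu.-integrable J (fun t => (df n t)%:E) by near: n.
  rewrite -(RintegralB mJ (integrable_sf_eval_apply psi (ws n)) iv).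
  apply: le_trans (le_normr_Rintegral mJ idn) _.
  rewrite -[X in _ <= X * _]invrK ler_pdivlMl ?invr_gt0// mulrC.
  by rewrite -(RintegralZr _ mJ (integrable_norm idn)).
exact: (cvg_unique (@Rhausdorff R) c1 c2).
Unshelve. all: by end_near. Qed.

End BochnerApply.
#[global] Instance leb1_ae_filter (R : realType) :
  Filter (nbhs (almost_everywhere (leb1 R))) := ae_filter_ringOfSetsType (leb1 R).

Section Embedding.
Context {R : realType} (Omega : set (pt3 R)).
Hypothesis oO : open Omega.
Let mO : measurable (Omega : set (borel3 R)) := open_measurable3 oO.

Lemma seminormed_Hcurl : seminormed (Hcurl Omega).
Proof.
split.
- by move=> a u v; exact: Hcurl_lin.
- exact: Hcurl0.
- by move=> a u; exact: nnorm_HcurlZ.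
- by move=> u _; exact: sqrtr_ge0.
Qed.

Lemma seminormed_H0curl : seminormed (H0curl Omega).
Proof.
split.
- by move=> a u v; exact: H0curl_lin.
- exact: H0curl0.
- by move=> a u /H0curl_Hcurl; exact: nnorm_HcurlZ.
- by move=> u _; exact: sqrtr_ge0.
Qed.

Lemma emb_dual (X : nspace (vf3 R)) w : (forall u, X u -> L2 Omega u) ->
  (forall u, X u -> nnorm (L2 Omega) u <= nnorm X u) ->
  L2 Omega w -> dual X (emb Omega w).
Proof.
move=> XL XN Lw; split.
  move=> a u v /XL Lu /XL Lv.
  by rewrite /emb (ipDr mO)//; [rewrite (ipZr mO)|exact: (L2Z mO)].
exists (nnorm (L2 Omega) w) => u Xu; apply: le_trans (ip_le mO Lw (XL _ Xu)) _.
by rewrite ler_wpM2l ?nrm_ge0// XN.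
Qed.

Lemma nrm_le_Hcurl u : nnorm (L2 Omega) u <= nnorm (Hcurl Omega) u.
Proof. by rewrite /= ler_wsqrtr// lerDl ip_ge0. Qed.

Lemma emb_dual_Hcurl w : L2 Omega w -> dual (Hcurl Omega) (emb Omega w).
Proof. by apply: emb_dual => [u /Hcurl_L2//|u _]; exact: nrm_le_Hcurl. Qed.

Lemma emb_dual_H0curl w : L2 Omega w -> dual (H0curl Omega) (emb Omega w).
Proof. by apply: emb_dual => [u /H0curl_Hcurl/Hcurl_L2//|u _]; exact: nrm_le_Hcurl. Qed.

End Embedding.

(** Tested with a fixed [psi], the function itself attains the initial value of its
    continuous representative, along the times where the two agree. *)
Lemma initial_value_apply {R : realType} {W : lmodType R} (X : nspace W) (T : R)
    (u : R -> W -> R) (w0 : W -> R) : 0 < T -> seminormed X ->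
  {ae leb1 R, forall t, `]0, T[%classic t -> dual X (u t)} ->
  initial_value (dual X) T u w0 ->
  exists J : set R, {ae leb1 R, forall t, `]0, T[%classic t -> J t} /\
    forall psi, X psi -> forall del : R, 0 < del -> exists2 tau : R, 0 < tau &
      forall r, `]0, T[%classic r -> J r -> r < tau -> `|u r psi - w0 psi| <= del.
Proof.
move=> T0 sX du [g [dg gc gu dw0 g0]].
(* on these times [g t] and [u t] agree on [X] *)
exists (fun t => dual X (u t) /\ nnorm (dual X) (g t - u t) = 0); split.
  by move: du gu; apply: filterS2 => t h1 h2 It; split; [exact: h1|exact: h2].
move=> psi Xpsi del del0.
have psi0 : 0 <= nnorm X psi by exact: sn_ge0.
have I0 : `[0, T]%classic (0 : R) by rewrite /= in_itv/= lexx ltW.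
have e0 : 0 < del / (nnorm X psi + 1) by rewrite divr_gt0// ltr_wpDl.
have /cvgrPdist_le/(_ _ e0) := gc _ I0.
rewrite near_withinE => -[tau /= tau0 gtau].
exists tau => // r Ir [dur gur] rtau.
have r0 : 0 < r by move: Ir; rewrite /= in_itv/= => /andP[].
have Ir' : `[0, T]%classic r.
  by move: Ir; rewrite /= !in_itv/= => /andP[? ?]; rewrite !ltW.
have := gtau r; rewrite /ball/= sub0r normrN gtr0_norm// => /(_ rtau Ir').
rewrite sub0r normrN ger0_norm ?nnorm_dual_ge0// => gr.
have dgr := dg _ Ir'; have dg0 := dg _ I0.
have h1 := dual_le sX (dual_sub dgr dur) Xpsi.
have h2 := dual_le sX (dual_sub dgr dg0) Xpsi.
have h3 := dual_le sX (dual_sub dg0 dw0) Xpsi.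
rewrite (gur : nnorm (dual X) (g r - u r) = 0) mul0r in h1; rewrite g0 mul0r in h3.
have {}h2 : `|(g r - g 0) psi| <= del.
  apply: le_trans h2 _; apply: le_trans (ler_wpM2r psi0 gr) _.
  by rewrite mulrAC -mulrA ger_pMr// ler_pdivrMr ?mul1r ?lerDl// ltr_wpDl.
move: h1 h2 h3; rewrite !fctE !normr_le0 !subr_eq0 => /eqP h1 h2 /eqP h3.
by rewrite -h1 -h3.
Qed.

(** By the Lebesgue differentiation theorem [h], extended by zero, is at almost
    every time the derivative of its primitive, which vanishes on ]0, T[. *)
Lemma ae_eq0_of_primitive {R : realType} (T : R) (J : set R) (h : R -> R) (K : R) :
  measurable (J : set (measurableTypeR R)) -> J `<=` `]0, T[%classic ->
  measurable_fun (J : set (measurableTypeR R)) h -> (forall t, J t -> `|h t| <= K) ->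
  (forall t, 0 < t < T -> \int[leb1 R]_(r in J) (\1_(`]-oo, t[%classic) r * h r) = 0) ->
  {ae leb1 R, forall t, J t -> h t = 0}.
Proof.
move=> mJ JT mh hK h0.
have fJ := times_lty mJ JT.
have ih : (leb1 R).-integrable J (EFin \o h) by exact: (bounded_integrable mJ fJ mh hK).
pose H := h \_ J.
have iH : (leb1 R).-integrable setT (EFin \o H).
  by rewrite -(restrict_EFin h J); apply/(integrable_mkcond _ mJ).
have lH : locally_integrable [set: R] H.
  by apply: integrable_locally => //; exact: openT.
have mitv (i : interval R) : measurable ([set` i] : set (measurableTypeR R)).
  exact: measurable_itv.
have F0 t : 0 < t < T -> \int[leb1 R]_(r in `]-oo, t]) H r = 0.
  move=> t0; rewrite -(h0 _ t0).
  transitivity (\int[leb1 R]_(r in J) (\1_(`]-oo, t]%classic) r * h r)).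
    rewrite [LHS]Rintegral_mkcond [RHS]Rintegral_mkcond; apply: eq_Rintegral => r _.
    rewrite /H !patchE indicE; case: (r \in [set` _]); case: (r \in J) => //=;
      by rewrite ?mul1r ?mul0r.
  have mind (i : interval R) : measurable_fun (J : set (measurableTypeR R)) (fun r => \1_([set` i]) r * h r).
    by apply: measurable_funM => //; apply: measurable_indic.
  apply: (eq_ae_Rintegral mJ) => //.
  exists [set t]; split; [exact: measurable_set1|exact: lebesgue_measure_set1|].
  move=> r /= nr; apply: contrapT => rt; apply: nr => _; rewrite !indicE; congr (_%:R * _).
  rewrite !mem_setE !in_itv/= le_eqVlt; case: eqP => // ?; exact: rt.
have := lebesgue_differentiation lH.
apply: filterS => t pt Jt.
have t0T : 0 < t < T by move: (JT _ Jt); rewrite /= in_itv.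
have iT : (leb1 R).-integrable [set` Interval -oo%O (BRight T)] (EFin \o H).
  exact: (integrableS measurableT).
have /andP[_ tT] := t0T.
have /(_ (ltNyr _))[_ dF] := FTC1_lebesgue_pt tT iT _ pt.
move: dF; rewrite /H patchE mem_set// => <-; rewrite derive1E.
rewrite (@near_eq_derive _ _ _ _ (cst 0))//; first by rewrite derive_cst.
have : \forall s \near t, s \in `]0, T[ by exact: near_in_itvoo.
by apply: filterS => s; rewrite in_itv/= => s0; rewrite F0.
Qed.

(** Subdividing [0, t] into [n] intervals bounds [y t] by [C t^2 / n]. This takes
    the place of differentiating [y]. *)
Lemma square_increments_le {R : realType} (T C : R) (y : R -> R) : y 0 <= 0 ->
  (forall s t, 0 <= s -> s <= t -> t < T -> y t - y s <= C * (t - s) ^+ 2) ->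
  forall t, 0 <= t < T -> y t <= 0.
Proof.
move=> y0 yC t /andP[t0 tT].
have step n k : (k <= n.+1)%N -> y (k%:R * (t / n.+1%:R)) <= k%:R * (C * (t / n.+1%:R) ^+ 2).
  elim: k => [_|k IH kn]; first by rewrite !mul0r.
  have h0 : 0 <= t / n.+1%:R by rewrite divr_ge0.
  have := yC (k%:R * (t / n.+1%:R)) (k.+1%:R * (t / n.+1%:R)).
  rewrite mulr_ge0// ler_wpM2r ?ler_nat// => /(_ isT isT).
  have -> : k.+1%:R * (t / n.+1%:R) < T.
    apply: le_lt_trans tT; rewrite mulrCA -[leRHS]mulr1 ler_wpM2l//.
    by rewrite ler_pdivrMr ?mul1r ?ler_nat.
  move=> /(_ isT); rewrite -mulrBl -[k.+1]addn1 natrD addrAC subrr add0r mul1r => h.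
  have := IH (ltnW kn); move: h; set a := y _; set b := y _; set c := C * _ => h1 h2.
  rewrite mulrDl mul1r; lra.
have {}step n : y t <= C * t ^+ 2 / n.+1%:R.
  have := step n n.+1 (leqnn _).
  have n0 : n.+1%:R != 0 :> R by rewrite pnatr_eq0.
  have -> : n.+1%:R * (t / n.+1%:R) = t by field.
  by have -> : n.+1%:R * (C * (t / n.+1%:R) ^+ 2) = C * t ^+ 2 / n.+1%:R by field.
have c0 : C * t ^+ 2 / n.+1%:R @[n --> \oo] --> C * t ^+ 2 * 0.
  by apply: cvgM; [exact: cvg_cst|exact: cvg_harmonic].
rewrite mulr0 in c0.
by apply: (cvgr_to_ge c0); near=> n; exact: step.
Unshelve. all: by end_near. Qed.

(** * Primitives of a bounded field *)

Section Primitives.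
Context {R : realType} (Omega : set (pt3 R)) (T : R) (J : set R).
Hypothesis mO : measurable (Omega : set (borel3 R)).
Hypothesis T0 : 0 < T.
Hypothesis mJ : measurable (J : set (measurableTypeR R)).
Hypothesis JT : J `<=` `]0, T[.
Variables (sn : nat -> @simple_fun R (vf3 R)) (u : R -> vf3 R) (M : R).
Hypothesis su : strong_limit Omega J sn u M.
Hypothesis M0 : 0 <= M.

Local Notation mu := (leb1 R).
Local Notation "<| u , v |>" := (ip Omega u v) (at level 0, format "<| u ,  v |>").
Local Notation nrm := (nnorm (L2 Omega)).
Local Notation mfun f := (measurable_fun (J : set (measurableTypeR R)) f).

Let fJ : (mu J < +oo)%E. Proof. exact: times_lty JT. Qed.

(** Take [eta = V]. *)
Lemma nrm_le_dual V (c : R) : L2 Omega V -> 0 <= c ->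
  (forall eta, L2 Omega eta -> `|<|V, eta|>| <= c * nrm eta) -> nrm V <= c.
Proof.
move=> LV c0 /(_ _ LV); have n0 := nrm_ge0 Omega V.
rewrite -nrm_sqr ger0_norm ?sqr_ge0// expr2.
have [->//|nV] := eqVneq (nrm V) 0.
by rewrite ler_pM2r// lt_neqAle eq_sym nV.
Qed.

(** The kernel of the second primitive. *)
Definition ramp (t r : R) : R := Num.max (t - r) 0.

Lemma ramp_ge0 t r : 0 <= ramp t r. Proof. by rewrite /ramp le_max lexx orbT. Qed.

Lemma measurable_ramp t : mfun (ramp t).
Proof.
apply: measurable_maxr => //; apply: measurable_funB => //.
Qed.

Lemma measurable_before (t : R) : mfun (fun r => \1_(`]-oo, t[%classic) r : R).
Proof. by apply: measurable_indic; exact: measurable_itv. Qed.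

Lemma ramp_le t r : t <= T -> J r -> `|ramp t r| <= T.
Proof.
move=> tT /JT; rewrite /= in_itv/= => /andP[r0 _].
by rewrite ger0_norm ?ramp_ge0// /ramp ge_max (ltW T0) andbT; lra.
Qed.

Lemma before_le (t r : R) : `|\1_(`]-oo, t[%classic) r : R| <= 1.
Proof. by rewrite indicE; case: (_ \in _); rewrite ?normr0 ?normr1. Qed.

Lemma integrable_kernel (k : R -> R) (K : R) eta : mfun k ->
  (forall r, J r -> `|k r| <= K) -> L2 Omega eta ->
  mu.-integrable J (fun r => (k r * <|u r, eta|>)%:E).
Proof.
move=> mk kK Le; apply: (bounded_integrable (K := K * (M * nrm eta)) mJ fJ).
  by apply: measurable_funM => //; exact: (strong_limit_measurable mO su).
move=> r Jr; rewrite normrM; apply: ler_pM => //; first exact: kK.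
exact: (strong_limit_ip_le mO su).
Qed.

Lemma integrable_ramp t eta : t <= T -> L2 Omega eta ->
  mu.-integrable J (fun r => (ramp t r * <|u r, eta|>)%:E).
Proof.
move=> tT; apply: (integrable_kernel (measurable_ramp t) (K := T)) => r.
exact: ramp_le.
Qed.

(** The factor [t - s] comes from the support of the kernel; for kernels of size
    [t - s] this gives a bound of second order. *)
Lemma kernel_le (k : R -> R) (K s t : R) eta : mfun k -> 0 <= K -> s <= t ->
  (forall r, J r -> `|k r| <= K) -> (forall r, J r -> r \notin `[s, t] -> k r = 0) ->
  L2 Omega eta ->
  `|\int[mu]_(r in J) (k r * <|u r, eta|>)| <= K * (t - s) * M * nrm eta.
Proof.
move=> mk K0 st kK k0 Le.
pose J' := J `&` `[s, t]%classic.
have mJ' : measurable (J' : set (measurableTypeR R)).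
  by apply: measurableI => //; exact: measurable_itv.
have muJ' : (mu J' <= (t - s)%:E)%E.
  apply: (@le_trans _ _ (mu `[s, t]%classic)).
    by apply: le_measure; rewrite ?inE//; exact: subIsetr.
  by rewrite lebesgue_measure_itv/=; case: ifPn => // _; rewrite lee_fin subr_ge0.
have fJ' : (mu J' < +oo)%E by apply: le_lt_trans muJ' _; rewrite ltry.
have -> : \int[mu]_(r in J) (k r * <|u r, eta|>) = \int[mu]_(r in J') (k r * <|u r, eta|>).
  rewrite [RHS]Rintegral_mkcondr; apply: eq_Rintegral => r; rewrite inE => Jr.
  rewrite patchE; case: ifPn => //; rewrite notin_setE /= => /negP nr.
  by rewrite k0// mul0r.
have B0 : 0 <= K * (M * nrm eta) by rewrite !mulr_ge0// nrm_ge0.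
apply: le_trans (Rintegral_le_bound (K := K * (M * nrm eta)) mJ' fJ' _ _) _.
- apply: (measurable_funS mJ); first exact: subIsetl.
  by apply: measurable_funM => //; exact: (strong_limit_measurable mO su).
- move=> r [Jr _]; rewrite normrM; apply: ler_pM => //; first exact: kK.
  exact: (strong_limit_ip_le mO su).
- have mf : fine (mu J') <= t - s by rewrite -lee_fin fineK// ge0_fin_numE.
  apply: le_trans (ler_wpM2l B0 mf) _; rewrite le_eqVlt; apply/orP; left; apply/eqP; ring.
Qed.

(** First and second primitives of [u], vanishing at time [0]. In the last clause,
    the kernel of the Taylor remainder is at most [t - s] and supported in
    [s, t]. *)
Lemma primitives : exists P PP : R -> vf3 R, forall t, 0 <= t <= T ->
  [/\ L2 Omega (P t), L2 Omega (PP t),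
    (forall eta, L2 Omega eta ->
      <|P t, eta|> = \int[mu]_(r in J) (\1_(`]-oo, t[%classic) r * <|u r, eta|>) /\
      <|PP t, eta|> = \int[mu]_(r in J) (ramp t r * <|u r, eta|>)),
    nrm (P t) <= T * M /\ nrm (PP t) <= T * T * M &
    forall s, 0 <= s <= t -> nrm (PP t - PP s - (t - s) *: P s) <= (t - s) ^+ 2 * M].
Proof.
have /choice[P PP1] : forall t, exists V, L2 Omega V /\ forall eta, L2 Omega eta ->
    <|V, eta|> = \int[mu]_(r in J) (\1_(`]-oo, t[%classic) r * <|u r, eta|>).
  move=> t; have [|V LV VP] := strong_integral mO mJ fJ su (measurable_before t) (K := 1).
    by move=> r _; exact: before_le.
  by exists V.
have /choice[PP PP2] : forall t, exists V, t <= T -> L2 Omega V /\ forall eta, L2 Omega eta ->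
    <|V, eta|> = \int[mu]_(r in J) (ramp t r * <|u r, eta|>).
  move=> t; have [tT|Tt] := leP t T; last by exists 0.
  have [|V LV VP] := strong_integral mO mJ fJ su (measurable_ramp t) (K := T).
    by move=> r; exact: ramp_le.
  by exists V.
have Jitv r : J r -> r \notin `[0, T] -> False.
  by move=> /JT; rewrite /= !in_itv/= => /andP[r0 rT]; rewrite !ltW.
exists P, PP => t /andP[t0 tT].
have [LP Pt] := PP1 t; have [LPP PPt] := PP2 _ tT.
split => //; first by move=> eta Le; split; [exact: Pt|exact: PPt].
  split.
    apply: nrm_le_dual => //; first by rewrite mulr_ge0// ltW.
    move=> eta Le; rewrite Pt//.
    have := @kernel_le _ 1 0 T eta (measurable_before t); rewrite subr0 mul1r; apply => //.
    - exact: ltW.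
    - by move=> r _; exact: before_le.
    - by move=> r Jr /(Jitv _ Jr).
  apply: nrm_le_dual => //; first by rewrite !mulr_ge0// ltW.
  move=> eta Le; rewrite PPt//.
  have := @kernel_le _ T 0 T eta (measurable_ramp t); rewrite subr0; apply => //.
  - exact: ltW.
  - exact: ltW.
  - by move=> r; exact: ramp_le.
  - by move=> r Jr /(Jitv _ Jr).
move=> s /andP[s0 st]; have sT := le_trans st tT.
have [LPs Ps] := PP1 s; have [LPPs PPs] := PP2 _ sT.
have LD := L2B mO LPP LPPs; have LZ := L2Z mO (t - s) LPs.
apply: nrm_le_dual; first exact: L2B.
  by rewrite mulr_ge0// sqr_ge0.
move=> eta Le; rewrite (ipBl mO)// (ipBl mO)// (ipZl mO)// PPt// PPs// Ps//.
have i1 := integrable_ramp tT Le.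
have i2 := integrable_ramp sT Le.
have i3 := integrable_kernel (K := 1) (measurable_before s) (fun r _ => before_le s r) Le.
have i12 := integrable_EFinB mJ i1 i2; have i3' := integrable_EFinZ mJ (t - s) i3.
rewrite -(RintegralB mJ i1 i2) -(RintegralZl _ mJ i3) -(RintegralB mJ i12 i3').
pose k r := ramp t r - ramp s r - (t - s) * \1_(`]-oo, s[%classic) r.
have -> : \int[mu]_(r in J) (ramp t r * <|u r, eta|> - ramp s r * <|u r, eta|> -
    (t - s) * (\1_(`]-oo, s[%classic) r * <|u r, eta|>)) =
    \int[mu]_(r in J) (k r * <|u r, eta|>).
  by apply: eq_Rintegral => r _; rewrite /k; ring.
have mk : mfun k.
  apply: measurable_funB; first by apply: measurable_funB; exact: measurable_ramp.
  by apply: measurable_funM => //; exact: measurable_before.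
have kE r : k r = if r < s then 0 else ramp t r.
  rewrite /k indicE mem_setE in_itv/= /ramp; case: ltP => rs.
    rewrite !max_l ?subr_ge0 ?(ltW rs)//; first by rewrite mulr1; ring.
    by rewrite (le_trans (ltW rs)).
  by rewrite [Num.max (s - r) 0]max_r ?subr_le0// mulr0 !subr0.
rewrite expr2; apply: kernel_le => //.
- by rewrite subr_ge0.
- move=> r _; rewrite kE; case: ltP => rs; first by rewrite normr0 subr_ge0.
  by rewrite ger0_norm ?ramp_ge0// /ramp ge_max subr_ge0 st andbT lerD2l lerN2.
- move=> r _; rewrite kE in_itv/=; case: ltP => //= _; rewrite -ltNge => tr.
  by rewrite /ramp max_r// subr_le0 ltW.
Qed.

End Primitives.

(** * The energy argument *)

Section QuadraticForm.
Context {R : realType} (Omega : set (pt3 R)) (A : tf3 R).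
Hypothesis mO : measurable (Omega : set (borel3 R)).
Hypothesis AL : Linf_tensor Omega A.
Hypothesis A_sym : {ae leb3 R, forall x, Omega x -> (A x)^T = A x}.

Local Notation "<| u , v |>" := (ip Omega u v) (at level 0, format "<| u ,  v |>").
Local Notation nrm := (nnorm (L2 Omega)).

Definition qform (u : vf3 R) : R := <|u, tapp A u|>.

Lemma tapp_swap u v : L2 Omega u -> L2 Omega v -> <|u, tapp A v|> = <|v, tapp A u|>.
Proof. by move=> Lu Lv; rewrite -(tapp_sym mO AL A_sym Lu Lv) ipC. Qed.

Lemma tappD u v : tapp A (u + v) = tapp A u + tapp A v.
Proof. by apply/funext => x; rewrite /tapp !fctE mulmxDr. Qed.

Lemma tappZ a u : tapp A (a *: u) = a *: tapp A u.
Proof. by apply/funext => x; rewrite /tapp !fctE -scalemxAr. Qed.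

Lemma qformD u v : L2 Omega u -> L2 Omega v ->
  qform (u + v) = qform u + 2 * <|u, tapp A v|> + qform v.
Proof.
move=> Lu Lv; have LAu := tapp_L2 mO AL Lu; have LAv := tapp_L2 mO AL Lv.
have LAD := L2D mO LAu LAv.
rewrite /qform tappD (ipDl mO) ?(ipDr mO)//.
rewrite (tapp_swap Lv Lu); ring.
Qed.

(** Expanding the square of [u + h p + rho]: besides the differential, every term
    carries the factor [h ^+ 2], since [rho] does. *)
Lemma qform_increment (T M K : R) : 0 <= T -> 0 <= M -> 0 <= K ->
  exists C : R, forall u v p h, L2 Omega u -> L2 Omega v -> L2 Omega p ->
    0 <= h <= T -> nrm u <= K -> nrm p <= K -> nrm (v - u - h *: p) <= h ^+ 2 * M ->
    qform v - qform u <= 2 * h * <|u, tapp A p|> + C * h ^+ 2.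
Proof.
move=> T0 M0 K0; have [c c0 cP] := tapp_bounded mO AL.
exists (2 * (K * (c * M)) + c * (K + T * M) ^+ 2).
move=> u v p h Lu Lv Lp /andP[h0 hT] uK pK; set rho := v - u - h *: p => rhoM.
have Lhp := L2Z mO h Lp; have Lrho : L2 Omega rho by do 2 apply: (L2B mO) => //.
pose D := h *: p + rho; have LD : L2 Omega D by exact: (L2D mO).
have -> : v = u + D by rewrite /D /rho [_ + (v - u - _)]addrC subrK addrC subrK.
rewrite qformD// /D tappD tappZ.
have LAp := tapp_L2 mO AL Lp; have LAr := tapp_L2 mO AL Lrho.
have LhAp := L2Z mO h LAp; rewrite (ipDr mO)// (ipZr mO)//.
have hK : 0 <= h * K by rewrite mulr_ge0.
have hM : 0 <= h ^+ 2 * M by rewrite mulr_ge0// sqr_ge0.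
have D1 : nrm D <= h * (K + T * M).
  apply: le_trans (nrmD mO Lhp Lrho) _; rewrite (nrmZ mO)// ger0_norm// mulrDr.
  apply: lerD; first by rewrite ler_wpM2l.
  by apply: le_trans rhoM _; rewrite expr2 -mulrA ler_wpM2l// ler_wpM2r.
have q1 : qform D <= c * (K + T * M) ^+ 2 * h ^+ 2.
  rewrite /qform; apply: le_trans (ler_norm _) _.
  apply: le_trans (ip_le mO LD (tapp_L2 mO AL LD)) _.
  apply: le_trans (ler_wpM2l (nrm_ge0 _ _) (cP _ LD)) _.
  have -> : c * (K + T * M) ^+ 2 * h ^+ 2 = (h * (K + T * M)) * (c * (h * (K + T * M))) by ring.
  by apply: ler_pM; rewrite ?nrm_ge0 ?mulr_ge0 ?nrm_ge0// ler_wpM2l.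
have r1 : <|u, tapp A rho|> <= K * (c * M) * h ^+ 2.
  apply: le_trans (ler_norm _) _; apply: le_trans (ip_le mO Lu LAr) _.
  have -> : K * (c * M) * h ^+ 2 = K * (c * (h ^+ 2 * M)) by ring.
  apply: ler_pM; rewrite ?nrm_ge0//; apply: le_trans (cP _ Lrho) _.
  by rewrite ler_wpM2l.
move: q1 r1; rewrite /D; set q := qform (_ + _); set w := <|u, tapp A rho|>.
set z := <|u, tapp A p|>; set k1 := K * _; set k2 := c * (_ ^+ 2); lra.
Qed.

End QuadraticForm.
Lemma le0_of_linear {R : realType} (x M d : R) : 0 <= M -> 0 < d ->
  (forall h, 0 < h -> h < d -> x <= h * M) -> x <= 0.
Proof.
move=> M0 d0 xh; apply/ler_addgt0Pr => e e0; rewrite add0r.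
have M1 : 0 < M + 1 by rewrite ltr_wpDl.
pose h := Num.min (e / (M + 1)) (d / 2).
have h0 : 0 < h by rewrite lt_min !divr_gt0.
have hd : h < d by rewrite gt_min (_ : d / 2 < d) ?orbT//; lra.
apply: le_trans (xh h h0 hd) _.
apply: le_trans (_ : e / (M + 1) * M <= _).
  by rewrite ler_wpM2r// ge_min lexx.
by rewrite mulrAC -mulrA ger_pMr// ler_pdivrMr ?mul1r ?lerDl.
Qed.

Section Energy.
Context {R : realType} (Omega : set (pt3 R)) (T : R) (J : set R).
Hypothesis oO : open Omega.
Hypothesis T0 : 0 < T.
Hypothesis mJ : measurable (J : set (measurableTypeR R)).
Hypothesis JT : J `<=` `]0, T[.
Let mO : measurable (Omega : set (borel3 R)) := open_measurable3 oO.

Local Notation mu := (leb1 R).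
Local Notation "<| u , v |>" := (ip Omega u v) (at level 0, format "<| u ,  v |>").
Local Notation nrm := (nnorm (L2 Omega)).
Let fJ : (mu J < +oo)%E. Proof. exact: times_lty JT. Qed.

Variables (eps nu sigma : tf3 R) (c : R).
Hypothesis eL : Linf_tensor Omega eps.
Hypothesis nL : Linf_tensor Omega nu.
Hypothesis sL : Linf_tensor Omega sigma.
Hypothesis e_sym : {ae leb3 R, forall x, Omega x -> (eps x)^T = eps x}.
Hypothesis n_sym : {ae leb3 R, forall x, Omega x -> (nu x)^T = nu x}.
Hypothesis c0 : 0 < c.
Hypothesis e_coer : {ae leb3 R, forall x, Omega x ->
  forall xi, c * dot xi xi <= dot xi (eps x *m xi)}.
Hypothesis n_psd : {ae leb3 R, forall x, Omega x -> forall xi, 0 <= dot xi (nu x *m xi)}.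
Hypothesis s_psd : {ae leb3 R, forall x, Omega x -> forall xi, 0 <= dot xi (sigma x *m xi)}.

Variables (sE sB : nat -> @simple_fun R (vf3 R)) (E B : R -> vf3 R) (M : R).
Hypothesis M0 : 0 <= M.
Hypothesis E_lim : strong_limit Omega J sE E M.
Hypothesis B_lim : strong_limit Omega J sB B M.

(** The homogeneous system with zero initial data, integrated twice in time. *)
Hypothesis ampere : forall psi t, H0curl Omega psi -> 0 < t < T ->
  \int[mu]_(r in J) (\1_(`]-oo, t[%classic) r * <|E r, tapp eps psi|>) =
  \int[mu]_(r in J) (ramp t r * (<|B r, tapp nu (curlw Omega psi)|> - <|E r, tapp sigma psi|>)).
Hypothesis faraday : forall phi t, Hcurl Omega phi -> 0 < t < T ->
  \int[mu]_(r in J) (\1_(`]-oo, t[%classic) r * <|B r, phi|>) =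
  \int[mu]_(r in J) (ramp t r * - <|E r, curlw Omega phi|>).

(** The energy argument for the second primitives, followed by the descent to the
    first ones: [PE] vanishes since [h |PE(t)|] is a Taylor remainder of order
    [h ^+ 2], and [PB] because it is minus the curl of [PPE]. *)
Lemma energy_primitives0 eta t : L2 Omega eta -> 0 < t < T ->
  \int[mu]_(r in J) (\1_(`]-oo, t[%classic) r * <|E r, eta|>) = 0 /\
  \int[mu]_(r in J) (\1_(`]-oo, t[%classic) r * <|B r, eta|>) = 0.
Proof.
have [PE [PPE EP]] := primitives mO T0 mJ JT E_lim M0.
have [PB [PPB BP]] := primitives mO T0 mJ JT B_lim M0.
have J0 r : J r -> 0 < r by move=> /JT; rewrite /= in_itv/= => /andP[].
have oo s : 0 < s < T -> 0 <= s <= T by move=> /andP[? ?]; rewrite !ltW.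
(* [ampere] and [faraday], read as identities between the primitives *)
have amp psi s : H0curl Omega psi -> 0 < s < T ->
    <|PE s, tapp eps psi|> = <|PPB s, tapp nu (curlw Omega psi)|> - <|PPE s, tapp sigma psi|>.
  move=> Hpsi sT; have /EP[_ _ eE _ _] := oo _ sT; have /BP[_ _ eB _ _] := oo _ sT.
  have Lpsi := Hcurl_L2 (H0curl_Hcurl Hpsi); have Lc := curlw_L2 (H0curl_Hcurl Hpsi).
  have Le := tapp_L2 mO eL Lpsi; have Ls := tapp_L2 mO sL Lpsi; have Ln := tapp_L2 mO nL Lc.
  rewrite (eE _ Le).1 ampere// (eB _ Ln).2 (eE _ Ls).2.
  have sle : s <= T by case/andP: sT => _ /ltW.
  have i1 := integrable_ramp mO T0 mJ JT B_lim sle Ln.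
  have i2 := integrable_ramp mO T0 mJ JT E_lim sle Ls.
  rewrite -(RintegralB mJ i1 i2); apply: eq_Rintegral => r _; exact: mulrBr.
have far phi s : Hcurl Omega phi -> 0 < s < T -> <|- PB s, phi|> = <|PPE s, curlw Omega phi|>.
  move=> Hphi sT; have /EP[_ _ eE _ _] := oo _ sT; have /BP[LB _ eB _ _] := oo _ sT.
  have Lphi := Hcurl_L2 Hphi; have Lc := curlw_L2 Hphi.
  rewrite (ipNl mO)// (eB _ Lphi).1 faraday// (eE _ Lc).2.
  have sle : s <= T by case/andP: sT => _ /ltW.
  have i := integrable_ramp mO T0 mJ JT E_lim sle Lc.
  rewrite -mulN1r -(RintegralZl _ mJ); last first.
    have := integrable_EFinZ mJ (-1) i; apply: eq_integrable => // r _; congr EFin; ring.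
  by apply: eq_Rintegral => r _; ring.
(* the left-hand side is half the derivative of the energy [y] below *)
have energy_diss s : 0 < s < T ->
    <|PPE s, tapp eps (PE s)|> + <|PPB s, tapp nu (PB s)|> <= 0.
  move=> sT; have /EP[LPE LPPE _ _ _] := oo _ sT; have /BP[LPB LPPB _ _ _] := oo _ sT.
  have LN := L2N mO LPB.
  have [H0 wc] := H0curl_by_parts oO LPPE LN (fun phi H => far phi s H sT).
  have Hc := H0curl_Hcurl H0; have Lc := curlw_L2 Hc.
  have LnB := tapp_L2 mO nL LPPB.
  rewrite (tapp_swap mO eL e_sym LPPE LPE) (amp _ _ H0 sT) (tapp_swap mO nL n_sym LPPB Lc).
  rewrite (curlw_unique oO Hc LN wc)// (ipNl mO)// (tapp_swap mO nL n_sym LPB LPPB).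
  have := tapp_psd mO sL s_psd LPPE; set a := <|_, tapp sigma _|>; set b := <|_, tapp nu _|>; lra.
pose y t := qform Omega eps (PPE t) + qform Omega nu (PPB t).
have z0 : 0 <= (0 : R) <= T by rewrite lexx ltW.
have ramp0 r : J r -> ramp 0 r = 0.
  by move=> Jr; rewrite /ramp sub0r max_r// oppr_le0 ltW// J0.
have int0 (f : R -> R) : \int[mu]_(r in J) (ramp 0 r * f r) = 0.
  rewrite -[RHS](mul0r (fine (mu J))) -Rintegral_cst//; apply: eq_Rintegral => r.
  by rewrite inE => Jr; rewrite ramp0// mul0r.
have PPE0 v : L2 Omega v -> <|PPE 0, v|> = 0.
  have /EP[_ _ eE _ _] := z0 => Lv; rewrite (eE _ Lv).2.
  exact: int0.
have PPB0 v : L2 Omega v -> <|PPB 0, v|> = 0.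
  have /BP[_ _ eB _ _] := z0 => Lv; rewrite (eB _ Lv).2.
  exact: int0.
have TM0 : 0 <= T * M by rewrite mulr_ge0// ltW.
have TTM0 : 0 <= T * T * M by rewrite -mulrA mulr_ge0// ltW.
pose K := T * M + T * T * M.
have K0 : 0 <= K by rewrite addr_ge0.
have K1 : T * M <= K by rewrite lerDl.
have K2 : T * T * M <= K by rewrite lerDr.
have [C1 C1P] := qform_increment mO eL e_sym (ltW T0) M0 K0.
have [C2 C2P] := qform_increment mO nL n_sym (ltW T0) M0 K0.
have yle r : 0 <= r < T -> y r <= 0.
  apply: (@square_increments_le _ T (C1 + C2)).
    have /EP[_ LE _ _ _] := z0; have /BP[_ LB _ _ _] := z0.
    by rewrite /y /qform PPE0 ?PPB0 ?addr0//; exact: tapp_L2.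
  move=> s {}r s0 sr rT.
  have sT : 0 <= s <= T by rewrite s0 ltW// (le_lt_trans sr).
  have rT' : 0 <= r <= T by rewrite (le_trans s0)// ltW.
  have /EP[LEs LEEs _ [nEs nEEs] _] := sT; have /BP[LBs LBBs _ [nBs nBBs] _] := sT.
  have /EP[_ LEEr _ _ tE] := rT'; have /BP[_ LBBr _ _ tB] := rT'.
  have h0 : 0 <= r - s <= T.
    by rewrite subr_ge0 sr lerBlDr (le_trans (ltW rT))// lerDl.
  have sr' : 0 <= s <= r by rewrite s0.
  have h1 := C1P _ _ _ _ LEEs LEEr LEs h0 (le_trans nEEs K2) (le_trans nEs K1) (tE _ sr').
  have h2 := C2P _ _ _ _ LBBs LBBr LBs h0 (le_trans nBBs K2) (le_trans nBs K1) (tB _ sr').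
  rewrite /y; set q1 := <|_, _|> in h1; set q2 := <|_, _|> in h2.
  have diss : 2 * (r - s) * (q1 + q2) <= 0.
    have [s_eq0|s_neq0] := eqVneq s 0.
      rewrite /q1 /q2 s_eq0 PPE0 ?PPB0 ?addr0 ?mulr0//;
        by apply: (tapp_L2 mO) => //; rewrite -s_eq0.
    apply: mulr_ge0_le0; first by rewrite mulr_ge0// subr_ge0.
    by apply: energy_diss; rewrite lt_neqAle eq_sym s_neq0 s0 (le_lt_trans sr).
  move: h1 h2 diss; set w := _ ^+ 2; set q3 := qform _ _ _; set q4 := qform _ _ _.
  set q5 := qform _ _ _; set q6 := qform _ _ _; lra.
have PPE_eq0 s v : 0 <= s < T -> L2 Omega v -> <|PPE s, v|> = 0.
  move=> sT Lv; have sT' : 0 <= s <= T by case/andP: sT => -> /ltW.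
  have /EP[_ LE _ _ _] := sT'; have /BP[_ LB _ _ _] := sT'.
  have h1 := tapp_coercive mO eL e_coer LE; have h2 := tapp_psd mO nL n_psd LB.
  have h3 := yle _ sT; rewrite /y /qform in h3.
  apply: (nrm_eq0_ip mO) => //; apply/eqP; rewrite eq_le ip_ge0 andbT.
  rewrite -(pmulr_rle0 _ c0); move: h1 h2 h3; set a := ip _ _ (tapp eps _); set b := ip _ _ (tapp nu _); lra.
move=> Le tT; have tT' := oo _ tT; have [t0 tltT] := andP tT.
have /EP[LE LPE eE _ _] := tT'; have /BP[LB LPB eB _ _] := tT'.
have tT0 : 0 <= t < T by rewrite ltW.
rewrite -(eE _ Le).1 -(eB _ Le).1; split.
  apply: (nrm_eq0_ip mO) => //; rewrite -nrm_sqr; apply/eqP; rewrite sqrf_eq0 -normr_le0.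
  rewrite (ger0_norm (nrm_ge0 _ _)).
  (* as [PPE] vanishes, the Taylor remainder at [t] is [- h *: PE t] *)
  have bound h : 0 < h -> h < T - t -> nrm (PE t) <= h * M.
    move=> h0 hT; have th0 : 0 <= t + h by rewrite addr_ge0// ltW.
    have thT : t + h < T by rewrite -ltrBrDl.
    have rT : 0 <= t + h <= T by rewrite th0 ltW.
    have /EP[_ LPr _ _ tay] := rT.
    have := tay t; rewrite (ltW t0) lerDl (ltW h0) => /(_ isT).
    have -> : t + h - t = h by ring.
    have LD := L2B mO LPr LPE; have Lh := L2Z mO h LE; have LX := L2B mO LD Lh.
    have -> : nrm (PPE (t + h) - PPE t - h *: PE t) = h * nrm (PE t).
      have PPr v : L2 Omega v -> <|PPE (t + h), v|> = 0.
        by move=> Lv; apply: PPE_eq0 => //; rewrite th0.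
      have PPt v : L2 Omega v -> <|PPE t, v|> = 0 by exact: PPE_eq0.
      rewrite -[h in RHS](gtr0_norm h0) -(nrmZ mO)// /=; congr Num.sqrt.
      rewrite (ipBl mO)// (ipBl mO)// PPr// PPt// subrr sub0r (ipBr mO)// (ipBr mO)//.
      by rewrite (ipC Omega (h *: PE t) (PPE _)) PPr// (ipC Omega (h *: PE t) (PPE _)) PPt// subrr sub0r opprK.
    by rewrite expr2 -mulrA ler_pM2l.
  by apply: (le0_of_linear M0 _ bound); rewrite subr_gt0.
rewrite -[RHS](ip0l mO Le); apply: (ip_eq_test oO LB (L20 Omega) Le) => theta tth.
rewrite (ip0l mO); last exact: test_field_L2.
have Hth := test_field_Hcurl oO tth.
have := far _ _ Hth tT; rewrite (ipNl mO)//; last exact: Hcurl_L2.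
by rewrite PPE_eq0//; [move/eqP; rewrite oppr_eq0 => /eqP|exact: curlw_L2].
Qed.

End Energy.

(** * Uniqueness *)

(** By [strong_limit_eq0] it suffices to test with countably many fields, and each
    of them costs a null set of times. *)
Lemma strong_limit_ae_eq0 {R : realType} (Omega : set (pt3 R)) (T : R) (J : set R)
    (s : nat -> @simple_fun R (vf3 R)) (u : R -> vf3 R) (M : R) :
  measurable (Omega : set (borel3 R)) -> measurable (J : set (measurableTypeR R)) ->
  J `<=` `]0, T[%classic -> strong_limit Omega J s u M ->
  (forall eta t, L2 Omega eta -> 0 < t < T ->
    \int[leb1 R]_(r in J) (\1_(`]-oo, t[%classic) r * ip Omega (u r) eta) = 0) ->
  {ae leb1 R, forall t, J t -> ip Omega (u t) (u t) = 0}.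
Proof.
move=> mO mJ JT su u0; have [ws _ _ _] := su.
have : {ae leb1 R, forall t, forall n, J t ->
    forall i : 'I_(sf_size (s n)), ip Omega (u t) (sf_val i) = 0}.
  apply: ae_foralln => n.
  have : \forall t \ae leb1 R, forall i : 'I_(sf_size (s n)), J t -> ip Omega (u t) (sf_val i) = 0.
    apply: filter_forall => i; have Lv : L2 Omega (sf_val i) by case: (ws n i).
    apply: (ae_eq0_of_primitive mJ JT (strong_limit_measurable mO su Lv)).
      by move=> t Jt; exact: (strong_limit_ip_le mO su Jt Lv).
    by move=> t t0; exact: u0.
  by apply: filterS => t ut Jt i; exact: ut.
by apply: filterS => t ut Jt; apply: (strong_limit_eq0 mO su Jt) => n i; exact: ut.
Qed.

Lemma strong_limitW {R : realType} (Omega : set (pt3 R)) (J : set R)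
    (s : nat -> @simple_fun R (vf3 R)) (u : R -> vf3 R) (M M' : R) :
  M <= M' -> strong_limit Omega J s u M -> strong_limit Omega J s u M'.
Proof. by move=> MM' [? ? uM ?]; split => // t Jt; apply: le_trans (uM _ Jt) MM'. Qed.

(** Being bounded, a family of fields that tends to zero weakly against test
    fields does so against all square integrable fields. In Ampere's law the field
    is paired with [eps psi], which is not an admissible test field in general. *)
Lemma initial_trace_L2 {R : realType} (Omega : set (pt3 R)) (J : set R)
    (s : nat -> @simple_fun R (vf3 R)) (u : R -> vf3 R) (M : R) :
  open Omega -> 0 <= M -> strong_limit Omega J s u M ->
  (forall theta, test_field Omega theta -> forall del : R, 0 < del ->
    exists2 tau : R, 0 < tau & forall r, J r -> r < tau -> `|ip Omega (u r) theta| <= del) ->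
  forall eta, L2 Omega eta -> forall del : R, 0 < del ->
    exists2 tau : R, 0 < tau & forall r, J r -> r < tau -> `|ip Omega (u r) eta| <= del.
Proof.
move=> oO M0 su u0 eta Le del del0; have mO := open_measurable3 oO.
have M1 : 0 < M + 1 by rewrite ltr_wpDl.
have d0 : 0 < del / 2 / (M + 1) by rewrite !divr_gt0.
have [theta tth eth] := test_field_dense oO Le d0.
have [tau tau0 tauP] := u0 _ tth _ (divr_gt0 del0 (ltr0n _ 2)).
exists tau => // r Jr rtau; have Lth := test_field_L2 oO tth; have LB := L2B mO Le Lth.
have Lu := sl_L2 su Jr.
have -> : ip Omega (u r) eta = ip Omega (u r) theta + ip Omega (u r) (eta - theta).
  by rewrite (ipBr mO)// addrC subrK.
apply: le_trans (ler_normD _ _) _; rewrite [leRHS](splitr del); apply: lerD; first exact: tauP.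
apply: le_trans (strong_limit_ip_le mO su Jr LB) _.
apply: le_trans (ler_wpM2l M0 eth) _.
by rewrite mulrCA ger_pMr ?divr_gt0// ler_pdivrMr ?mul1r ?lerDl.
Qed.

(** The difference of two solutions of evolution equations in the dual of [X],
    paired with a fixed [psi] and integrated twice in time. Only the differences
    [e] and [d] are bounded; the terms of [d] separately, which contain the
    forcing, are merely integrable. *)
Lemma weak_primitive {R : realType} {W : lmodType R} (X : nspace W) (T : R) (J : set R)
    (u1 u2 d1 d2 : R -> W -> R) (psi : W) (e d : R -> R) (M : R) :
  0 < T -> seminormed X -> measurable (J : set (measurableTypeR R)) ->
  J `<=` `]0, T[%classic -> leb1 R (`]0, T[%classic `\` J) = 0%E -> X psi ->
  (forall t, J t -> [/\ dual X (u1 t), dual X (u2 t), dual X (d1 t) & dual X (d2 t)]) ->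
  [/\ measurable_fun (J : set (measurableTypeR R)) (fun t => u1 t psi),
      measurable_fun (J : set (measurableTypeR R)) (fun t => u2 t psi),
      measurable_fun (J : set (measurableTypeR R)) (fun t => d1 t psi) &
      measurable_fun (J : set (measurableTypeR R)) (fun t => d2 t psi)] ->
  weak_time_deriv (dual X) T u1 d1 -> weak_time_deriv (dual X) T u2 d2 ->
  (forall t, J t -> u1 t psi - u2 t psi = e t /\ d1 t psi - d2 t psi = d t) ->
  (forall t, J t -> `|e t| <= M /\ `|d t| <= M) ->
  (forall del : R, 0 < del -> exists2 tau : R, 0 < tau &
     forall r, J r -> r < tau -> `|e r| <= del) ->
  forall t, 0 < t < T ->
  \int[leb1 R]_(r in J) (\1_(`]-oo, t[%classic) r * e r) =
  \int[leb1 R]_(r in J) (ramp t r * d r).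
Proof.
move=> T0 sX mJ JT fullJ Xpsi dual_ud [mu1 mu2 md1 md2] wd1 wd2 ed edM e0.
apply: (time_primitive T0 mJ JT (M := M)) => //.
- apply: (eq_measurable_fun (fun t => u1 t psi - u2 t psi)).
    by move=> t; rewrite inE => Jt; case: (ed _ Jt).
  exact: measurable_funB.
- apply: (eq_measurable_fun (fun t => d1 t psi - d2 t psi)).
    by move=> t; rewrite inE => Jt; case: (ed _ Jt).
  exact: measurable_funB.
- by move=> r /edM[].
- by move=> r /edM[].
move=> theta tth; have [sth _ _] := tth.
have mth : measurable_fun (J : set (measurableTypeR R)) theta.
  apply: measurable_funTS; apply: continuous_measurable_fun.
  by have [] := sth [::].
have mdth : measurable_fun (J : set (measurableTypeR R)) (derive1 theta).
  apply: measurable_funTS; apply: continuous_measurable_fun.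
  have [/= c _] := sth [:: 1].
  by have -> : derive1 theta = 'D_1 theta by apply/funext => x; rewrite derive1E.
have apply_deriv (u d' : R -> W -> R) : (forall t, J t -> dual X (u t)) ->
    (forall t, J t -> dual X (d' t)) ->
    measurable_fun (J : set (measurableTypeR R)) (fun t => u t psi) ->
    measurable_fun (J : set (measurableTypeR R)) (fun t => d' t psi) ->
    weak_time_deriv (dual X) T u d' ->
    [/\ (leb1 R).-integrable J (fun t => (derive1 theta t * u t psi)%:E),
        (leb1 R).-integrable J (fun t => (theta t * d' t psi)%:E) &
        \int[leb1 R]_(t in J) (derive1 theta t * u t psi) =
        - \int[leb1 R]_(t in J) (theta t * d' t psi)].
  move=> du dd mu md /(_ _ tth)[w [bu bd]].
  have [i1 e1] := bochner_apply sX mJ JT fullJ Xpsi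
    (fun t Jt => dual_scale _ (du t Jt)) (measurable_funM mdth mu) bu.
  have [i2 e2] := bochner_apply sX mJ JT fullJ Xpsi
    (fun t Jt => dual_scale _ (dd t Jt)) (measurable_funM mth md) bd.
  by split => //; rewrite -[LHS]e1 -[X in - X]e2 opprK.
have [i1 j1 ud1] := apply_deriv u1 d1 (fun t Jt => let: And4 h _ _ _ := dual_ud t Jt in h)
  (fun t Jt => let: And4 _ _ h _ := dual_ud t Jt in h) mu1 md1 wd1.
have [i2 j2 ud2] := apply_deriv u2 d2 (fun t Jt => let: And4 _ h _ _ := dual_ud t Jt in h)
  (fun t Jt => let: And4 _ _ _ h := dual_ud t Jt in h) mu2 md2 wd2.
transitivity (\int[leb1 R]_(r in J) (derive1 theta r * u1 r psi - derive1 theta r * u2 r psi)).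
  by apply: eq_Rintegral => r; rewrite inE => Jr; rewrite -mulrBr (ed _ Jr).1.
rewrite (RintegralB mJ i1 i2) ud1 ud2 -opprD -(RintegralB mJ j1 j2); apply: congr1.
by apply: eq_Rintegral => r; rewrite inE => Jr; rewrite -mulrBr (ed _ Jr).2.
Qed.

Section Solutions.
Context {R : realType} (Omega : set (pt3 R)) (T : R).
Variables (eps nu sigma : tf3 R) (f : R -> vf3 R) (E0 B0 : vf3 R).

Local Notation "<| u , v |>" := (ip Omega u v) (at level 0, format "<| u ,  v |>").
Local Notation mfun J g := (measurable_fun (J : set (measurableTypeR R)) g).

(** What the weak formulation says at the times of a set [J] where its almost
    everywhere statements hold. *)
Record solution_on (J : set R) (sE sB : nat -> @simple_fun R (vf3 R)) (M : R)
    (E B : R -> vf3 R) (dD dB : R -> vf3 R -> R) : Prop := {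
  so_E : strong_limit Omega J sE E M;
  so_B : strong_limit Omega J sB B M;
  so_dD : forall t, J t -> dual (H0curl Omega) (dD t);
  so_dB : forall t, J t -> dual (Hcurl Omega) (dB t);
  so_mdD : forall psi, H0curl Omega psi -> mfun J (fun t => dD t psi);
  so_mdB : forall phi, Hcurl Omega phi -> mfun J (fun t => dB t phi);
  so_D : weak_time_deriv (dual (H0curl Omega)) T (fun t => emb Omega (tapp eps (E t))) dD;
  so_F : weak_time_deriv (dual (Hcurl Omega)) T (fun t => emb Omega (B t)) dB;
  so_ampere : forall t psi, J t -> H0curl Omega psi ->
    dD t psi + <|tapp sigma (E t), psi|> - <|tapp nu (B t), curlw Omega psi|> = <|f t, psi|>;
  so_faraday : forall t phi, J t -> Hcurl Omega phi ->
    dB t phi + <|E t, curlw Omega phi|> = 0;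
  so_E0 : forall psi, H0curl Omega psi -> forall del : R, 0 < del ->
    exists2 tau : R, 0 < tau &
      forall r, J r -> r < tau -> `|<|E r, psi|> - <|E0, psi|>| <= del;
  so_B0 : forall phi, Hcurl Omega phi -> forall del : R, 0 < del ->
    exists2 tau : R, 0 < tau &
      forall r, J r -> r < tau -> `|<|B r, phi|> - <|B0, phi|>| <= del }.

End Solutions.

Section WeakSolution.
Context {R : realType} (Omega : set (pt3 R)) (T : R).
Hypothesis oO : open Omega.
Hypothesis T0 : 0 < T.
Let mO : measurable (Omega : set (borel3 R)) := open_measurable3 oO.
Local Notation leb := (leb1 R).

Lemma Linft_strong_limit (u : R -> vf3 R) : Linft (L2 Omega) T u ->
  exists (s : nat -> @simple_fun R (vf3 R)) (M : R) (J0 : set R),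
    {ae leb, forall t, `]0, T[%classic t -> J0 t} /\
    forall J, (forall t, J t -> `]0, T[%classic t /\ J0 t) -> strong_limit Omega J s u M.
Proof.
move=> [[s [ws sc]] [M uM]].
exists s, M, (fun t => (L2 Omega (u t) /\
  nnorm (L2 Omega) (sf_eval (s n) t - u t) @[n --> \oo] --> 0) /\ nnorm (L2 Omega) (u t) <= M).
split; first by apply: filterS2 sc uM => t h1 h2 It; split; [exact: h1|exact: h2].
by move=> J JP; split => // t /JP[_ [[]]].
Qed.

Lemma strongly_measurable_dual (X : nspace (vf3 R)) (u : R -> vf3 R -> R) : seminormed X ->
  strongly_measurable (dual X) T u ->
  exists J0 : set R, {ae leb, forall t, `]0, T[%classic t -> J0 t} /\
    forall J, measurable (J : set (measurableTypeR R)) ->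
      (forall t, J t -> `]0, T[%classic t /\ J0 t) ->
      (forall t, J t -> dual X (u t)) /\
      forall psi, X psi -> measurable_fun (J : set (measurableTypeR R)) (fun t => u t psi).
Proof.
move=> sX [s [ws sc]].
exists (fun t => dual X (u t) /\ nnorm (dual X) (sf_eval (s n) t - u t) @[n --> \oo] --> 0).
split => // J mJ JP; split; first by move=> t /JP[_ []].
move=> psi Xpsi; apply: (strongly_measurable_apply sX ws Xpsi) => t /JP[_ []].
by [].
Qed.

(** The set [J0] avoids the finitely many exceptional null sets; it is kept apart
    from [J] so that two solutions can be read on a common [J]. *)
Lemma solution_on_ae (eps mu sigma : tf3 R) f (E0 B0 : vf3 R) (E B : R -> vf3 R) :
  maxwell_weak_solution Omega T eps mu sigma f E0 B0 E B ->
  exists sE sB M dD dB (J0 : set R), {ae leb, forall t, `]0, T[%classic t -> J0 t} /\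
    forall J, measurable (J : set (measurableTypeR R)) ->
      (forall t, J t -> `]0, T[%classic t /\ J0 t) ->
      solution_on Omega T eps (fun x => invmx (mu x)) sigma f E0 B0 J sE sB M E B dD dB.
Proof.
move=> [_ EL _ BL [dD [[mD _] wD amp]] [dB [[mB _] wB far]] iE iB _].
have sH0 := seminormed_H0curl oO; have sH := seminormed_Hcurl oO.
have [sE [ME [J1 [J1ae E_lim]]]] := Linft_strong_limit EL.
have [sB [MB [J2 [J2ae B_lim]]]] := Linft_strong_limit BL.
have [J3 [J3ae dDP]] := strongly_measurable_dual sH0 mD.
have [J4 [J4ae dBP]] := strongly_measurable_dual sH mB.
have dE : {ae leb, forall t, `]0, T[%classic t -> dual (H0curl Omega) (emb Omega (E t))}.
  case: EL => -[s [_ +]] _; apply: filterS => t /[apply] -[LE _].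
  exact: (emb_dual_H0curl oO).
have dB' : {ae leb, forall t, `]0, T[%classic t -> dual (Hcurl Omega) (emb Omega (B t))}.
  case: BL => -[s [_ +]] _; apply: filterS => t /[apply] -[LB _].
  exact: (emb_dual_Hcurl oO).
have [J5 [J5ae E0P]] := initial_value_apply T0 sH0 dE iE.
have [J6 [J6ae B0P]] := initial_value_apply T0 sH dB' iB.
pose J7 t := forall psi, H0curl Omega psi ->
  dD t psi + ip Omega (tapp sigma (E t)) psi
  - ip Omega (tapp (fun x => invmx (mu x)) (B t)) (curlw Omega psi) = ip Omega (f t) psi.
pose J8 t := forall phi, Hcurl Omega phi -> dB t phi + ip Omega (E t) (curlw Omega phi) = 0.
exists sE, sB, (`|ME| + `|MB|), dD, dB,
  (fun t => ((J1 t /\ J2 t) /\ (J3 t /\ J4 t)) /\ ((J5 t /\ J6 t) /\ (J7 t /\ J8 t))).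
split.
  have filter_and (P Q : set R) : {ae leb, forall t, `]0, T[%classic t -> P t} ->
      {ae leb, forall t, `]0, T[%classic t -> Q t} ->
      {ae leb, forall t, `]0, T[%classic t -> P t /\ Q t}.
    by apply: filterS2 => t h1 h2 It; split; [exact: h1|exact: h2].
  exact: (filter_and _ _ (filter_and _ _ (filter_and _ _ J1ae J2ae) (filter_and _ _ J3ae J4ae))
    (filter_and _ _ (filter_and _ _ J5ae J6ae) (filter_and _ _ amp far))).
move=> J mJ JP.
have P1 t : J t -> `]0, T[%classic t /\ J1 t by move=> /JP[? [[[]]]].
have P2 t : J t -> `]0, T[%classic t /\ J2 t by move=> /JP[? [[[]]]].
have P3 t : J t -> `]0, T[%classic t /\ J3 t by move=> /JP[? [[_ []]]].
have P4 t : J t -> `]0, T[%classic t /\ J4 t by move=> /JP[? [[_ []]]].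
have P5 t : J t -> `]0, T[%classic t /\ J5 t by move=> /JP[? [_ [[]]]].
have P6 t : J t -> `]0, T[%classic t /\ J6 t by move=> /JP[? [_ [[]]]].
have [dd1 dd2] := dDP _ mJ P3; have [db1 db2] := dBP _ mJ P4.
split => //.
- apply: strong_limitW (E_lim _ P1); apply: le_trans (ler_norm _) _; by rewrite lerDl.
- apply: strong_limitW (B_lim _ P2); apply: le_trans (ler_norm _) _; by rewrite lerDr.
- by move=> t psi /JP[_ [_ [_ []]]] + _; apply.
- by move=> t phi /JP[_ [_ [_ []]]] _; apply.
- move=> psi Hpsi del /(E0P _ Hpsi)[tau tau0 tauP]; exists tau => // r Jr.
  by have [Ir J5r] := P5 _ Jr; exact: tauP.
- move=> phi Hphi del /(B0P _ Hphi)[tau tau0 tauP]; exists tau => // r Jr.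
  by have [Ir J6r] := P6 _ Jr; exact: tauP.
Qed.

End WeakSolution.

Section TwoSolutions.
Context {R : realType} (Omega : set (pt3 R)) (T : R) (J : set R).
Hypothesis oO : open Omega.
Hypothesis T0 : 0 < T.
Hypothesis mJ : measurable (J : set (measurableTypeR R)).
Hypothesis JT : J `<=` `]0, T[.
Hypothesis fullJ : leb1 R (`]0, T[%classic `\` J) = 0%E.
Let mO : measurable (Omega : set (borel3 R)) := open_measurable3 oO.

Local Notation leb := (leb1 R).
Local Notation "<| u , v |>" := (ip Omega u v) (at level 0, format "<| u ,  v |>").
Local Notation nrm := (nnorm (L2 Omega)).
Local Notation mfun g := (measurable_fun (J : set (measurableTypeR R)) g).

Variables (eps nu sigma : tf3 R) (f : R -> vf3 R) (E0 B0 : vf3 R).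
Hypothesis eL : Linf_tensor Omega eps.
Hypothesis nL : Linf_tensor Omega nu.
Hypothesis sL : Linf_tensor Omega sigma.
Hypothesis e_sym : {ae leb3 R, forall x, Omega x -> (eps x)^T = eps x}.
Hypothesis n_sym : {ae leb3 R, forall x, Omega x -> (nu x)^T = nu x}.
Hypothesis s_sym : {ae leb3 R, forall x, Omega x -> (sigma x)^T = sigma x}.

Variables (sE1 sB1 sE2 sB2 : nat -> @simple_fun R (vf3 R)) (M1 M2 : R).
Variables (E1 B1 E2 B2 : R -> vf3 R) (dD1 dB1 dD2 dB2 : R -> vf3 R -> R).
Hypothesis S1 : solution_on Omega T eps nu sigma f E0 B0 J sE1 sB1 M1 E1 B1 dD1 dB1.
Hypothesis S2 : solution_on Omega T eps nu sigma f E0 B0 J sE2 sB2 M2 E2 B2 dD2 dB2.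

Let E t := E1 t - E2 t.
Let B t := B1 t - B2 t.
Let M := `|M1| + `|M2|.
Let M0 : 0 <= M. Proof. by rewrite addr_ge0. Qed.
Let MM : M1 + M2 <= M. Proof. by apply: lerD; exact: ler_norm. Qed.

Lemma difference_E_limit :
  strong_limit Omega J (fun n => sf_sub (sE1 n) (sE2 n)) E M.
Proof. by apply: strong_limitW MM _; apply: (strong_limitB mO (so_E S1) (so_E S2)). Qed.

Lemma difference_B_limit :
  strong_limit Omega J (fun n => sf_sub (sB1 n) (sB2 n)) B M.
Proof. by apply: strong_limitW MM _; apply: (strong_limitB mO (so_B S1) (so_B S2)). Qed.

Let dist_half (x y z del : R) : `|x - z| <= del / 2 -> `|y - z| <= del / 2 -> `|x - y| <= del.
Proof.
move=> h1 h2; have -> : x - y = (x - z) - (y - z) by ring.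
by apply: le_trans (ler_normB _ _) _; rewrite [leRHS]splitr lerD.
Qed.

(** Both solutions start from [E0]. *)
Lemma difference_E_initial eta : L2 Omega eta -> forall del : R, 0 < del ->
  exists2 tau : R, 0 < tau & forall r, J r -> r < tau -> `|<|E r, eta|>| <= del.
Proof.
apply: (initial_trace_L2 oO M0 difference_E_limit) => theta tth del del0.
have Hth := test_field_H0curl oO tth; have Lth := test_field_L2 oO tth.
have d2 : 0 < del / 2 by rewrite divr_gt0.
have [t1 t10 h1] := so_E0 S1 Hth d2; have [t2 t20 h2] := so_E0 S2 Hth d2.
exists (Num.min t1 t2); first by rewrite lt_min t10.
move=> r Jr; rewrite lt_min => /andP[r1 r2].
have L1 := sl_L2 (so_E S1) Jr; have L2' := sl_L2 (so_E S2) Jr.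
by rewrite (ipBl mO)//; apply: (dist_half (h1 _ Jr r1) (h2 _ Jr r2)).
Qed.

Lemma difference_B_initial eta : L2 Omega eta -> forall del : R, 0 < del ->
  exists2 tau : R, 0 < tau & forall r, J r -> r < tau -> `|<|B r, eta|>| <= del.
Proof.
apply: (initial_trace_L2 oO M0 difference_B_limit) => theta tth del del0.
have Hth := test_field_Hcurl oO tth; have Lth := test_field_L2 oO tth.
have d2 : 0 < del / 2 by rewrite divr_gt0.
have [t1 t10 h1] := so_B0 S1 Hth d2; have [t2 t20 h2] := so_B0 S2 Hth d2.
exists (Num.min t1 t2); first by rewrite lt_min t10.
move=> r Jr; rewrite lt_min => /andP[r1 r2].
have L1 := sl_L2 (so_B S1) Jr; have L2' := sl_L2 (so_B S2) Jr.
by rewrite (ipBl mO)//; apply: (dist_half (h1 _ Jr r1) (h2 _ Jr r2)).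
Qed.

Let measurable_emb_tapp (s : nat -> @simple_fun R (vf3 R)) (u : R -> vf3 R) (K : R) psi :
  strong_limit Omega J s u K -> L2 Omega psi ->
  mfun (fun t => emb Omega (tapp eps (u t)) psi).
Proof.
move=> su Lpsi; apply: (eq_measurable_fun (fun t => <|u t, tapp eps psi|>)).
  move=> t; rewrite inE => Jt.
  by rewrite /emb (tapp_sym mO eL e_sym)//; exact: (sl_L2 su).
exact: (strong_limit_measurable mO su (tapp_L2 mO eL Lpsi)).
Qed.

(** The symmetry of the tensors moves them to the fixed factor [psi], and the
    forcing terms cancel. *)
Lemma difference_ampere psi t : H0curl Omega psi -> 0 < t < T ->
  \int[leb]_(r in J) (\1_(`]-oo, t[%classic) r * <|E r, tapp eps psi|>) =
  \int[leb]_(r in J) (ramp t r * (<|B r, tapp nu (curlw Omega psi)|> - <|E r, tapp sigma psi|>)).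
Proof.
move=> Hpsi; have Hc := H0curl_Hcurl Hpsi; have Lpsi := Hcurl_L2 Hc.
have Lc := curlw_L2 Hc; have Le := tapp_L2 mO eL Lpsi; have Ls := tapp_L2 mO sL Lpsi.
have Ln := tapp_L2 mO nL Lc.
have LE1 r : J r -> L2 Omega (E1 r) by exact: (sl_L2 (so_E S1)).
have LE2 r : J r -> L2 Omega (E2 r) by exact: (sl_L2 (so_E S2)).
have LB1 r : J r -> L2 Omega (B1 r) by exact: (sl_L2 (so_B S1)).
have LB2 r : J r -> L2 Omega (B2 r) by exact: (sl_L2 (so_B S2)).
apply: (@weak_primitive _ _ (H0curl Omega) T J (fun t => emb Omega (tapp eps (E1 t)))
  (fun t => emb Omega (tapp eps (E2 t))) dD1 dD2 psi (fun r => <|E r, tapp eps psi|>)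
  (fun r => <|B r, tapp nu (curlw Omega psi)|> - <|E r, tapp sigma psi|>)
  (M * nrm (tapp eps psi) + (M * nrm (tapp nu (curlw Omega psi)) + M * nrm (tapp sigma psi)))
  T0 (seminormed_H0curl oO) mJ JT fullJ Hpsi).
- move=> r Jr; split; [| |exact: (so_dD S1)|exact: (so_dD S2)].
    by apply: (emb_dual_H0curl oO); apply: (tapp_L2 mO eL); exact: LE1.
  by apply: (emb_dual_H0curl oO); apply: (tapp_L2 mO eL); exact: LE2.
- split; [exact: measurable_emb_tapp (so_E S1) Lpsi|exact: measurable_emb_tapp (so_E S2) Lpsi
    |exact: (so_mdD S1)|exact: (so_mdD S2)].
- exact: (so_D S1).
- exact: (so_D S2).
- move=> r Jr; have {}LE1 := LE1 r Jr; have {}LE2 := LE2 r Jr.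
  have {}LB1 := LB1 r Jr; have {}LB2 := LB2 r Jr; split.
    by rewrite /emb !(tapp_sym mO eL e_sym)// (ipBl mO).
  have := so_ampere S1 Jr Hpsi; have := so_ampere S2 Jr Hpsi.
  rewrite !(tapp_sym mO sL s_sym)// !(tapp_sym mO nL n_sym)//.
  rewrite /E /B !(ipBl mO)//.
  set a1 := <|E1 r, _|>; set a2 := <|E2 r, _|>; set b1 := <|B1 r, _|>; set b2 := <|B2 r, _|>.
  set g := <|f r, _|> => h2 h1.
  have -> : dD1 r psi = g - a1 + b1 by rewrite -h1; ring.
  have -> : dD2 r psi = g - a2 + b2 by rewrite -h2; ring.
  ring.
- move=> r Jr.
  have e1 := strong_limit_ip_le mO difference_E_limit Jr Le.
  have e2 := strong_limit_ip_le mO difference_E_limit Jr Ls.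
  have e3 := strong_limit_ip_le mO difference_B_limit Jr Ln.
  have pos u : 0 <= M * nrm u by rewrite mulr_ge0// nrm_ge0.
  split; first by rewrite (le_trans e1)// lerDl addr_ge0.
  by apply: le_trans (ler_normB _ _) _; rewrite (le_trans (lerD e3 e2))// lerDr.
- exact: difference_E_initial.
Qed.

Lemma difference_faraday phi t : Hcurl Omega phi -> 0 < t < T ->
  \int[leb]_(r in J) (\1_(`]-oo, t[%classic) r * <|B r, phi|>) =
  \int[leb]_(r in J) (ramp t r * - <|E r, curlw Omega phi|>).
Proof.
move=> Hphi; have Lphi := Hcurl_L2 Hphi; have Lc := curlw_L2 Hphi.
have LE1 r : J r -> L2 Omega (E1 r) by exact: (sl_L2 (so_E S1)).
have LE2 r : J r -> L2 Omega (E2 r) by exact: (sl_L2 (so_E S2)).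
have LB1 r : J r -> L2 Omega (B1 r) by exact: (sl_L2 (so_B S1)).
have LB2 r : J r -> L2 Omega (B2 r) by exact: (sl_L2 (so_B S2)).
apply: (@weak_primitive _ _ (Hcurl Omega) T J (fun t => emb Omega (B1 t))
  (fun t => emb Omega (B2 t)) dB1 dB2 phi (fun r => <|B r, phi|>)
  (fun r => - <|E r, curlw Omega phi|>)
  (M * nrm phi + M * nrm (curlw Omega phi))
  T0 (seminormed_Hcurl oO) mJ JT fullJ Hphi).
- move=> r Jr; split; [| |exact: (so_dB S1)|exact: (so_dB S2)].
    by apply: (emb_dual_Hcurl oO); exact: LB1.
  by apply: (emb_dual_Hcurl oO); exact: LB2.
- split; [exact: (strong_limit_measurable mO (so_B S1))|exact: (strong_limit_measurable mO (so_B S2))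
    |exact: (so_mdB S1)|exact: (so_mdB S2)].
- exact: (so_F S1).
- exact: (so_F S2).
- move=> r Jr; have {}LE1 := LE1 r Jr; have {}LE2 := LE2 r Jr.
  have {}LB1 := LB1 r Jr; have {}LB2 := LB2 r Jr; split.
    by rewrite /emb (ipBl mO).
  have := so_faraday S1 Jr Hphi; have := so_faraday S2 Jr Hphi.
  rewrite /E (ipBl mO)// => /eqP; rewrite addr_eq0 => /eqP -> /eqP.
  by rewrite addr_eq0 => /eqP ->; ring.
- move=> r Jr.
  have e1 := strong_limit_ip_le mO difference_B_limit Jr Lphi.
  have e2 := strong_limit_ip_le mO difference_E_limit Jr Lc.
  have pos u : 0 <= M * nrm u by rewrite mulr_ge0// nrm_ge0.
  by split; [rewrite (le_trans e1)// lerDl|rewrite normrN (le_trans e2)// lerDr].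
- exact: difference_B_initial.
Qed.

End TwoSolutions.

Theorem theorem1 (R : realType) (Omega : set (pt3 R)) (T : R)
  (eps mu sigma : tf3 R) (eps0 mu0 : R)
  (f : R -> vf3 R) (E0 B0 : vf3 R) (E1 B1 E2 B2 : R -> vf3 R)
  (Omega_dom : bounded_lipschitz_domain Omega) (T_gt0 : 0 < T)
  (eps_Linf : Linf_tensor Omega eps)
  (mu_Linf : Linf_tensor Omega mu)
  (sigma_Linf : Linf_tensor Omega sigma)
  (eps_sym : {ae leb3 R, forall x, Omega x -> (eps x)^T = eps x})
  (mu_sym : {ae leb3 R, forall x, Omega x -> (mu x)^T = mu x})
  (sigma_sym : {ae leb3 R, forall x, Omega x -> (sigma x)^T = sigma x})
  (eps0_gt0 : 0 < eps0) (mu0_gt0 : 0 < mu0)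
  (eps_coer : {ae leb3 R, forall x, Omega x ->
    forall xi, eps0 * dot xi xi <= dot xi (eps x *m xi)})
  (mu_coer : {ae leb3 R, forall x, Omega x ->
    forall xi, mu0 * dot xi xi <= dot xi (mu x *m xi)})
  (sigma_psd : {ae leb3 R, forall x, Omega x ->
    forall xi, 0 <= dot xi (sigma x *m xi)})
  (f_L2 : L2t (L2 Omega) T f)
  (E0_L2 : L2 Omega E0) (B0_L2 : L2 Omega B0) (B0_div : weak_div Omega B0 (cst 0))
  (sol1 : maxwell_weak_solution Omega T eps mu sigma f E0 B0 E1 B1)
  (sol2 : maxwell_weak_solution Omega T eps mu sigma f E0 B0 E2 B2) :
  {ae leb1 R, forall t, `]0, T[%classic t ->
    {ae leb3 R, forall x, Omega x -> E1 t x = E2 t x /\ B1 t x = B2 t x}}.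
Proof.
have [_ oO _ _ _] := Omega_dom; have mO := open_measurable3 oO.
have [sE1 [sB1 [M1 [dD1 [dB1 [J1 [J1ae S1]]]]]]] := solution_on_ae oO T_gt0 sol1.
have [sE2 [sB2 [M2 [dD2 [dB2 [J2 [J2ae S2]]]]]]] := solution_on_ae oO T_gt0 sol2.
have J12 : {ae leb1 R, forall t, `]0, T[%classic t -> J1 t /\ J2 t}.
  by apply: filterS2 J1ae J2ae => t h1 h2 It; split; [exact: h1|exact: h2].
have [J [mJ JT fullJ JP]] := ae_full_set J12.
have {}S1 := S1 J mJ (fun t Jt => conj (JT t Jt) (proj1 (JP t Jt))).
have {}S2 := S2 J mJ (fun t Jt => conj (JT t Jt) (proj2 (JP t Jt))).
have nL := Linf_tensor_invmx mO mu0_gt0 mu_Linf mu_coer.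
have n_sym := invmx_sym mu_sym; have n_psd := invmx_psd mu0_gt0 mu_coer.
have E_lim := difference_E_limit oO S1 S2; have B_lim := difference_B_limit oO S1 S2.
have M0 : 0 <= `|M1| + `|M2| by rewrite addr_ge0.
have prim0 eta t : L2 Omega eta -> 0 < t < T -> _ :=
  @energy_primitives0 R Omega T J oO T_gt0 mJ JT eps _ sigma eps0 eps_Linf nL sigma_Linf
    eps_sym n_sym eps0_gt0 eps_coer n_psd sigma_psd _ _ _ _ _ M0 E_lim B_lim
    (fun psi t => difference_ampere oO T_gt0 mJ JT fullJ eps_Linf nL sigma_Linf
       eps_sym n_sym sigma_sym S1 S2 (psi := psi) (t := t))
    (fun phi t => difference_faraday oO T_gt0 mJ JT fullJ S1 S2 (phi := phi) (t := t)) eta t.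
have E_eq0 := strong_limit_ae_eq0 mO mJ JT E_lim (fun eta t Le t0 => proj1 (prim0 eta t Le t0)).
have B_eq0 := strong_limit_ae_eq0 mO mJ JT B_lim (fun eta t Le t0 => proj2 (prim0 eta t Le t0)).
have J_ae : {ae leb1 R, forall t, `]0, T[%classic t -> J t}.
  exists (`]0, T[%classic `\` J); split => //.
    by apply: measurableD => //; exact: measurable_itv.
  move=> t /= nJ; split; first by apply: contrapT => nI; apply: nJ => /nI.
  by move=> Jt; apply: nJ.
apply: filterS3 J_ae E_eq0 B_eq0 => t It_J Et Bt It.
have Jt := It_J It.
have Eae := ip_eq0_ae mO (sl_L2 E_lim Jt) (Et Jt).
have Bae := ip_eq0_ae mO (sl_L2 B_lim Jt) (Bt Jt).
apply: filterS2 Eae Bae => x Ex Bx Ox; split; apply/eqP; rewrite -subr_eq0; apply/eqP.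
  exact: Ex.
exact: Bx.
Qed.
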